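(* Let $s_j=\sigma_j+it_j\in\mathbb{C}$ ($j=1,2,3$) with $\sigma_1\ge0$, $\sigma_3>0$, $\tfrac12<\sigma_1+\sigma_3\le1$, $\sigma_1+\sigma_2+\sigma_3>2$, $t_1\ge0$ and $t_3\ge2$, with $s_1,s_2,\sigma_3$ fixed. Assume that as $t_3$ runs from $2$ to $T$ the point $(s_1,s_2,s_3)$ never lies on the hyperplane $s_1+s_3=1$. Then as $T\to\infty$, $$\int_2^T|\zeta_{AV,2}(s_1,s_2,s_3)|^2dt_3=\zeta_{AV,2}^{[2]}(s_1,s_2,2\sigma_3)T+\begin{cases}O(T^{2-2\sigma_1-2\sigma_3}\log T)&(\tfrac12<\sigma_1+\sigma_3\le\tfrac34),\\ O(T^{1/2})&(\tfrac34<\sigma_1+\sigma_3\le1),\end{cases}$$ where the implied constants depend on $s_1,s_2$ and $\sigma_3$.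
   Context: Write $s_j=\sigma_j+it_j$ with $\sigma_j,t_j\in\mathbb{R}$; complex powers $n^{s}=e^{s\log n}$ use the real logarithm. The Apostol–Vu double zeta-function is $\zeta_{AV,2}(s_1,s_2,s_3)=\sum_{m=1}^\infty\sum_{n<m}m^{-s_1}n^{-s_2}(m+n)^{-s_3}$ (positive integers $n<m$), absolutely convergent for $\sigma_1+\sigma_3>1$, $\sigma_1+\sigma_2+\sigma_3>2$, and extended meromorphically to $\mathbb{C}^3$ (singularities only on $s_1+s_3=1-l$, $s_1+s_2+s_3=2-l$, $l\in\mathbb{Z}_{\ge0}$); $\zeta_{AV,2}$ denotes this continuation. Also $\zeta_{AV,2}^{[2]}(s_1,s_2,s_3)=\sum_{k=2}^\infty\left|\sum_{k/2<m\le k-1}m^{-s_1}(k-m)^{-s_2}\right|^2k^{-s_3}$. *)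

(* Defs.v *)
From Stdlib Require Import Reals.
From Coquelicot Require Import Coquelicot.
Open Scope R_scope.

Definition npow_neg (n : nat) (s : C) : C :=
  (exp (- Re s * ln (INR n)) * cos (- Im s * ln (INR n)),
   exp (- Re s * ln (INR n)) * sin (- Im s * ln (INR n))).

Definition AV_inner (s1 s2 s3 : C) (m : nat) : C :=
  sum_n_m (fun n => Cmult (Cmult (npow_neg m s1) (npow_neg n s2))
                          (npow_neg (m + n) s3)) 1 (m - 1).

(* The open slice domain, for fixed s1, s2, on which the continuation
   s3 |-> zeta_{AV,2}(s1,s2,s3) is holomorphic:
   Re s3 > 2 - Re s1 - Re s2 and s1 + s3 <> 1 - l for every l in N
   (the other singular hyperplanes s1+s2+s3 = 2-l lie outside). *)
Definition AV_slice_domain (s1 s2 : C) (z : C) : Prop :=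
  2 - Re s1 - Re s2 < Re z /\ forall l : nat, Cplus s1 z <> RtoC (1 - INR l).

(* Z is the (meromorphic continuation of) zeta_{AV,2}(s1,s2,.) on the slice:
   holomorphic on the slice domain and equal to the double series in the
   region of absolute convergence. *)
Definition is_zetaAV2_slice (s1 s2 : C) (Z : C -> C) : Prop :=
  (forall z, AV_slice_domain s1 s2 z -> ex_derive (K := C_AbsRing) Z z) /\
  (forall z, 1 < Re s1 + Re z -> 2 < Re s1 + Re s2 + Re z ->
     is_series (K := C_AbsRing) (AV_inner s1 s2 z) (Z z)).

Definition AV2_inner (s1 s2 : C) (k : nat) : C :=
  sum_n_m (fun m => Cmult (npow_neg m s1) (npow_neg (k - m) s2))
          (Nat.div k 2 + 1) (k - 1).

Definition zetaAV2_sq (s1 s2 : C) (sigma3 : R) : R :=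
  Series (fun k => (Cmod (AV2_inner s1 s2 k)) ^ 2 * exp (- (2 * sigma3) * ln (INR k))).

(* Main.v *)
Require Import Defs.
From Stdlib Require Import Reals Lra Lia ClassicalEpsilon.
From Coquelicot Require Import Coquelicot.
Open Scope R_scope.
Set Bullet Behavior "Strict Subproofs".

(** Collecting the terms with [m + n = k] gives a Dirichlet series in [s3] whose coefficients
    are [a_k = zeta(s2) k^(-s1) + r_k], where [sum r_k k^(-sigma3)] converges absolutely.
    Hence, with [w = s1 + s3], the continuation is the limit of
    [sum_(k < M) a_k k^(-s3) + zeta(s2) M^(1-w) / (w-1)].  That this limit is the given [Z] is
    unique continuation on a disc centred in the half-plane of convergence; since [Z] is only
    assumed complex differentiable, this rests on Goursat's theorem.
    On a dyadic range [U <= t3 <= 2U] the sum is cut at [N] of order [U].  The part of the zeta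
    series beyond [N] is [O(N^(-sigma))] by the Kusmin-Landau method ([sigma = Re w]), and the
    [r_k] beyond [N] have bounded mean square.  The mean square of the Dirichlet polynomial
    [sum_(k < N) a_k k^(-s3)] is its diagonal plus [O(U^(2-2 sigma) log U)], and the cross terms
    with the bounded-mean-square error cost [O(U^(1/2))].  *)

(** * Complex exponential *)

(** Pointwise, the [r_k] beyond [N] only give [O(N^(1-beta))], where [beta = sigma + kappa - 1 > 1]
    may be very close to 1; this is too weak for the error term. That block is therefore kept as a
    second Dirichlet polynomial, running up to some [M] possibly far beyond [N], and measured in
    mean square uniformly in [M]. The size of [N] is dictated from both sides: Kusmin-Landau
    summation needs [16 |w| <= N], while a longer polynomial has larger off-diagonal terms. These
    are bounded pair by pair, through the frequency [ln l - ln k] of each product, and the resulting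
    harmonic sums produce the logarithm. The off-diagonal constant contains [1 / (1 - tau)] for
    coefficients of size [k^(-tau)], so the estimates run with some [tau <= sigma] and [tau < 1]
    instead of [sigma] itself. When [sigma > 3/4], such a [tau] can stay above [3/4], which leaves
    room to absorb the logarithm into [T^(1/2)]. *)

Lemma exp_mono (x y : R) : x <= y -> exp x <= exp y.
Proof. intros [H| ->]; [left; now apply exp_increasing|lra]. Qed.

Lemma sin_abs_le (x : R) : Rabs (sin x) <= Rabs x.
Proof.
destruct (MVT_gen sin 0 x cos) as [c [_ Hc]].
- intros y _. apply is_derive_sin.
- intros y _. apply continuity_sin.
- rewrite sin_0, !Rminus_0_r in Hc. rewrite Hc, Rabs_mult.
  rewrite <- (Rmult_1_l (Rabs x)) at 2.
  apply Rmult_le_compat_r; [apply Rabs_pos|].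
  apply Rabs_le; destruct (COS_bound c); lra.
Qed.

Lemma one_minus_cos_le (x : R) : 0 <= 1 - cos x <= x ^ 2 / 2.
Proof.
pose proof (sin_abs_le (x / 2)) as H.
assert (E : 1 - cos x = 2 * sin (x / 2) ^ 2).
{ replace x with (2 * (x / 2)) at 1 by field. rewrite cos_2a_sin. ring. }
rewrite E. apply Rsqr_le_abs_1 in H. unfold Rsqr in H. nra.
Qed.

Lemma sin_minus_id_le (x : R) : Rabs (sin x - x) <= Rabs x ^ 3.
Proof.
destruct (MVT_gen (fun x => sin x - x) 0 x (fun x => cos x - 1)) as [c [H1 Hc]].
- intros y _. auto_derive; [easy|ring].
- intros y _. apply (continuity_pt_minus sin (fun x => x)).
  apply continuity_sin. apply derivable_continuous_pt, derivable_pt_id.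
- rewrite sin_0 in Hc. replace (sin x - x) with ((cos c - 1) * x) by lra.
  rewrite Rabs_mult. replace (Rabs x ^ 3) with (Rabs x ^ 2 * Rabs x) by ring.
  apply Rmult_le_compat_r; [apply Rabs_pos|].
  destruct (one_minus_cos_le c). rewrite Rabs_left1 by lra.
  assert (Rabs c <= Rabs x).
  { revert H1. unfold Rmin, Rmax. destruct (Rle_dec 0 x); intros; apply Rabs_le;
    unfold Rabs; destruct (Rcase_abs x); lra. }
  rewrite <- !Rsqr_pow2, <- Rsqr_abs. apply Rsqr_le_abs_1 in H2.
  rewrite Rsqr_pow2 in *. rewrite Rsqr_pow2 in H2. nra.
Qed.

Lemma exp_taylor1 (x : R) : Rabs x <= 1 -> Rabs (exp x - 1) <= 3 * Rabs x.
Proof.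
intros Hx. destruct (MVT_gen exp 0 x exp) as [c [H1 Hc]].
- intros y _. apply is_derive_exp.
- intros y _. apply derivable_continuous_pt, derivable_pt_exp.
- rewrite exp_0, Rminus_0_r in Hc. rewrite Hc, Rabs_mult.
  apply Rmult_le_compat_r; [apply Rabs_pos|].
  rewrite Rabs_pos_eq by (left; apply exp_pos).
  apply Rle_trans with (exp 1); [|apply exp_le_3].
  apply exp_mono. revert H1. apply Rabs_le_between in Hx.
  unfold Rmin, Rmax; destruct (Rle_dec 0 x); lra.
Qed.

Lemma exp_taylor2 (x : R) : Rabs x <= 1 -> Rabs (exp x - 1 - x) <= 3 * x ^ 2.
Proof.
intros Hx. destruct (MVT_gen (fun x => exp x - 1 - x) 0 x (fun x => exp x - 1)) as [c [H1 Hc]].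
- intros y _. auto_derive; [easy|ring].
- intros y _. apply derivable_continuous_pt.
  apply (derivable_pt_minus (fun x => exp x - 1) (fun x => x)); [|apply derivable_pt_id].
  apply (derivable_pt_minus exp (fun x => 1)); [apply derivable_pt_exp|apply derivable_pt_const].
- rewrite exp_0 in Hc. replace (exp x - 1 - x) with ((exp c - 1) * x) by lra.
  rewrite Rabs_mult.
  assert (Rabs c <= Rabs x).
  { revert H1. unfold Rmin, Rmax. destruct (Rle_dec 0 x); intros; apply Rabs_le;
    unfold Rabs; destruct (Rcase_abs x); lra. }
  assert (H2 : Rabs (exp c - 1) <= 3 * Rabs c) by (apply exp_taylor1; lra).
  rewrite <- Rsqr_pow2, (Rsqr_abs x). unfold Rsqr. pose proof (Rabs_pos x). nra.
Qed.

Lemma cosh_minus_one_le (x : R) : Rabs x <= 1 -> Rabs (cosh x - 1) <= 3 * x ^ 2.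
Proof.
intros Hx. pose proof (exp_taylor2 x Hx) as H1.
assert (H2 : Rabs (exp (- x) - 1 - - x) <= 3 * (- x) ^ 2).
{ apply exp_taylor2. now rewrite Rabs_Ropp. }
replace (cosh x - 1) with (((exp x - 1 - x) + (exp (- x) - 1 - - x)) / 2)
  by (unfold cosh; field).
apply Rabs_le. apply Rabs_le_between in H1, H2. nra.
Qed.

Lemma sinh_minus_id_le (x : R) : Rabs x <= 1 -> Rabs (sinh x - x) <= 3 * Rabs x ^ 3.
Proof.
intros Hx.
destruct (MVT_gen (fun x => sinh x - x) 0 x (fun x => cosh x - 1)) as [c [H1 Hc]].
- intros y _. unfold sinh, cosh. auto_derive; [easy|field].
- intros y _. apply (continuity_pt_minus sinh (fun x => x));
  apply derivable_continuous_pt; [apply derivable_pt_sinh|apply derivable_pt_id].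
- rewrite sinh_0 in Hc. replace (sinh x - x) with ((cosh c - 1) * x) by lra.
  rewrite Rabs_mult.
  assert (Rabs c <= Rabs x).
  { revert H1. unfold Rmin, Rmax. destruct (Rle_dec 0 x); intros; apply Rabs_le;
    unfold Rabs; destruct (Rcase_abs x); lra. }
  assert (H2 : Rabs (cosh c - 1) <= 3 * c ^ 2) by (apply cosh_minus_one_le; lra).
  rewrite <- Rsqr_pow2, (Rsqr_abs c) in H2. unfold Rsqr in H2.
  replace (3 * Rabs x ^ 3) with (3 * (Rabs x * Rabs x) * Rabs x) by ring.
  apply Rmult_le_compat_r; [apply Rabs_pos|].
  pose proof (Rabs_pos c). nra.
Qed.

Definition cexp (z : C) : C := (exp (Re z) * cos (Im z), exp (Re z) * sin (Im z)).

Lemma cexp_plus (a b : C) : cexp (a + b)%C = (cexp a * cexp b)%C.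
Proof.
destruct a, b. unfold cexp. apply injective_projections; simpl; rewrite exp_plus;
[rewrite cos_plus|rewrite sin_plus]; ring.
Qed.

Lemma cexp_0 : cexp 0 = RtoC 1.
Proof.
unfold cexp; apply injective_projections; simpl; rewrite exp_0; [rewrite cos_0|rewrite sin_0]; ring.
Qed.

Lemma cexp_opp_l (z : C) : (cexp (- z) * cexp z)%C = RtoC 1.
Proof. rewrite <- cexp_plus, <- cexp_0. f_equal. ring. Qed.

Lemma Cmod_cexp (z : C) : Cmod (cexp z) = exp (Re z).
Proof.
unfold Cmod, cexp; simpl.
replace (_ + _) with ((exp (Re z)) ^ 2 * ((sin (Im z))² + (cos (Im z))²)) by (unfold Rsqr; ring).
rewrite sin2_cos2, Rmult_1_r, sqrt_pow2; auto. left; apply exp_pos.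
Qed.

Lemma cexp_neq_0 (z : C) : cexp z <> RtoC 0.
Proof. intros H. pose proof (exp_pos (Re z)) as H1. rewrite <- Cmod_cexp, H, Cmod_0 in H1. lra. Qed.

Lemma im_le_Cmod (z : C) : Rabs (Im z) <= Cmod z.
Proof. eapply Rle_trans; [|apply Rmax_Cmod]. apply Rmax_r. Qed.

Lemma Cmod_le_sum (z : C) : Cmod z <= Rabs (Re z) + Rabs (Im z).
Proof.
destruct z as [x y]. replace (x, y) with (RtoC x + RtoC y * Ci)%C.
- eapply Rle_trans; [apply Cmod_triangle|]. rewrite Cmod_mult, !Cmod_R, Cmod_Ci. simpl.
  replace (x + _) with x by ring. replace (0 + _) with y by ring. lra.
- apply injective_projections; simpl; ring.
Qed.

Lemma Cmod_rev_triangle (a b : C) : Cmod a - Cmod b <= Cmod (a - b).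
Proof.
pose proof (Cmod_triangle (a - b) b) as H. replace (a - b + b)%C with a in H by ring. lra.
Qed.

Lemma Cmod_minus_sym (a b : C) : Cmod (a - b) = Cmod (b - a).
Proof. rewrite <- Cmod_opp. f_equal. ring. Qed.

Lemma Cmod_triangle_minus (a b : C) : Cmod (a - b) <= Cmod a + Cmod b.
Proof. unfold Cminus. eapply Rle_trans; [apply Cmod_triangle|]. rewrite Cmod_opp. lra. Qed.

Lemma cexp_taylor2 (z : C) : Cmod z <= 1 -> Cmod (cexp z - 1 - z) <= 8 * Cmod z ^ 2.
Proof.
intros Hz. destruct z as [a b]. pose proof (re_le_Cmod (a, b)) as Ha.
pose proof (im_le_Cmod (a, b)) as Hb. set (r := Cmod (a, b)) in *. simpl in Ha, Hb.
eapply Rle_trans; [apply Cmod_le_sum|]. simpl.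
assert (Ea : Rabs (exp a - 1) <= 3 * Rabs a) by (apply exp_taylor1; lra).
assert (Ea2 : Rabs (exp a - 1 - a) <= 3 * a ^ 2) by (apply exp_taylor2; lra).
pose proof (one_minus_cos_le b) as Hc. pose proof (sin_abs_le b) as Hs.
pose proof (sin_minus_id_le b) as Hs3. pose proof (exp_pos a).
assert (A1 : Rabs (exp a * cos b + - (1) + - a) <= 2 * b ^ 2 + 3 * a ^ 2).
{ replace (_ + - a) with ((exp a - 1 - a) - exp a * (1 - cos b)) by ring.
  assert (exp a <= 4). { apply Rabs_le_between in Ea. pose proof (Rabs_pos a). lra. }
  apply Rabs_le. apply Rabs_le_between in Ea2. nra. }
assert (A2 : Rabs (exp a * sin b + - 0 + - b) <= 3 * Rabs a * Rabs b + Rabs b ^ 3).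
{ replace (_ + - b) with ((exp a - 1) * sin b + (sin b - b)) by ring.
  eapply Rle_trans; [apply Rabs_triang|]. rewrite Rabs_mult.
  apply Rplus_le_compat; auto; apply Rmult_le_compat; auto using Rabs_pos. }
assert (r2 : a ^ 2 + b ^ 2 = r ^ 2).
{ unfold r. now rewrite Cmod2_alt. }
rewrite <- (Rsqr_pow2 a), (Rsqr_abs a), Rsqr_pow2 in A1, r2.
rewrite <- (Rsqr_pow2 b), (Rsqr_abs b), Rsqr_pow2 in A1, r2.
pose proof (Rabs_pos a). pose proof (Rabs_pos b).
assert (Rabs b ^ 3 <= Rabs b ^ 2) by nra.
nra.
Qed.

Lemma cexp_minus_one_neg (z : C) : Re z <= 0 -> Cmod (cexp z - 1) <= 2 * Cmod z.
Proof.
intros Hz. destruct z as [a b]. simpl in Hz.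
pose proof (re_le_Cmod (a, b)) as Ha. pose proof (im_le_Cmod (a, b)) as Hb. simpl in Ha, Hb.
replace (cexp (a, b) - 1)%C with (RtoC (exp a - 1)%R + RtoC (exp a) * ((cos b - 1)%R, sin b))%C.
2:{ unfold cexp; apply injective_projections; simpl; ring. }
eapply Rle_trans; [apply Cmod_triangle|]. rewrite Cmod_mult, !Cmod_R.
assert (E1 : exp a <= 1). { rewrite <- exp_0. now apply exp_mono. }
assert (E2 : Rabs (exp a - 1) <= Rabs a).
{ pose proof (exp_ineq1_le a). rewrite !Rabs_left1; lra. }
assert (E3 : Cmod (cos b - 1, sin b) <= Rabs b).
{ unfold Cmod; simpl. rewrite <- sqrt_Rsqr_abs. apply sqrt_le_1_alt.
  destruct (one_minus_cos_le b). pose proof (sin2_cos2 b). unfold Rsqr in *. nra. }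
rewrite (Rabs_pos_eq (exp a)) by (left; apply exp_pos).
pose proof (exp_pos a). pose proof (Cmod_ge_0 (cos b - 1, sin b)). nra.
Qed.

(** Factoring out the exponential of larger modulus leaves an exponent of nonpositive real part,
    where [|exp z - 1| <= 2 |z|] holds without any smallness condition. *)
Lemma cexp_lipschitz (u v : C) (B : R) : exp (Re u) <= B -> exp (Re v) <= B ->
  Cmod (cexp u - cexp v) <= 2 * B * Cmod (u - v).
Proof.
assert (W : forall u v, exp (Re u) <= B -> Re v <= Re u ->
  Cmod (cexp u - cexp v) <= 2 * B * Cmod (u - v)).
{ clear u v. intros u v Hu Hv.
  replace (cexp u - cexp v)%C with (- (cexp u * (cexp (v - u) - 1)))%C.
  - rewrite Cmod_opp, Cmod_mult, Cmod_cexp.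
    assert (Cmod (cexp (v - u) - 1) <= 2 * Cmod (v - u)).
    { apply cexp_minus_one_neg. change (Re v - Re u <= 0). lra. }
    rewrite (Cmod_minus_sym u v).
    pose proof (exp_pos (Re u)). pose proof (Cmod_ge_0 (v - u)).
    pose proof (Cmod_ge_0 (cexp (v - u) - 1)). nra.
  - replace (cexp v) with (cexp u * cexp (v - u))%C; [ring|].
    rewrite <- cexp_plus. f_equal. ring. }
intros Hu Hv. destruct (Rle_dec (Re v) (Re u)).
- now apply W.
- rewrite Cmod_minus_sym, (Cmod_minus_sym u). apply W; auto; lra.
Qed.

Definition csinh (z : C) : C := ((cexp z - cexp (- z)) / 2)%C.

(** Oddness makes the error cubic, one order better than for [cexp]. The relative error is then
    quadratic, which is what the increments of [geo] require. *)
Lemma csinh_minus_id_le (z : C) : Cmod z <= 1 -> Cmod (csinh z - z) <= 8 * Cmod z ^ 3.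
Proof.
intros Hz. destruct z as [a b].
assert (E : csinh (a, b) = (sinh a * cos b, cosh a * sin b)).
{ unfold csinh, cexp, sinh, cosh. apply injective_projections; simpl;
  rewrite cos_neg, sin_neg; field. }
rewrite E. pose proof (re_le_Cmod (a, b)) as Ha.
pose proof (im_le_Cmod (a, b)) as Hb. set (r := Cmod (a, b)) in *. simpl in Ha, Hb.
eapply Rle_trans; [apply Cmod_le_sum|]. simpl.
assert (S : Rabs (sinh a - a) <= 3 * Rabs a ^ 3) by (apply sinh_minus_id_le; lra).
assert (K : Rabs (cosh a - 1) <= 3 * a ^ 2) by (apply cosh_minus_one_le; lra).
pose proof (one_minus_cos_le b) as Hc. pose proof (sin_abs_le b) as Hs.
pose proof (sin_minus_id_le b) as Hs3.
rewrite <- (Rsqr_pow2 a), (Rsqr_abs a), Rsqr_pow2 in K.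
rewrite <- (Rsqr_pow2 b), (Rsqr_abs b), Rsqr_pow2 in Hc.
pose proof (Rabs_pos a). pose proof (Rabs_pos b).
assert (A1 : Rabs (sinh a * cos b + - a) <= 3 * Rabs a ^ 3 + Rabs a * (Rabs b ^ 2 / 2)).
{ replace (_ + - a) with ((sinh a - a) * cos b + a * (cos b - 1)) by ring.
  eapply Rle_trans; [apply Rabs_triang|]. rewrite !Rabs_mult.
  assert (Rabs (cos b) <= 1) by (apply Rabs_le; destruct (COS_bound b); lra).
  assert (Rabs (cos b - 1) <= Rabs b ^ 2 / 2) by (rewrite Rabs_left1; lra).
  pose proof (Rabs_pos (cos b)). pose proof (Rabs_pos (sinh a - a)).
  apply Rplus_le_compat; nra. }
assert (A2 : Rabs (cosh a * sin b + - b) <= 3 * Rabs a ^ 2 * Rabs b + Rabs b ^ 3).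
{ replace (_ + - b) with ((cosh a - 1) * sin b + (sin b - b)) by ring.
  eapply Rle_trans; [apply Rabs_triang|]. rewrite Rabs_mult.
  apply Rplus_le_compat; auto; apply Rmult_le_compat; auto using Rabs_pos. }
eapply Rle_trans; [apply Rplus_le_compat; eassumption|].
assert (Q : forall x y z, 0 <= x <= r -> 0 <= y <= r -> 0 <= z <= r -> x * y * z <= r ^ 3).
{ intros x y z ? ? ?. replace (r ^ 3) with (r * r * r) by ring.
  apply Rmult_le_compat; nra. }
assert (Q1 := Q (Rabs a) (Rabs a) (Rabs a)). assert (Q2 := Q (Rabs a) (Rabs b) (Rabs b)).
assert (Q3 := Q (Rabs a) (Rabs a) (Rabs b)). assert (Q4 := Q (Rabs b) (Rabs b) (Rabs b)).
specialize (Q1 ltac:(lra) ltac:(lra) ltac:(lra)). specialize (Q2 ltac:(lra) ltac:(lra) ltac:(lra)).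
specialize (Q3 ltac:(lra) ltac:(lra) ltac:(lra)). specialize (Q4 ltac:(lra) ltac:(lra) ltac:(lra)).
assert (0 <= r ^ 3) by (apply pow_le; lra). lra.
Qed.

(** * Pole part of 1 / (1 - exp (- v)) *)

Lemma Rle_of_deriv_nonneg (f df : R -> R) (a b : R) : a <= b ->
  (forall x, a <= x <= b -> is_derive f x (df x)) ->
  (forall x, a <= x <= b -> 0 <= df x) -> f a <= f b.
Proof.
intros Hab Hd Hp.
destruct (MVT_gen f a b df) as [c [Hc E]].
- intros x Hx. rewrite Rmin_left, Rmax_right in Hx by lra. apply Hd; lra.
- intros x Hx. rewrite Rmin_left, Rmax_right in Hx by lra.
  apply continuity_pt_filterlim, (ex_derive_continuous f). exists (df x). apply Hd; lra.
- rewrite Rmin_left, Rmax_right in Hc by lra. specialize (Hp c Hc). nra.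
Qed.

(** With [s = exp u] this is [u <= sinh u]. *)
Lemma ln_upper_hyperbolic (s : R) : 1 <= s -> 2 * ln s <= s - / s.
Proof.
intros Hs.
assert (H : 1 - / 1 - 2 * ln 1 <= s - / s - 2 * ln s).
{ apply (Rle_of_deriv_nonneg (fun s => s - / s - 2 * ln s) (fun s => (1 - / s) ^ 2)); auto.
  - intros x Hx. auto_derive; [lra|field; lra].
  - intros x _. apply pow2_ge_0. }
rewrite ln_1 in H. lra.
Qed.

Lemma ln_lower_pade (y : R) : 0 <= y -> 2 * y / (2 + y) <= ln (1 + y).
Proof.
intros Hy.
assert (H : ln (1 + 0) - 2 * 0 / (2 + 0) <= ln (1 + y) - 2 * y / (2 + y)).
{ apply (Rle_of_deriv_nonneg (fun y => ln (1 + y) - 2 * y / (2 + y))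
    (fun y => y ^ 2 / ((1 + y) * (2 + y) ^ 2))); auto.
  - intros x Hx. auto_derive; [lra|field; lra].
  - intros x Hx. apply Rmult_le_pos; [apply pow2_ge_0|].
    left. apply Rinv_0_lt_compat. nra. }
rewrite Rplus_0_r, ln_1 in H. lra.
Qed.

(** Equal to [ln (x + 1) - ln x]. With [v = w lstep k], the ratio of consecutive terms of
    [sum k^(-w)] is [exp (- v)]. *)
Definition lstep (x : R) : R := ln (1 + / x).

Lemma lstep_lower (x : R) : 0 < x -> / (x + / 2) <= lstep x.
Proof.
intros Hx. unfold lstep. pose proof (Rinv_0_lt_compat x Hx).
replace (/ (x + / 2)) with (2 * / x / (2 + / x)) by (field; lra).
apply ln_lower_pade; lra.
Qed.

Lemma lstep_sqr_upper (x : R) : 0 < x -> lstep x ^ 2 <= / (x * (x + 1)).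
Proof.
intros Hx. pose proof (Rinv_0_lt_compat x Hx) as Hi.
(* Then [lstep x = 2 ln s], and [(s - 1/s)^2] is exactly [1 / (x (x + 1))]. *)
set (s := sqrt (1 + / x)).
assert (Hs2 : s * s = 1 + / x) by (apply sqrt_sqrt; lra).
assert (Hs : 1 <= s). { unfold s. rewrite <- sqrt_1 at 1. apply sqrt_le_1_alt. lra. }
assert (E : lstep x = 2 * ln s).
{ unfold lstep. rewrite <- Hs2, ln_mult; lra. }
assert (0 <= ln s). { rewrite <- ln_1. apply ln_le; lra. }
pose proof (ln_upper_hyperbolic s Hs) as H1. rewrite E.
replace (/ (x * (x + 1))) with ((s - / s) ^ 2).
- apply pow_incr; lra.
- replace ((s - / s) ^ 2) with (s * s - 2 + / (s * s)) by (field; lra).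
  rewrite Hs2. field. lra.
Qed.

Lemma lstep_pos (x : R) : 0 < x -> 0 < lstep x.
Proof. intros Hx. eapply Rlt_le_trans; [|apply lstep_lower; auto]. apply Rinv_0_lt_compat; lra. Qed.

Lemma lstep_upper (x : R) : 0 < x -> lstep x <= / x.
Proof.
intros Hx. pose proof (Rinv_0_lt_compat x Hx).
pose proof (exp_ineq1_le (/ x)). unfold lstep.
rewrite <- (ln_exp (/ x)) at 2. apply ln_le; lra.
Qed.

(** The derivative of [1 / lstep] is [1 / (x (x + 1) lstep(x)^2)], and the two sharp bounds on
    [lstep] squeeze it between 1 and [1 + 1 / (4 x (x + 1))]. So [1 / lstep] grows by 1 per step up
    to a summable error. *)
Lemma inv_lstep_step (x : R) : 1 <= x -> 0 <= / lstep (x + 1) - / lstep x - 1 <= / x ^ 2.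
Proof.
intros Hx.
destruct (MVT_gen (fun x => / lstep x) x (x + 1) (fun x => / (x * (x + 1) * lstep x ^ 2)))
  as [c [Hc E]].
- intros y Hy. rewrite Rmin_left, Rmax_right in Hy by lra.
  pose proof (lstep_pos y). unfold lstep in *.
  assert (0 < / y) by (apply Rinv_0_lt_compat; lra).
  auto_derive; [repeat split; lra|].
  field. repeat split; lra.
- intros y Hy. rewrite Rmin_left, Rmax_right in Hy by lra.
  pose proof (lstep_pos y). unfold lstep in *.
  assert (0 < / y) by (apply Rinv_0_lt_compat; lra).
  apply continuity_pt_filterlim, (ex_derive_continuous (fun x => / ln (1 + / x))).
  auto_derive. repeat split; lra.
- rewrite Rmin_left, Rmax_right in Hc by lra.
  pose proof (lstep_pos c ltac:(lra)) as P.
  pose proof (lstep_sqr_upper c ltac:(lra)) as U. pose proof (lstep_lower c ltac:(lra)) as L.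
  set (q := c * (c + 1) * lstep c ^ 2) in *.
  replace (/ lstep (x + 1) - / lstep x - 1) with (/ q - 1) by lra.
  assert (Hcc : 0 < c * (c + 1)) by nra.
  assert (q1 : q <= 1).
  { unfold q. apply Rmult_le_reg_l with (/ (c * (c + 1))); [now apply Rinv_0_lt_compat|].
    rewrite <- Rmult_assoc, Rinv_l; lra. }
  assert (q0 : c * (c + 1) / (c + / 2) ^ 2 <= q).
  { unfold q, Rdiv. apply Rmult_le_compat_l; [lra|]. rewrite <- pow_inv.
    apply pow_incr. split; auto. left. apply Rinv_0_lt_compat; lra. }
  assert (q00 : 0 < c * (c + 1) / (c + / 2) ^ 2).
  { apply Rmult_lt_0_compat; auto. apply Rinv_0_lt_compat. nra. }
  split.
  + assert (1 <= / q); [|lra]. rewrite <- Rinv_1. apply Rinv_le_contravar; lra.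
  + apply Rle_trans with ((c + / 2) ^ 2 / (c * (c + 1)) - 1).
    * apply Rplus_le_compat_r. apply Rinv_le_contravar in q0; auto.
      eapply Rle_trans; [apply q0|]. right. field. lra.
    * replace ((c + / 2) ^ 2 / (c * (c + 1)) - 1) with (/ (4 * (c * (c + 1)))) by (field; lra).
      apply Rinv_le_contravar; nra.
Qed.

Lemma lstep_decr (x : R) : 1 <= x ->
  lstep (x + 1) <= lstep x <= 2 * lstep (x + 1) /\ lstep x - lstep (x + 1) <= / x ^ 2.
Proof.
intros Hx. pose proof (lstep_upper x ltac:(lra)). pose proof (lstep_lower (x + 1) ltac:(lra)).
pose proof (lstep_lower x ltac:(lra)).
assert (A : lstep x <= 2 * lstep (x + 1)).
{ unfold lstep. assert (I0 : 0 < / x) by (apply Rinv_0_lt_compat; lra).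
  assert (I1 : 0 < / (x + 1)) by (apply Rinv_0_lt_compat; lra).
  replace (2 * ln (1 + / (x + 1))) with (ln ((1 + / (x + 1)) * (1 + / (x + 1)))) by (rewrite ln_mult; lra).
  assert (/ x <= 2 * / (x + 1)).
  { replace (2 * / (x + 1)) with (/ ((x + 1) / 2)) by (field; lra). apply Rinv_le_contravar; lra. }
  apply ln_le; nra. }
split; [split; auto|].
- unfold lstep. assert (/ (x + 1) <= / x) by (apply Rinv_le_contravar; lra).
  assert (0 < / (x + 1)) by (apply Rinv_0_lt_compat; lra).
  apply ln_le; lra.
- pose proof (lstep_lower (x + 1) ltac:(lra)) as L.
  (* The quotient of [1 + 1/x] by [1 + 1/(x+1)] is [(x+1)^2 / (x (x+2)) = 1 + 1 / (x (x+2))]. *)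
  assert (B : lstep x - lstep (x + 1) = lstep (x * (x + 2))).
  { unfold lstep.
    assert (0 < / x) by (apply Rinv_0_lt_compat; lra).
    assert (0 < / (x + 1)) by (apply Rinv_0_lt_compat; lra).
    rewrite <- ln_div by lra. f_equal. field. nra. }
  rewrite B. eapply Rle_trans; [apply lstep_upper; nra|]. apply Rinv_le_contravar; nra.
Qed.

Lemma lstep_ln (k : nat) : (1 <= k)%nat -> ln (INR (S k)) = ln (INR k) + lstep (INR k).
Proof.
intros Hk. apply le_INR in Hk. simpl INR in Hk at 1. unfold lstep.
assert (0 < / INR k) by (apply Rinv_0_lt_compat; lra).
rewrite <- ln_mult by lra. f_equal. rewrite S_INR. field. lra.
Qed.

Lemma C2_neq_0 : RtoC 2 <> 0.
Proof. intros H; injection H; lra. Qed.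

(** The cubic error in relative form: [1 + al] stays away from 0, so quotients by [csinh (v / 2)]
    can be handled as quotients by [v / 2]. *)
Lemma csinh_factor (v : C) : v <> 0 -> Cmod v <= / 4 ->
  exists al : C, csinh (v / 2) = (v / 2 * (1 + al))%C /\ Cmod al <= 2 * Cmod v ^ 2 /\ Cmod al <= / 8.
Proof.
intros Hv Hm. assert (E2 : Cmod (v / 2) = Cmod v / 2).
{ rewrite Cmod_div, Cmod_R, Rabs_pos_eq by (try lra; apply C2_neq_0). auto. }
pose proof (csinh_minus_id_le (v / 2) ltac:(lra)) as H. rewrite E2 in H.
apply Cmod_gt_0 in Hv as Hv0.
exists ((csinh (v / 2) - v / 2) / (v / 2))%C.
assert (v / 2 <> 0)%C. { apply Cmod_gt_0. lra. }
assert (B : Cmod ((csinh (v / 2) - v / 2) / (v / 2)) <= 2 * Cmod v ^ 2).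
{ rewrite Cmod_div, E2 by auto. apply Rmult_le_reg_r with (Cmod v / 2); [lra|].
  unfold Rdiv at 1. rewrite Rmult_assoc, Rinv_l by lra. lra. }
repeat split; auto; [|nra]. pose proof C2_neq_0. field; repeat split; auto.
Qed.

(** If [a] and [a exp(-v)] are consecutive terms, [geo v] times their difference gives back [a].
    This is the multiplier of the summation by parts. *)
Definition geo (v : C) : C := (/ (1 - cexp (- v)))%C.

Lemma geo_csinh (v : C) : (1 - cexp (- v) = 2 * cexp (- (v / 2)) * csinh (v / 2))%C.
Proof.
unfold csinh. replace (cexp (- v)) with (cexp (- (v / 2)) * cexp (- (v / 2)))%C.
- replace (RtoC 1) with (cexp (- (v / 2)) * cexp (v / 2))%C by apply cexp_opp_l.
  field; apply C2_neq_0.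
- rewrite <- cexp_plus. f_equal. field; apply C2_neq_0.
Qed.

Lemma Cmod_1_plus_ge (al : C) : Cmod al <= / 8 -> 7 / 8 <= Cmod (1 + al).
Proof.
intros H. pose proof (Cmod_rev_triangle 1 (- al)) as H1.
rewrite Cmod_opp, Cmod_1 in H1. replace (1 - - al)%C with (1 + al)%C in H1 by ring. lra.
Qed.

Lemma geo_den_neq_0 (v : C) : v <> 0 -> Cmod v <= / 4 -> (1 - cexp (- v))%C <> 0.
Proof.
intros Hv Hm. rewrite geo_csinh. destruct (csinh_factor v Hv Hm) as [al [E [_ Ha]]]. rewrite E.
pose proof (Cmod_1_plus_ge al Ha). pose proof C2_neq_0.
assert ((v / 2)%C <> 0).
{ apply Cmod_gt_0. rewrite Cmod_div, Cmod_R, Rabs_pos_eq by (auto; lra).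
  apply Cmod_gt_0 in Hv. lra. }
assert ((1 + al)%C <> 0) by (apply Cmod_gt_0; lra).
apply Cmult_neq_0; apply Cmult_neq_0; auto using cexp_neq_0.
Qed.

(* [geo] is [1/2 + coth (v/2) / 2]: [geo v' - geo v] is [sinh] of half the
   increment over [2 sinh (v/2) sinh (v'/2)]. *)
Lemma geo_diff (v v' : C) : v <> 0 -> v' <> 0 -> Cmod v <= / 4 -> Cmod v' <= Cmod v ->
  Cmod v <= 2 * Cmod v' ->
  Cmod ((geo v' - geo v) - (/ v' - / v)) <= 40 * Cmod (v' - v).
Proof.
intros Hv Hv' Hm Hvv Hvv2. set (d := (v' - v)%C).
destruct (csinh_factor v Hv Hm) as [al [E [Ha1 Ha2]]].
destruct (csinh_factor v' Hv' ltac:(lra)) as [al' [E' [Ha1' Ha2']]].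
assert (Hd : Cmod d <= 2 * Cmod v).
{ eapply Rle_trans; [apply Cmod_triangle_minus|]. lra. }
pose proof C2_neq_0 as n2.
assert (E2 : Cmod (d / 2) = Cmod d / 2).
{ rewrite Cmod_div, Cmod_R, Rabs_pos_eq by (auto; lra). auto. }
pose proof (csinh_minus_id_le (d / 2) ltac:(lra)) as Hr. rewrite E2 in Hr.
set (rho := (csinh (d / 2) - d / 2)%C) in *.
pose proof (Cmod_1_plus_ge al Ha2) as P. pose proof (Cmod_1_plus_ge al' Ha2') as P'.
assert (N1 : (1 + al)%C <> 0) by (apply Cmod_gt_0; lra).
assert (N1' : (1 + al')%C <> 0) by (apply Cmod_gt_0; lra).
(* [geo v' - geo v] is [- sinh (d/2) / (2 sinh (v/2) sinh (v'/2))] and [1/v' - 1/v] is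
   [- d / (v v')]; after reduction to a common denominator the main terms cancel, and only [al],
   [al'] and [rho] remain. *)
assert (Q : (geo v' - geo v - (/ v' - / v) =
  (d * (al + al' + al * al') - 2 * rho) / (v * v' * ((1 + al) * (1 + al'))))%C).
{ unfold geo. rewrite !geo_csinh, E, E'.
  assert (D : (2 * csinh (d / 2) * (cexp (- (v / 2)) * cexp (- (v' / 2))) =
    cexp (- (v / 2)) * cexp (- (v / 2)) - cexp (- (v' / 2)) * cexp (- (v' / 2)))%C).
  { unfold csinh. replace (cexp (d / 2)) with (cexp (v' / 2) * cexp (- (v / 2)))%C.
    replace (cexp (- (d / 2))) with (cexp (v / 2) * cexp (- (v' / 2)))%C.
    - transitivity (cexp (- (v / 2)) * cexp (- (v / 2)) * (cexp (- (v' / 2)) * cexp (v' / 2))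
       - cexp (- (v' / 2)) * cexp (- (v' / 2)) * (cexp (- (v / 2)) * cexp (v / 2)))%C.
      field; auto. rewrite !cexp_opp_l. ring.
    - rewrite <- cexp_plus. f_equal. unfold d. field; auto.
    - rewrite <- cexp_plus. f_equal. unfold d. field; auto. }
  assert (G : forall u, (1 - cexp (- u) = 1 - cexp (- (u / 2)) * cexp (- (u / 2)))%C).
  { intros u. rewrite <- cexp_plus. do 2 f_equal. field; auto. }
  pose proof (geo_csinh v) as G1. pose proof (geo_csinh v') as G2.
  rewrite G, E in G1. rewrite G, E' in G2.
  replace rho with (csinh (d / 2) - d / 2)%C by reflexivity.
  pose proof (cexp_neq_0 (- (v / 2))) as nq. pose proof (cexp_neq_0 (- (v' / 2))) as nq'.
  set (q := cexp (- (v / 2))) in *. set (q' := cexp (- (v' / 2))) in *.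
  set (S := csinh (d / 2)) in *.
  assert (D2 : (q * v * (1 + al) - q' * v' * (1 + al') = - (2 * S * (q * q')))%C).
  { rewrite D.
    transitivity (2 * q * (v / 2 * (1 + al)) - 2 * q' * (v' / 2 * (1 + al')))%C; [field; auto|].
    rewrite <- G1, <- G2. ring. }
  transitivity ((q * v * (1 + al) - q' * v' * (1 + al'))
     / (q * q' * (v * v' * ((1 + al) * (1 + al')))) - (/ v' - / v))%C.
  - field. repeat split; auto.
  - rewrite D2. unfold d. field. repeat split; auto. }
rewrite Q.
assert (NN : (v * v' * ((1 + al) * (1 + al')))%C <> 0) by (repeat apply Cmult_neq_0; auto).
rewrite Cmod_div by auto. rewrite !Cmod_mult.
apply Cmod_gt_0 in Hv, Hv'. pose proof (Cmod_ge_0 d) as d0.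
pose proof (Cmod_ge_0 al). pose proof (Cmod_ge_0 al').
assert (T : Cmod (d * (al + al' + al * al') - 2 * rho) <= 13 * (Cmod d * Cmod v ^ 2)).
{ eapply Rle_trans; [apply Cmod_triangle_minus|]. rewrite !Cmod_mult, Cmod_R, Rabs_pos_eq by lra.
  assert (Cmod (al + al' + al * al') <= 5 * Cmod v ^ 2).
  { eapply Rle_trans; [apply Cmod_triangle|]. rewrite Cmod_mult.
    pose proof (Cmod_triangle al al'). nra. }
  assert (Cmod rho <= 4 * (Cmod d * Cmod v ^ 2)).
  { eapply Rle_trans; [apply Hr|].
    replace (8 * (Cmod d / 2) ^ 3) with (Cmod d * Cmod d ^ 2) by field.
    assert (Cmod d ^ 2 <= 4 * Cmod v ^ 2) by nra. nra. }
  nra. }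
apply Rmult_le_reg_r with (Cmod v * Cmod v' * (Cmod (1 + al) * Cmod (1 + al'))).
{ repeat apply Rmult_lt_0_compat; lra. }
unfold Rdiv. rewrite Rmult_assoc, Rinv_l.
2:{ apply Rgt_not_eq. repeat apply Rmult_lt_0_compat; lra. }
rewrite Rmult_1_r. eapply Rle_trans; [apply T|].
assert (X : 49 / 64 <= Cmod (1 + al) * Cmod (1 + al')) by nra.
assert (Y : Cmod v ^ 2 <= 2 * (Cmod v * Cmod v')) by nra.
assert (Z : 0 < Cmod v * Cmod v') by (apply Rmult_lt_0_compat; lra).
apply Rle_trans with (13 * (Cmod d * (2 * (Cmod v * Cmod v')))).
- apply Rmult_le_compat_l; [lra|]. apply Rmult_le_compat_l; auto.
- replace (40 * Cmod d * _) with (Cmod d * (Cmod v * Cmod v') * (40 * (Cmod (1 + al) * Cmod (1 + al')))) by ring.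
  replace (13 * _) with (Cmod d * (Cmod v * Cmod v') * 26) by ring.
  apply Rmult_le_compat_l; [|lra]. apply Rmult_le_pos; lra.
Qed.

Lemma geo_minus_inv_le (v : C) : v <> 0 -> Cmod v <= / 16 -> Cmod (geo v - / v) <= 16.
Proof.
intros Hv Hm. unfold geo.
pose proof (cexp_taylor2 (- v)) as T. rewrite Cmod_opp in T. specialize (T ltac:(lra)).
set (r := (cexp (- v) - 1 - - v)%C) in *.
pose proof (geo_den_neq_0 v Hv ltac:(lra)) as N.
replace (1 - cexp (- v))%C with (v - r)%C in * by (unfold r; ring).
replace (/ (v - r) - / v)%C with (r / (v * (v - r)))%C.
2:{ field. auto. }
rewrite Cmod_div by (apply Cmult_neq_0; auto). rewrite Cmod_mult.
pose proof (Cmod_rev_triangle v r). apply Cmod_gt_0 in Hv.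
(* The radius [1/16] makes [|r| <= 8 |v|^2] at most [|v| / 2]. *)
assert (Cmod v / 2 <= Cmod (v - r)) by nra.
apply Rmult_le_reg_r with (Cmod v * Cmod (v - r)); [nra|].
unfold Rdiv. rewrite Rmult_assoc, Rinv_l by nra. nra.
Qed.

(** * Segments of the Dirichlet series of zeta *)

(** Sums over [k < n]: the block [N <= k < M] is then the difference [csum f M - csum f N], with no
    special case for an empty block. *)
Fixpoint csum (f : nat -> C) (n : nat) : C :=
  match n with O => 0 | S n => (csum f n + f n)%C end.

Fixpoint rsum (f : nat -> R) (n : nat) : R :=
  match n with O => 0 | S n => rsum f n + f n end.

Lemma csum_ext_seg (f g : nat -> C) (N M : nat) : (N <= M)%nat ->
  (forall k, (N <= k < M)%nat -> f k = g k) ->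
  (csum f M - csum f N = csum g M - csum g N)%C.
Proof.
intros HNM; induction HNM as [|M HNM IH]; intros H; [ring|].
simpl. rewrite (H M) by lia.
transitivity (csum f M - csum f N + g M)%C; [ring|]. rewrite IH by (intros; apply H; lia). ring.
Qed.

Lemma csum_ext (f g : nat -> C) (M : nat) :
  (forall k, (k < M)%nat -> f k = g k) -> csum f M = csum g M.
Proof. induction M as [|M IH]; intros H; simpl; auto. rewrite IH, H; auto. Qed.

Lemma csum_plus (f g : nat -> C) (n : nat) :
  csum (fun k => f k + g k)%C n = (csum f n + csum g n)%C.
Proof. induction n as [|n IH]; simpl; [|rewrite IH]; ring. Qed.

Lemma csum_scal (c : C) (f : nat -> C) (n : nat) :
  csum (fun k => c * f k)%C n = (c * csum f n)%C.
Proof. induction n as [|n IH]; simpl; [|rewrite IH]; ring. Qed.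

Lemma rsum_plus (f g : nat -> R) (n : nat) :
  rsum (fun k => f k + g k) n = rsum f n + rsum g n.
Proof. induction n as [|n IH]; simpl; [|rewrite IH]; ring. Qed.

Lemma rsum_scal (c : R) (f : nat -> R) (n : nat) :
  rsum (fun k => c * f k) n = c * rsum f n.
Proof. induction n as [|n IH]; simpl; [|rewrite IH]; ring. Qed.

Lemma rsum_le_seg (f g : nat -> R) (N M : nat) : (N <= M)%nat ->
  (forall k, (N <= k < M)%nat -> f k <= g k) ->
  rsum f M - rsum f N <= rsum g M - rsum g N.
Proof.
intros HNM; induction HNM as [|M HNM IH]; intros H; [lra|].
simpl. pose proof (H M ltac:(lia)). specialize (IH ltac:(intros; apply H; lia)). lra.
Qed.

Lemma rsum_le (f g : nat -> R) (M : nat) :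
  (forall k, (k < M)%nat -> f k <= g k) -> rsum f M <= rsum g M.
Proof. induction M as [|M IH]; intros H; simpl; [lra|]. apply Rplus_le_compat; auto. Qed.

Lemma rsum_ext (f g : nat -> R) (M : nat) :
  (forall k, (k < M)%nat -> f k = g k) -> rsum f M = rsum g M.
Proof. induction M as [|M IH]; intros H; simpl; auto. rewrite IH, H; auto. Qed.

Lemma rsum_seg_nonneg (f : nat -> R) (N M : nat) : (N <= M)%nat ->
  (forall k, (N <= k < M)%nat -> 0 <= f k) -> rsum f N <= rsum f M.
Proof.
intros HNM; induction HNM as [|M HNM IH]; intros H; [lra|].
simpl. pose proof (H M ltac:(lia)). specialize (IH ltac:(intros; apply H; lia)). lra.
Qed.

Lemma Cmod_csum_seg_le (f : nat -> C) (g : nat -> R) (N M : nat) : (N <= M)%nat ->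
  (forall k, (N <= k < M)%nat -> Cmod (f k) <= g k) ->
  Cmod (csum f M - csum f N) <= rsum g M - rsum g N.
Proof.
intros HNM; induction HNM as [|M HNM IH]; intros H.
- replace (csum f N - csum f N)%C with (RtoC 0) by ring. rewrite Cmod_0. lra.
- simpl. replace (csum f M + f M - csum f N)%C with ((csum f M - csum f N) + f M)%C by ring.
  eapply Rle_trans; [apply Cmod_triangle|].
  pose proof (H M ltac:(lia)). specialize (IH ltac:(intros; apply H; lia)). lra.
Qed.

Lemma Cmod_csum_le (f : nat -> C) (g : nat -> R) (M : nat) :
  (forall k, (k < M)%nat -> Cmod (f k) <= g k) -> Cmod (csum f M) <= rsum g M.
Proof.
intros H. pose proof (Cmod_csum_seg_le f g 0 M ltac:(lia)) as K. simpl in K.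
replace (csum f M - 0)%C with (csum f M) in K by ring. rewrite Rminus_0_r in K.
apply K. intros; apply H; lia.
Qed.

(** * Powers of integers and the ratio of consecutive terms *)

Lemma npow_neg_cexp (n : nat) (s : C) : npow_neg n s = cexp (- s * RtoC (ln (INR n)))%C.
Proof.
destruct s as [x y]. unfold npow_neg, cexp. simpl.
replace (- x * ln (INR n) - - y * 0) with (- x * ln (INR n)) by ring.
replace (- x * 0 + - y * ln (INR n)) with (- y * ln (INR n)) by ring. reflexivity.
Qed.

Lemma npow_neg_plus (n : nat) (s u : C) : npow_neg n (s + u) = (npow_neg n s * npow_neg n u)%C.
Proof. rewrite !npow_neg_cexp, <- cexp_plus. f_equal. ring. Qed.

Lemma Cmod_npow_neg (n : nat) (s : C) : Cmod (npow_neg n s) = Rpower (INR n) (- Re s).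
Proof. destruct s. rewrite npow_neg_cexp, Cmod_cexp. unfold Rpower. f_equal. simpl. ring. Qed.

Lemma INR_ge_1 (k : nat) : (1 <= k)%nat -> 1 <= INR k.
Proof. intros H. now apply le_INR in H. Qed.

Lemma npow_neg_minus_1 (n : nat) (s : C) : (1 <= n)%nat ->
  npow_neg n (s - 1) = (RtoC (INR n) * npow_neg n s)%C.
Proof.
intros Hn. apply INR_ge_1 in Hn. unfold Cminus. rewrite Cplus_comm, npow_neg_plus. f_equal.
unfold npow_neg. apply injective_projections; simpl.
- replace (- - (1) * ln (INR n)) with (ln (INR n)) by ring. replace (- - 0 * ln (INR n)) with 0 by ring.
  rewrite cos_0, exp_ln; lra.
- replace (- - 0 * ln (INR n)) with 0 by ring. rewrite sin_0. ring.
Qed.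

Lemma Rpower_antitone (x y s : R) : 0 <= s -> 0 < x -> x <= y -> Rpower y (- s) <= Rpower x (- s).
Proof.
intros Hs Hx Hxy. unfold Rpower. apply exp_mono.
pose proof (ln_le x y Hx Hxy). nra.
Qed.

Lemma Rpower_pos (x s : R) : 0 < Rpower x s.
Proof. apply exp_pos. Qed.

(** [geo v] is [1/v + O(1)], and [1/v = 1 / (w lstep k)] grows by almost exactly [1/w] at each step.
    Removing [k/w] therefore leaves a bounded sequence whose increments are [O(|w| / k^2)]. *)
Definition geo_err (w : C) (k : nat) : C := (geo (w * RtoC (lstep (INR k))) - RtoC (INR k) / w)%C.

Lemma npow_neg_step (w : C) (k : nat) : (1 <= k)%nat ->
  npow_neg (S k) w = (npow_neg k w * cexp (- (w * RtoC (lstep (INR k)))))%C.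
Proof.
intros Hk. rewrite !npow_neg_cexp, <- cexp_plus. f_equal. rewrite lstep_ln, RtoC_plus by auto. ring.
Qed.

Section GeoErr.
Variables (w : C) (k : nat).
Hypothesis Hk : (1 <= k)%nat.
Hypothesis Hw : / 2 <= Cmod w.
Hypothesis Hwk : 16 * Cmod w <= INR k.

Let v := (w * RtoC (lstep (INR k)))%C.

Lemma geo_arg_bounds : w <> 0 /\ v <> 0 /\ Cmod v = Cmod w * lstep (INR k) /\ Cmod v <= / 16.
Proof.
pose proof (INR_ge_1 k Hk) as K.
pose proof (lstep_pos (INR k) ltac:(lra)) as P. pose proof (lstep_upper (INR k) ltac:(lra)) as U.
assert (w <> 0) by (apply Cmod_gt_0; lra).
assert (E : Cmod v = Cmod w * lstep (INR k)).
{ unfold v. rewrite Cmod_mult, Cmod_R, Rabs_pos_eq; lra. }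
repeat split; auto.
- apply Cmod_gt_0. rewrite E. apply Rmult_lt_0_compat; lra.
- rewrite E. apply Rle_trans with (INR k / 16 * / INR k).
  + apply Rmult_le_compat; lra.
  + right. field. lra.
Qed.

Lemma geo_err_le : Cmod (geo_err w k) <= 18.
Proof.
destruct geo_arg_bounds as (W & V & E & B). pose proof (INR_ge_1 k Hk) as K.
pose proof (lstep_pos (INR k) ltac:(lra)) as P. pose proof (lstep_upper (INR k) ltac:(lra)) as U.
pose proof (lstep_lower (INR k) ltac:(lra)) as L.
pose proof (geo_minus_inv_le v V B) as G. unfold geo_err. fold v.
replace (geo v - RtoC (INR k) / w)%C with
  ((geo v - / v) + RtoC (/ lstep (INR k) - INR k) / w)%C.
- eapply Rle_trans; [apply Cmod_triangle|]. rewrite Cmod_div, Cmod_R by auto.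
  assert (0 <= / lstep (INR k) - INR k <= 1).
  { split.
    - apply Rinv_le_contravar in U; auto. rewrite Rinv_inv in U. lra.
    - apply Rinv_le_contravar in L; [|apply Rinv_0_lt_compat; lra]. rewrite Rinv_inv in L. lra. }
  rewrite Rabs_pos_eq by lra.
  assert ((/ lstep (INR k) - INR k) / Cmod w <= 2).
  { apply Rmult_le_reg_r with (Cmod w); [lra|]. unfold Rdiv. rewrite Rmult_assoc, Rinv_l; lra. }
  lra.
- rewrite RtoC_minus, RtoC_inv by lra. unfold v. field. split; auto.
  intros H. injection H. lra.
Qed.

Lemma geo_err_step_le : Cmod (geo_err w (S k) - geo_err w k) <= 44 * Cmod w / INR k ^ 2.
Proof.
destruct geo_arg_bounds as (W & V & E & B). pose proof (INR_ge_1 k Hk) as K.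
unfold geo_err. fold v. rewrite S_INR. set (v' := (w * RtoC (lstep (INR k + 1)))%C).
pose proof (lstep_pos (INR k) ltac:(lra)) as P. pose proof (lstep_pos (INR k + 1) ltac:(lra)) as P'.
destruct (lstep_decr (INR k) K) as [[D1 D2] D3].
pose proof (inv_lstep_step (INR k) K) as I.
assert (E' : Cmod v' = Cmod w * lstep (INR k + 1)).
{ unfold v'. rewrite Cmod_mult, Cmod_R, Rabs_pos_eq; lra. }
assert (V' : v' <> 0). { apply Cmod_gt_0. rewrite E'. apply Rmult_lt_0_compat; lra. }
pose proof (geo_diff v v' V V' ltac:(lra) ltac:(nra) ltac:(nra)) as G.
replace (geo v' - RtoC (INR k + 1) / w - (geo v - RtoC (INR k) / w))%C with
  ((geo v' - geo v - (/ v' - / v)) + RtoC (/ lstep (INR k + 1) - / lstep (INR k) - 1) / w)%C.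
- eapply Rle_trans; [apply Cmod_triangle|]. rewrite Cmod_div, Cmod_R by auto.
  rewrite Rabs_pos_eq by lra.
  assert (Dv : Cmod (v' - v) <= Cmod w * / INR k ^ 2).
  { replace (v' - v)%C with (w * RtoC (- (lstep (INR k) - lstep (INR k + 1))))%C.
    - rewrite Cmod_mult, Cmod_R, Rabs_Ropp, Rabs_pos_eq by lra.
      apply Rmult_le_compat_l; lra.
    - unfold v, v'. rewrite RtoC_opp, RtoC_minus. ring. }
  assert (0 < / INR k ^ 2) by (apply Rinv_0_lt_compat; nra).
  (* From [|w| >= 1/2], [1/|w| <= 4 |w|]. With the 40 of [geo_diff] this gives the 44. *)
  assert ((/ lstep (INR k + 1) - / lstep (INR k) - 1) / Cmod w <= 4 * (Cmod w * / INR k ^ 2)).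
  { apply Rmult_le_reg_r with (Cmod w); [lra|]. unfold Rdiv at 1. rewrite Rmult_assoc, Rinv_l by lra.
    assert (1 <= 4 * (Cmod w * Cmod w)) by nra. nra. }
  unfold Rdiv. lra.
- rewrite !RtoC_minus, !RtoC_inv, RtoC_plus by lra. unfold v, v'. field.
  repeat split; auto; intros H; injection H; lra.
Qed.

(** Substituting [geo v = k/w + geo_err] into [a_k = geo v (a_k - a_(k+1))] and multiplying by [w]
    gives an identity whose first two lines telescope in [k]: the first to the main term
    [N^(1-w) - M^(1-w)], the second to boundary terms. Only the third line has to be summed. *)
Lemma zeta_term_telescope :
  ((w - 1) * npow_neg k w =
   (RtoC (INR k) * npow_neg k w - RtoC (INR (S k)) * npow_neg (S k) w)
   + ((w * geo_err w k - 1) * npow_neg k w - (w * geo_err w (S k) - 1) * npow_neg (S k) w)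
   + w * (geo_err w (S k) - geo_err w k) * npow_neg (S k) w)%C.
Proof.
destruct geo_arg_bounds as (W & V & E & B).
pose proof (geo_den_neq_0 v V ltac:(lra)) as N.
assert (G : (npow_neg k w = geo v * (npow_neg k w - npow_neg (S k) w))%C).
{ rewrite npow_neg_step by auto. fold v. unfold geo. field. auto. }
unfold geo_err. fold v. rewrite S_INR, RtoC_plus.
transitivity (w * (geo v * (npow_neg k w - npow_neg (S k) w)) - npow_neg k w)%C.
- rewrite <- G. ring.
- field. auto.
Qed.
End GeoErr.

(* Kusmin-Landau: since [16 |w| <= k], the ratio of consecutive terms stays away from
   the other zeros of [1 - exp(-v)], so that Abel summation loses no power of [N]. *)
Lemma zeta_segment (w : C) (sg : R) (N M : nat) : 0 <= sg -> sg <= Re w -> / 2 <= Cmod w ->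
  (1 <= N)%nat -> 16 * Cmod w <= INR N -> (N <= M)%nat ->
  Cmod ((w - 1) * (csum (fun k => npow_neg k w) M - csum (fun k => npow_neg k w) N)
        - (npow_neg N (w - 1) - npow_neg M (w - 1))) <=
  30 * Cmod w * (Rpower (INR N) (- sg) + Rpower (INR M) (- sg)).
Proof.
intros Hs Hsw Hw HN HwN HNM. set (f := fun k => npow_neg k w).
assert (Hf : forall k, (1 <= k)%nat -> Cmod (f k) <= Rpower (INR k) (- sg)).
{ intros k Hk. unfold f. rewrite Cmod_npow_neg. apply Rle_Rpower; [now apply INR_ge_1|lra]. }
(* The boundary terms; [18 |w| + 1 <= 20 |w|] because [|w| >= 1/2]. *)
set (g := fun k => ((w * geo_err w k - 1) * f k)%C).
assert (Hg : forall k, (N <= k)%nat -> Cmod (g k) <= 20 * Cmod w * Rpower (INR k) (- sg)).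
{ intros k Hk. unfold g. rewrite Cmod_mult.
  assert (Cmod (w * geo_err w k - 1) <= 20 * Cmod w).
  { eapply Rle_trans; [apply Cmod_triangle_minus|]. rewrite Cmod_mult, Cmod_1.
    apply le_INR in Hk as Hk'.
    pose proof (geo_err_le w k ltac:(lia) Hw ltac:(lra)). nra. }
  apply Rmult_le_compat; auto using Cmod_ge_0. apply Hf. lia. }
assert (INR1 : 1 <= INR N) by now apply INR_ge_1.
set (P := Rpower (INR N) (- sg)) in *.
assert (P0 : 0 < P) by apply Rpower_pos.
(* [2/N - 2/M] majorises the sum of [1/k^2] over the block and telescopes along the induction. *)
assert (R : Cmod ((w - 1) * (csum f M - csum f N) - (npow_neg N (w - 1) - npow_neg M (w - 1))
     - (g N - g M)) <= 44 * Cmod w ^ 2 * P * (2 / INR N - 2 / INR M)).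
{ clear Hf. revert M HNM. induction 1 as [|M HNM IH].
  - replace (_ - (g N - g N))%C with (RtoC 0) by ring. rewrite Cmod_0. lra.
  - apply le_INR in HNM as HNM'. simpl csum.
    pose proof (zeta_term_telescope w M ltac:(lia) Hw ltac:(lra)) as T.
    rewrite !npow_neg_minus_1 in * by lia.
    fold (f M) in *. fold (f (S M)) in *.
    match goal with |- Cmod ?x <= _ => replace x with
     (((w - 1) * (csum f M - csum f N) - (RtoC (INR N) * npow_neg N w - RtoC (INR M) * f M) - (g N - g M))
      + w * (geo_err w (S M) - geo_err w M) * f (S M))%C end.
    + eapply Rle_trans; [apply Cmod_triangle|]. rewrite !Cmod_mult.
      pose proof (geo_err_step_le w M ltac:(lia) Hw ltac:(lra)) as D.
      assert (F : Cmod (f (S M)) <= P).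
      { unfold f. rewrite Cmod_npow_neg. apply Rle_trans with (Rpower (INR (S M)) (- sg)).
        - apply Rle_Rpower; [apply INR_ge_1; lia|lra].
        - apply Rpower_antitone; try lra. apply le_INR. lia. }
      assert (Q : / INR M ^ 2 <= 2 / INR M - 2 / INR (S M)).
      { rewrite S_INR.
        replace (2 / INR M - 2 / (INR M + 1)) with (/ (INR M * (INR M + 1) / 2)) by (field; lra).
        apply Rinv_le_contravar; nra. }
      assert (Cmod w * Cmod (geo_err w (S M) - geo_err w M) * Cmod (f (S M)) <=
         44 * Cmod w ^ 2 * P * (2 / INR M - 2 / INR (S M))).
      { apply Rle_trans with (Cmod w * (44 * Cmod w / INR M ^ 2) * P).
        - apply Rmult_le_compat; auto using Cmod_ge_0.
          + apply Rmult_le_pos; apply Cmod_ge_0.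
          + apply Rmult_le_compat_l; auto using Cmod_ge_0.
        - replace (Cmod w * (44 * Cmod w / INR M ^ 2) * P) with (44 * Cmod w ^ 2 * P * / INR M ^ 2)
            by (field; lra).
          apply Rmult_le_compat_l; auto. pose proof (Cmod_ge_0 w).
          apply Rmult_le_pos; nra. }
      change (npow_neg N w) with (f N) in *. lra.
    + replace ((w - 1) * (csum f M + f M - csum f N))%C with
        ((w - 1) * (csum f M - csum f N) + (w - 1) * f M)%C by ring.
      rewrite T. unfold g. ring. }
apply le_INR in HNM as HNM'.
replace (_ - (npow_neg N (w - 1) - npow_neg M (w - 1)))%C with
 ((w - 1) * (csum f M - csum f N) - (npow_neg N (w - 1) - npow_neg M (w - 1)) - (g N - g M) + (g N - g M))%C by ring.
eapply Rle_trans; [apply Cmod_triangle|].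
assert (Cmod (g N - g M) <= 20 * Cmod w * (P + Rpower (INR M) (- sg))).
{ eapply Rle_trans; [apply Cmod_triangle_minus|]. pose proof (Hg N ltac:(lia)).
  pose proof (Hg M ltac:(lia)). unfold P. lra. }
(* [88 |w|^2 / N <= 10 |w|] by [16 |w| <= N]; together with the boundary constant 20 this makes up
   the 30 of the statement. *)
assert (44 * Cmod w ^ 2 * P * (2 / INR N - 2 / INR M) <= 10 * Cmod w * P).
{ apply Rle_trans with (44 * Cmod w ^ 2 * P * (2 / INR N)).
  - apply Rmult_le_compat_l.
    + apply Rmult_le_pos; [|lra]. nra.
    + assert (0 < / INR M) by (apply Rinv_0_lt_compat; lra). unfold Rdiv. lra.
  - apply Rmult_le_reg_r with (INR N); [lra|].
    replace (44 * Cmod w ^ 2 * P * (2 / INR N) * INR N) with (Cmod w * P * (88 * Cmod w)) by (field; lra).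
    replace (10 * Cmod w * P * INR N) with (Cmod w * P * (10 * INR N)) by ring.
    apply Rmult_le_compat_l; [apply Rmult_le_pos; lra|lra]. }
pose proof (Rpower_pos (INR M) (- sg)). pose proof (Cmod_ge_0 w).
assert (0 <= Cmod w * Rpower (INR M) (- sg)) by (apply Rmult_le_pos; lra).
lra.
Qed.

(** * Coefficients of the Dirichlet series in k = m + n *)

(** The mean value theorem for [y^(1-a)]. Dividing by [1 - a], of either sign, serves the growing
    and the convergent sums alike. *)
Lemma Rpower_step (a x : R) : 0 <= a -> 0 < x -> a <> 1 ->
  Rpower (x + 1) (- a) <= (Rpower (x + 1) (1 - a) - Rpower x (1 - a)) / (1 - a) <= Rpower x (- a).
Proof.
intros Ha Hx Ha1.
destruct (MVT_gen (fun y => Rpower y (1 - a)) x (x + 1) (fun y => (1 - a) * Rpower y (- a)))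
  as [c [Hc E]].
- intros y Hy. rewrite Rmin_left, Rmax_right in Hy by lra.
  apply is_derive_Reals. replace (- a) with (1 - a - 1) by ring. apply derivable_pt_lim_power. lra.
- intros y Hy. rewrite Rmin_left, Rmax_right in Hy by lra.
  apply derivable_continuous_pt. eexists. apply derivable_pt_lim_power. lra.
- rewrite Rmin_left, Rmax_right in Hc by lra. rewrite E.
  replace ((1 - a) * Rpower c (- a) * (x + 1 - x) / (1 - a)) with (Rpower c (- a)) by (field; lra).
  split; apply Rpower_antitone; lra.
Qed.

Lemma rsum_power_lt1 (a : R) (n : nat) : 0 <= a < 1 -> (1 <= n)%nat ->
  rsum (fun j => Rpower (INR (S j)) (- a)) n <= Rpower (INR n) (1 - a) / (1 - a).
Proof.
intros Ha Hn. induction Hn as [|n Hn IH].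
- simpl. unfold Rpower. rewrite ln_1, !Rmult_0_r, exp_0.
  unfold Rdiv. rewrite Rplus_0_l, Rmult_1_l. rewrite <- Rinv_1 at 1. apply Rinv_le_contravar; lra.
- cbn [rsum]. apply INR_ge_1 in Hn as Hn'.
  destruct (Rpower_step a (INR n) ltac:(lra) ltac:(lra) ltac:(lra)) as [H _].
  rewrite S_INR. unfold Rdiv in *. rewrite Rmult_minus_distr_r in H. lra.
Qed.

Lemma Rpower_half_shift (a x : R) : 0 <= a -> 1 <= x -> Rpower x (- a) <= Rpower 2 a * Rpower (x + 1) (- a).
Proof.
intros Ha Hx. replace (Rpower 2 a) with (Rpower (/ 2) (- a)).
- rewrite Rpower_mult_distr by lra. apply Rpower_antitone; lra.
- unfold Rpower. f_equal. rewrite ln_Rinv by lra. ring.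
Qed.

(** The term at [j] is first traded for the term at [j + 1], at the cost of [2^a]; the latter is
    dominated by the integral over [[j, j+1]], so the comparison never reaches to the left of
    [N]. *)
Lemma rsum_power_gt1 (a : R) (N M : nat) : 1 < a -> (1 <= N)%nat -> (N <= M)%nat ->
  rsum (fun j => Rpower (INR j) (- a)) M - rsum (fun j => Rpower (INR j) (- a)) N
   <= Rpower 2 a / (a - 1) * Rpower (INR N) (1 - a).
Proof.
intros Ha HN HNM. apply INR_ge_1 in HN as HN'.
pose proof (Rpower_pos 2 a) as P2.
assert (H : rsum (fun j => Rpower (INR j) (- a)) M - rsum (fun j => Rpower (INR j) (- a)) N
   <= Rpower 2 a / (a - 1) * (Rpower (INR N) (1 - a) - Rpower (INR M) (1 - a))).
{ induction HNM as [|M HNM IH]; [lra|]. cbn [rsum].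
  apply le_INR in HNM as HNM'.
  destruct (Rpower_step a (INR M) ltac:(lra) ltac:(lra) ltac:(lra)) as [H _].
  pose proof (Rpower_half_shift a (INR M) ltac:(lra) ltac:(lra)) as H2.
  assert (H3 : Rpower (INR M) (- a) <= Rpower 2 a / (a - 1) *
    (Rpower (INR M) (1 - a) - Rpower (INR (S M)) (1 - a))).
  { eapply Rle_trans; [apply H2|]. rewrite S_INR.
    replace (Rpower 2 a / (a - 1) * _) with (Rpower 2 a *
     ((Rpower (INR M + 1) (1 - a) - Rpower (INR M) (1 - a)) / (1 - a))) by (field; lra).
    apply Rmult_le_compat_l; lra. }
  lra. }
eapply Rle_trans; [apply H|]. apply Rmult_le_compat_l.
- apply Rmult_le_pos; [lra|]. left; apply Rinv_0_lt_compat; lra.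
- pose proof (Rpower_pos (INR M) (1 - a)). lra.
Qed.

Lemma rsum_S_l (f : nat -> R) (n : nat) : rsum f (S n) = f O + rsum (fun k => f (S k)) n.
Proof. induction n as [|n IH]; [simpl; ring|]. change (rsum f (S (S n))) with (rsum f (S n) + f (S n)).
rewrite IH. simpl. ring. Qed.

Lemma csum_S_l (f : nat -> C) (n : nat) : csum f (S n) = (f O + csum (fun k => f (S k)) n)%C.
Proof. induction n as [|n IH]; [simpl; ring|]. change (csum f (S (S n))) with (csum f (S n) + f (S n))%C.
rewrite IH. simpl. ring. Qed.

Lemma harmonic_le (n : nat) : (1 <= n)%nat -> rsum (fun j => / INR (S j)) n <= 1 + ln (INR n).
Proof.
intros Hn. induction Hn as [|n Hn IH].
- simpl. rewrite ln_1. lra.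
- cbn [rsum]. rewrite lstep_ln by auto. apply INR_ge_1 in Hn as Hn'.
  pose proof (lstep_lower (INR n) ltac:(lra)) as L.
  assert (/ INR (S n) <= / (INR n + / 2)) by (apply Rinv_le_contravar; rewrite ?S_INR; lra).
  lra.
Qed.

Lemma rsum_inv_rev (n : nat) :
  rsum (fun j => / INR (n - j)) n = rsum (fun j => / INR (S j)) n.
Proof.
induction n as [|n IH]; [reflexivity|].
rewrite rsum_S_l. simpl (S n - 0)%nat. rewrite (rsum_ext _ (fun j => / INR (n - j))) by (intros; do 2 f_equal; lia).
rewrite IH. cbn [rsum]. ring.
Qed.

(** Since [t <= 1], [k^(-t) <= l^(1-t) / k]. The partial fractions [l / (k (l-k)) = 1/k + 1/(l-k)]
    then leave two harmonic sums. *)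
Lemma near_diagonal_sum_le (t : R) (l : nat) : t <= 1 -> (1 <= l)%nat ->
  rsum (fun k => match k with O => 0 | _ => Rpower (INR k) (- t) * (INR l / (INR l - INR k)) end) l
  <= 2 * Rpower (INR l) (1 - t) * (1 + ln (INR l)).
Proof.
intros Ht Hl. destruct l as [|n]; [lia|]. rewrite rsum_S_l, Rplus_0_l.
set (P := Rpower (INR (S n)) (1 - t)).
destruct n as [|n'].
{ simpl. unfold P. simpl INR. rewrite ln_1. pose proof (Rpower_pos 1 (1 - t)). lra. }
set (n := S n') in *.
apply Rle_trans with (rsum (fun j => P * (/ INR (S j) + / INR (n - j))) n).
- apply rsum_le. intros j Hj.
  assert (J : 1 <= INR (S j)) by (apply INR_ge_1; lia).
  assert (D : INR (S n) - INR (S j) = INR (n - j)).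
  { rewrite <- minus_INR by lia. f_equal. }
  assert (D1 : 1 <= INR (n - j)) by (apply INR_ge_1; lia).
  rewrite D.
  assert (X : Rpower (INR (S j)) (- t) <= P * / INR (S j)).
  { apply Rmult_le_reg_r with (INR (S j)); [lra|]. rewrite Rmult_assoc, Rinv_l, Rmult_1_r by lra.
    rewrite <- (Rpower_1 (INR (S j))) at 2 by lra. rewrite <- Rpower_plus. unfold P.
    replace (- t + 1) with (1 - t) by ring. apply Rle_Rpower_l; [lra|]. split; [lra|].
    apply le_INR; lia. }
  apply Rle_trans with (P * / INR (S j) * (INR (S n) / INR (n - j))).
  + apply Rmult_le_compat_r; auto. apply Rmult_le_pos; [apply pos_INR|].
    left; apply Rinv_0_lt_compat; lra.
  + right. replace (INR (S n)) with (INR (S j) + INR (n - j)) by lra. field. lra.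
- rewrite rsum_scal, rsum_plus, rsum_inv_rev.
  pose proof (harmonic_le n ltac:(unfold n; lia)) as H.
  assert (ln (INR n) <= ln (INR (S n))).
  { apply ln_le; [|apply le_INR; lia]. apply lt_0_INR. unfold n; lia. }
  pose proof (Rpower_pos (INR (S n)) (1 - t)) as HP. fold P in HP. nra.
Qed.

(** Letting [M] tend to infinity in the Cauchy bound keeps the rate [eta]. *)
Lemma C_cauchy_limit (u : nat -> C) (eta : nat -> R) (N0 : nat) :
  (forall N M, (N0 <= N)%nat -> (N <= M)%nat -> Cmod (u M - u N) <= eta N) ->
  is_lim_seq eta 0 ->
  exists L : C, forall N, (N0 <= N)%nat -> Cmod (L - u N) <= eta N.
Proof.
intros H Heta.
assert (E : forall eps : posreal, exists K, (N0 <= K)%nat /\ forall N, (K <= N)%nat -> eta N < eps).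
{ intros eps. apply is_lim_seq_spec in Heta. destruct (Heta eps) as [K HK].
  exists (Nat.max K N0). split; [lia|]. intros N HN. specialize (HK N ltac:(lia)).
  rewrite Rminus_0_r in HK. now apply Rabs_lt_between in HK. }
assert (Q : forall eps : posreal, exists K, forall n m, (K <= n)%nat -> (K <= m)%nat ->
   Cmod (u n - u m) < eps).
{ intros eps. destruct (E eps) as [K [K0 HK]]. exists K. intros n m Hn Hm.
  destruct (Nat.le_ge_cases n m) as [L|L].
  - rewrite Cmod_minus_sym. eapply Rle_lt_trans; [apply H; lia|]. now apply HK.
  - eapply Rle_lt_trans; [apply H; lia|]. now apply HK. }
assert (Lr : ex_finite_lim_seq (fun n => Re (u n))).
{ apply ex_lim_seq_cauchy_corr. intros eps. destruct (Q eps) as [K HK]. exists K. intros n m Hn Hm.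
  eapply Rle_lt_trans; [|apply (HK n m Hn Hm)]. apply (re_le_Cmod (u n - u m)). }
assert (Li : ex_finite_lim_seq (fun n => Im (u n))).
{ apply ex_lim_seq_cauchy_corr. intros eps. destruct (Q eps) as [K HK]. exists K. intros n m Hn Hm.
  eapply Rle_lt_trans; [|apply (HK n m Hn Hm)]. apply (im_le_Cmod (u n - u m)). }
destruct Lr as [x Hx], Li as [y Hy]. exists (x, y). intros N HN.
apply le_epsilon. intros eps He.
apply is_lim_seq_spec in Hx. apply is_lim_seq_spec in Hy.
assert (He2 : 0 < eps / 2) by lra.
destruct (Hx (mkposreal _ He2)) as [K1 H1]. destruct (Hy (mkposreal _ He2)) as [K2 H2].
set (M := Nat.max N (Nat.max K1 K2)).
specialize (H1 M ltac:(lia)). specialize (H2 M ltac:(lia)). simpl in H1, H2.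
replace ((x, y) - u N)%C with (((x, y) - u M) + (u M - u N))%C by ring.
eapply Rle_trans; [apply Cmod_triangle|].
pose proof (H N M HN ltac:(lia)).
assert (Cmod ((x, y) - u M) <= eps).
{ eapply Rle_trans; [apply Cmod_le_sum|].
  change (Rabs (x - Re (u M)) + Rabs (y - Im (u M)) <= eps).
  rewrite Rabs_minus_sym, (Rabs_minus_sym y). lra. }
lra.
Qed.

Lemma is_lim_seq_Rpower_neg (K a : R) : 0 < a -> is_lim_seq (fun n => K * Rpower (INR n) (- a)) 0.
Proof.
intros Ha. replace (Finite 0) with (Rbar_mult (Finite K) (Finite 0)) by (simpl; f_equal; ring).
apply is_lim_seq_scal_l. apply is_lim_seq_spec. intros [eps He]. simpl.
destruct (archimed_cor1 (Rpower eps (/ a)) (Rpower_pos _ _)) as [n [Hn Hn0]].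
exists n. intros k Hk. rewrite Rminus_0_r, Rabs_pos_eq by (left; apply Rpower_pos).
apply lt_0_INR in Hn0 as Hn1. apply le_INR in Hk as Hk1.
rewrite Rpower_Ropp.
assert (H : / INR k < Rpower eps (/ a)).
{ eapply Rle_lt_trans; [|apply Hn]. apply Rinv_le_contravar; lra. }
assert (H2 : Rpower (/ INR k) a < Rpower (Rpower eps (/ a)) a).
{ apply Rlt_Rpower_l; auto. split; auto. apply Rinv_0_lt_compat; lra. }
rewrite Rpower_mult, Rinv_l, Rpower_1 in H2 by lra.
replace (/ Rpower (INR k) a) with (Rpower (/ INR k) a); auto.
unfold Rpower. rewrite ln_Rinv by lra. rewrite <- exp_Ropp. f_equal. ring.
Qed.

Lemma csum_sum_n_m_rev (f : nat -> C) (k q : nat) : (q < k)%nat ->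
  sum_n_m (G := C_AbelianMonoid) f (k - q) (k - 1) = csum (fun j => f (k - S j)%nat) q.
Proof.
induction q as [|q IH]; intros Hq.
- rewrite sum_n_m_zero by lia. reflexivity.
- cbn [csum]. rewrite <- IH by lia. rewrite sum_Sn_m by lia.
  replace (S (k - S q)) with (k - q)%nat by lia. apply Cplus_comm.
Qed.

(** Substituting [n = k - m], the range [k/2 < m <= k - 1] becomes [1 <= n <= (k-1)/2], so that the
    factors [n^(-s2)] form a partial sum of [zeta(s2)]. For [k = 0] the sum is empty. *)
Lemma AV2_inner_csum (s1 s2 : C) (k : nat) :
  AV2_inner s1 s2 k =
  csum (fun j => (npow_neg (k - S j) s1 * npow_neg (S j) s2)%C) ((k - 1) / 2).
Proof.
unfold AV2_inner. destruct k as [|k].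
- simpl. rewrite sum_n_m_zero by lia. reflexivity.
- replace (S k - 1)%nat with k by lia.
  pose proof (Nat.div_mod_eq k 2). pose proof (Nat.div_mod_eq (S k) 2).
  pose proof (Nat.mod_upper_bound k 2 ltac:(lia)). pose proof (Nat.mod_upper_bound (S k) 2 ltac:(lia)).
  replace (S k / 2 + 1)%nat with (S k - k / 2)%nat by lia.
  replace k with (S k - 1)%nat at 3 by lia.
  rewrite csum_sum_n_m_rev by lia. apply csum_ext. intros j Hj. do 2 f_equal. lia.
Qed.

(** Both bases are at least [k/2], so [cexp_lipschitz] applies with one bound [B], and
    [ln k - ln (k-n) <= n / (k-n) <= 2n/k]. *)
Lemma npow_neg_diff_le (s : C) (k n : nat) : 0 <= Re s -> (1 <= n)%nat -> (2 * n <= k)%nat ->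
  Cmod (npow_neg (k - n) s - npow_neg k s) <=
  4 * Rpower 2 (Re s) * Cmod s * INR n * Rpower (INR k) (- 1 - Re s).
Proof.
intros Hs Hn Hk.
assert (N1 : 1 <= INR n) by now apply INR_ge_1.
assert (K1 : 2 * INR n <= INR k).
{ apply le_INR in Hk. rewrite mult_INR in Hk. simpl in Hk. lra. }
assert (E : INR (k - n) = INR k - INR n) by (rewrite minus_INR; [auto|lia]).
set (B := Rpower 2 (Re s) * Rpower (INR k) (- Re s)).
assert (HB : forall m, INR k / 2 <= INR m -> exp (Re (- s * RtoC (ln (INR m)))) <= B).
{ intros m Hm. apply Rle_trans with (Rpower (INR m) (- Re s)).
  - unfold Rpower. right. f_equal. destruct s; simpl; ring.
  - apply Rle_trans with (Rpower (INR k / 2) (- Re s)).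
    + apply Rpower_antitone; lra.
    + right. unfold B, Rpower. rewrite <- exp_plus. f_equal. unfold Rdiv.
      rewrite ln_mult, ln_Rinv by lra. ring. }
rewrite !npow_neg_cexp.
eapply Rle_trans; [apply (cexp_lipschitz _ _ B); apply HB; lra|].
replace (- s * RtoC (ln (INR (k - n))) - - s * RtoC (ln (INR k)))%C with
  (s * RtoC (ln (INR k) - ln (INR (k - n))))%C by (rewrite RtoC_minus; ring).
rewrite Cmod_mult, Cmod_R.
assert (L : 0 <= ln (INR k) - ln (INR (k - n)) <= 2 * INR n * / INR k).
{ assert (ln (INR (k - n)) <= ln (INR k)) by (apply ln_le; lra). split; [lra|].
  rewrite <- ln_div by lra.
  pose proof (exp_ineq1_le (INR n / (INR k - INR n))) as X.
  assert (Y : INR k / INR (k - n) <= exp (INR n / (INR k - INR n))).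
  { rewrite E. eapply Rle_trans; [|apply X]. right. field. lra. }
  apply ln_le in Y; [|apply Rdiv_lt_0_compat; lra]. rewrite ln_exp in Y.
  eapply Rle_trans; [apply Y|]. unfold Rdiv.
  rewrite (Rmult_comm 2), Rmult_assoc. apply Rmult_le_compat_l; [lra|].
  replace (2 * / INR k) with (/ (INR k / 2)) by (field; lra). apply Rinv_le_contravar; lra. }
rewrite Rabs_pos_eq by lra.
assert (B0 : 0 < B) by (apply Rmult_lt_0_compat; apply Rpower_pos).
pose proof (Cmod_ge_0 s).
apply Rle_trans with (2 * B * (Cmod s * (2 * INR n * / INR k))).
- apply Rmult_le_compat_l; [lra|]. apply Rmult_le_compat_l; lra.
- right. replace (- 1 - Re s) with (- Re s + - (1)) by ring.
  rewrite Rpower_plus, (Rpower_Ropp (INR k) 1), Rpower_1 by lra. unfold B. ring.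
Qed.

Lemma zeta2_exists (s2 : C) (kappa : R) : 1 < kappa -> kappa <= Re s2 ->
  exists (zeta2 : C) (C2 : R), 0 <= C2 /\ forall n, Cmod (zeta2 - csum (fun j => npow_neg (S j) s2) n)
    <= C2 * Rpower (INR (S n)) (1 - kappa).
Proof.
intros Hk Hs.
set (K := Rpower 2 kappa / (kappa - 1)).
destruct (C_cauchy_limit (fun N => csum (fun j => npow_neg j s2) N)
   (fun N => K * Rpower (INR N) (- (kappa - 1))) 1) as [L HL].
- intros N M HN HNM. eapply Rle_trans.
  + apply (Cmod_csum_seg_le _ (fun j => Rpower (INR j) (- kappa))); auto.
    intros k Hk2. rewrite Cmod_npow_neg. apply Rle_Rpower; [apply INR_ge_1; lia|lra].
  + replace (- (kappa - 1)) with (1 - kappa) by ring. now apply rsum_power_gt1.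
- apply is_lim_seq_Rpower_neg. lra.
(* The sums converging to [L] start at index 0, where [ln 0 = 0] makes the term 1; it is removed
   here. *)
- exists (L - npow_neg 0 s2)%C, K. split.
  + unfold K. apply Rmult_le_pos; [left; apply Rpower_pos|]. left; apply Rinv_0_lt_compat; lra.
  + intros n. specialize (HL (S n) ltac:(lia)). rewrite csum_S_l in HL.
    replace (- (kappa - 1)) with (1 - kappa) in HL by ring.
    replace (L - npow_neg 0 s2 - csum (fun j => npow_neg (S j) s2) n)%C with
     (L - (npow_neg 0 s2 + csum (fun k => npow_neg (S k) s2) n))%C by ring. exact HL.
Qed.

(* [zeta2 = zeta(s2)]: up to a remainder whose Dirichlet series still converges at
   [sigma3], the coefficients are those of [zeta(s2) zeta(s1 + s3)]. *)
Lemma AV2_inner_asymp (s1 s2 : C) (kappa : R) : 0 <= Re s1 -> 1 < kappa < 2 -> kappa <= Re s2 ->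
  exists (zeta2 : C) (Cr : R), 0 <= Cr /\ forall k, (1 <= k)%nat ->
   Cmod (AV2_inner s1 s2 k - zeta2 * npow_neg k s1) <= Cr * Rpower (INR k) (1 - Re s1 - kappa).
Proof.
intros H1 Hk H2. destruct (zeta2_exists s2 kappa ltac:(lra) H2) as (zeta2 & C2 & HC2 & HZ).
set (D := 4 * Rpower 2 (Re s1) * Cmod s1).
assert (HD : 0 <= D).
{ unfold D. pose proof (Rpower_pos 2 (Re s1)). pose proof (Cmod_ge_0 s1). apply Rmult_le_pos; lra. }
exists zeta2, (D / (2 - kappa) + C2 * Rpower (/ 2) (1 - kappa)). split.
{ apply Rplus_le_le_0_compat; apply Rmult_le_pos; auto.
  - left; apply Rinv_0_lt_compat; lra.
  - left; apply Rpower_pos. }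
intros k Hk1. rewrite AV2_inner_csum. set (q := ((k - 1) / 2)%nat).
pose proof (Nat.div_mod_eq (k - 1) 2) as Q1. fold q in Q1.
pose proof (Nat.mod_upper_bound (k - 1) 2 ltac:(lia)) as Q2.
assert (K1 : 1 <= INR k) by now apply INR_ge_1.
(* Two errors: replacing [(k-n)^(-s1)] by [k^(-s1)], and completing the sum over [n] to
   [zeta(s2)]. *)
replace (csum (fun j => npow_neg (k - S j) s1 * npow_neg (S j) s2) q - zeta2 * npow_neg k s1)%C
 with (csum (fun j => (npow_neg (k - S j) s1 - npow_neg k s1) * npow_neg (S j) s2) q
   - npow_neg k s1 * (zeta2 - csum (fun j => npow_neg (S j) s2) q))%C.
2:{ rewrite (csum_ext (fun j => (npow_neg (k - S j) s1 - npow_neg k s1) * npow_neg (S j) s2)%C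
     (fun j => npow_neg (k - S j) s1 * npow_neg (S j) s2 + (- npow_neg k s1) * npow_neg (S j) s2)%C)
     by (intros; ring). rewrite csum_plus, csum_scal. ring. }
eapply Rle_trans; [apply Cmod_triangle_minus|].
rewrite Rmult_plus_distr_r. apply Rplus_le_compat.
- destruct (Nat.eq_dec q 0) as [q0|q0].
  { rewrite q0. simpl. rewrite Cmod_0. apply Rmult_le_pos; [|left; apply Rpower_pos].
    apply Rmult_le_pos; auto. left; apply Rinv_0_lt_compat; lra. }
  apply Rle_trans with (rsum (fun j => D * Rpower (INR k) (- 1 - Re s1) * Rpower (INR (S j)) (- (kappa - 1))) q).
  + apply Cmod_csum_le. intros j Hj. rewrite Cmod_mult, Cmod_npow_neg.
    pose proof (npow_neg_diff_le s1 k (S j) H1 ltac:(lia) ltac:(lia)) as P.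
    assert (J : 1 <= INR (S j)) by (apply INR_ge_1; lia).
    assert (R : Rpower (INR (S j)) (- Re s2) <= Rpower (INR (S j)) (- kappa)) by (apply Rle_Rpower; lra).
    eapply Rle_trans; [apply Rmult_le_compat; [apply Cmod_ge_0|left; apply Rpower_pos|apply P|apply R]|].
    right. replace (- (kappa - 1)) with (1 + - kappa) by ring.
    rewrite (Rpower_plus 1 (- kappa)), Rpower_1 by lra. fold D. ring.
  + rewrite rsum_scal.
    (* The factor [n] of the difference bound lowers the exponent to [kappa - 1], which is below 1
       because [kappa < 2]: the sum grows like [q^(2 - kappa)]. *)
    pose proof (rsum_power_lt1 (kappa - 1) q ltac:(lra) ltac:(lia)) as S1.
    assert (S2 : Rpower (INR q) (1 - (kappa - 1)) <= Rpower (INR k) (2 - kappa)).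
    { replace (1 - (kappa - 1)) with (2 - kappa) by ring. apply Rle_Rpower_l; [lra|].
      split; [apply lt_0_INR; lia|apply le_INR; lia]. }
    replace (1 - Re s1 - kappa) with ((- 1 - Re s1) + (2 - kappa)) by ring.
    rewrite Rpower_plus.
    replace (D / (2 - kappa) * _) with (D * Rpower (INR k) (- 1 - Re s1) * (Rpower (INR k) (2 - kappa) / (2 - kappa)))
      by (field; lra).
    apply Rmult_le_compat_l.
    * apply Rmult_le_pos; auto. left; apply Rpower_pos.
    * eapply Rle_trans; [apply S1|]. replace (1 - (kappa - 1)) with (2 - kappa) in * by ring.
      apply Rmult_le_compat_r; auto. left; apply Rinv_0_lt_compat; lra.
- rewrite Cmod_mult, Cmod_npow_neg.
  replace (1 - Re s1 - kappa) with (- Re s1 + (1 - kappa)) by ring. rewrite Rpower_plus.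
  replace (C2 * _ * _) with (Rpower (INR k) (- Re s1) *
    (C2 * (Rpower (/ 2) (1 - kappa) * Rpower (INR k) (1 - kappa)))) by ring.
  apply Rmult_le_compat_l; [left; apply Rpower_pos|].
  eapply Rle_trans; [apply HZ|]. apply Rmult_le_compat_l; auto.
  rewrite Rpower_mult_distr by lra. replace (1 - kappa) with (- (kappa - 1)) by ring.
  apply Rpower_antitone; try lra.
  (* The tail of [zeta(s2)] starts at [q + 1 >= k/2], hence the factor [(1/2)^(1 - kappa)]. *)
  assert (k <= 2 * S q)%nat as X by lia. apply le_INR in X. rewrite mult_INR in X. simpl (INR 2) in X. lra.
Qed.

(** * Mean squares of Dirichlet polynomials *)

Lemma is_RInt_oscillation (g : C) (lam a b : R) : lam <> 0 ->
  exists v, is_RInt (fun t => Re (g * cexp (0, lam * t))) a b v /\ Rabs v <= 2 * Cmod g / Rabs lam.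
Proof.
intros Hl. set (F := fun t => Im (g * cexp (0, lam * t)) / lam).
exists (F b - F a). split.
- apply (is_RInt_derive F).
  + intros t _. destruct g as [x y]. unfold F, cexp. simpl. auto_derive; [easy|].
    rewrite exp_0. field. auto.
  + intros t _. destruct g as [x y]. unfold cexp. simpl.
    apply (ex_derive_continuous (fun t => x * (exp 0 * cos (lam * t)) - y * (exp 0 * sin (lam * t)))).
    auto_derive. easy.
- assert (B : forall t, Rabs (F t) <= Cmod g / Rabs lam).
  { intros t. unfold F, Rdiv. rewrite Rabs_mult, Rabs_inv. apply Rmult_le_compat_r.
    - left. apply Rinv_0_lt_compat. now apply Rabs_pos_lt.
    - eapply Rle_trans; [apply im_le_Cmod|]. rewrite Cmod_mult, Cmod_cexp. simpl. rewrite exp_0. lra. }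
  unfold Rminus. eapply Rle_trans; [apply Rabs_triang|]. rewrite Rabs_Ropp.
  pose proof (B a). pose proof (B b). unfold Rdiv in *. lra.
Qed.

(** [npow_neg k (0, t)] is [k^(-it)]. At [k = 0] it is 1, as [ln 0 = 0]; the mean square lemmas
    therefore ask for [c O = 0]. *)
Definition dpoly (c : nat -> C) (n : nat) (t : R) : C :=
  csum (fun k => (c k * npow_neg k (0, t))%C) n.

Lemma Re_csum_mult (f : nat -> C) (z : C) (n : nat) :
  Re (csum f n * z) = rsum (fun k => Re (f k * z)) n.
Proof.
induction n as [|n IH].
- destruct z; simpl; ring.
- cbn [csum rsum]. rewrite <- IH. destruct z, (f n), (csum f n). simpl. ring.
Qed.

Lemma is_RInt_0 (a b : R) : is_RInt (fun _ : R => 0) a b 0.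
Proof.
pose proof (is_RInt_const (V := R_NormedModule) a b 0) as H.
replace (scal (b - a) (0 : R_NormedModule)) with 0 in H; auto.
unfold scal; simpl; unfold mult; simpl; ring.
Qed.

Lemma is_RInt_rsum (f : nat -> R -> R) (v : nat -> R) (a b : R) (n : nat) :
  (forall k, (k < n)%nat -> is_RInt (f k) a b (v k)) ->
  is_RInt (fun t => rsum (fun k => f k t) n) a b (rsum v n).
Proof.
induction n as [|n IH]; intros H; cbn [rsum].
- apply is_RInt_0.
- apply (is_RInt_plus (V := R_NormedModule)); auto.
Qed.

Lemma Rabs_rsum_le (f g : nat -> R) (n : nat) :
  (forall k, (k < n)%nat -> Rabs (f k) <= g k) -> Rabs (rsum f n) <= rsum g n.
Proof.
induction n as [|n IH]; intros H; cbn [rsum]; [rewrite Rabs_R0; lra|].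
eapply Rle_trans; [apply Rabs_triang|]. apply Rplus_le_compat; auto.
Qed.

(** The weight [l / (l - k)] bounds [1 / (ln l - ln k)], the inverse frequency of the product of the
    terms [k] and [l], for [k >= 1]; index 0 is left out. *)
Definition near_diagonal (c : nat -> C) (l : nat) : R :=
  rsum (fun k => match k with O => 0 | _ => Cmod (c k) * (INR l / (INR l - INR k)) end) l.

Lemma ln_ratio_lower (x y : R) : 0 < x -> x < y -> (y - x) / y <= ln y - ln x.
Proof.
intros Hx Hxy. pose proof (exp_ineq1_le (ln x - ln y)) as H.
unfold Rminus at 2 in H. rewrite exp_plus, exp_Ropp, !exp_ln in H by lra.
replace ((y - x) / y) with (1 - x * / y) by (field; lra). lra.
Qed.

Lemma Cmod_sqr_plus (u v : C) : Cmod (u + v) ^ 2 = Cmod u ^ 2 + (Cmod v ^ 2 + 2 * Re (u * Cconj v)).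
Proof. rewrite !Cmod2_alt. destruct u, v. simpl. ring. Qed.

Lemma dirichlet_cross_term (c : nat -> C) (n : nat) (a b : R) : c O = 0 ->
  exists v, is_RInt (fun t => Re (dpoly c n t * Cconj (c n * npow_neg n (0, t)))) a b v /\
    Rabs v <= 2 * (Cmod (c n) * near_diagonal c n).
Proof.
intros c0.
assert (T : forall k, (k < n)%nat -> exists v,
  is_RInt (fun t => Re (c k * npow_neg k (0, t) * Cconj (c n * npow_neg n (0, t)))) a b v /\
  Rabs v <= 2 * Cmod (c n) * match k with O => 0 | _ => Cmod (c k) * (INR n / (INR n - INR k)) end).
{ intros k Hk. destruct k as [|k'].
  - exists 0. rewrite Rabs_R0. split; [|lra].
    apply (is_RInt_ext (fun _ => 0)).
    + intros t _. rewrite c0. replace (0 * npow_neg 0 (0, t) * _)%C with (RtoC 0) by ring. reflexivity.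
    + apply is_RInt_0.
  - set (k := S k') in *.
    assert (K1 : 1 <= INR k) by (apply INR_ge_1; unfold k; lia).
    assert (KN : INR k < INR n) by (apply lt_INR; auto).
    pose proof (ln_ratio_lower (INR k) (INR n) ltac:(lra) KN) as L.
    assert (L0 : 0 < (INR n - INR k) / INR n) by (apply Rdiv_lt_0_compat; lra).
    destruct (is_RInt_oscillation (c k * Cconj (c n)) (ln (INR n) - ln (INR k)) a b ltac:(lra))
      as [v [Hv Bv]].
    exists v. split.
    + revert Hv. apply is_RInt_ext. intros t _. f_equal.
      rewrite !npow_neg_cexp, Cmult_conj.
      replace (Cconj (cexp (- (0, t) * RtoC (ln (INR n))))) with (cexp ((0, t) * RtoC (ln (INR n)))).
      * replace (cexp (0, (ln (INR n) - ln (INR k)) * t)) with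
          (cexp (- (0, t) * RtoC (ln (INR k))) * cexp ((0, t) * RtoC (ln (INR n))))%C; [ring|].
        rewrite <- cexp_plus. f_equal. apply injective_projections; simpl; ring.
      * unfold cexp, Cconj. simpl.
        replace (- 0 * ln (INR n) - - t * 0) with (0 * ln (INR n) - t * 0) by ring.
        replace (- 0 * 0 + - t * ln (INR n)) with (- (0 * 0 + t * ln (INR n))) by ring.
        rewrite cos_neg, sin_neg. apply injective_projections; simpl; ring.
    + eapply Rle_trans; [apply Bv|]. rewrite Cmod_mult, Cmod_conj, Rabs_pos_eq by lra.
      unfold Rdiv at 1.
      replace (2 * Cmod (c n) * (Cmod (c k) * (INR n / (INR n - INR k)))) with
        (2 * (Cmod (c k) * Cmod (c n)) * (INR n / (INR n - INR k))) by ring.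
      pose proof (Cmod_ge_0 (c k)). pose proof (Cmod_ge_0 (c n)).
      apply Rmult_le_compat_l.
      * apply Rmult_le_pos; [lra|]. apply Rmult_le_pos; auto.
      * replace (INR n / (INR n - INR k)) with (/ ((INR n - INR k) / INR n)) by (field; lra).
        apply Rinv_le_contravar; lra. }
assert (V : exists v : nat -> R, forall k, (k < n)%nat ->
  is_RInt (fun t => Re (c k * npow_neg k (0, t) * Cconj (c n * npow_neg n (0, t)))) a b (v k) /\
  Rabs (v k) <= 2 * Cmod (c n) * match k with O => 0 | _ => Cmod (c k) * (INR n / (INR n - INR k)) end).
{ exists (fun k => RInt (fun t => Re (c k * npow_neg k (0, t) * Cconj (c n * npow_neg n (0, t)))) a b).
  intros k Hk. destruct (T k Hk) as [v [Hv Bv]].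
  rewrite (is_RInt_unique _ _ _ _ Hv). auto. }
destruct V as [v Hv]. exists (rsum v n). split.
- apply (is_RInt_ext (fun t => rsum (fun k =>
     Re (c k * npow_neg k (0, t) * Cconj (c n * npow_neg n (0, t)))) n)).
  + intros t _. unfold dpoly. now rewrite Re_csum_mult.
  + apply is_RInt_rsum. intros k Hk. now apply Hv.
- rewrite <- Rmult_assoc. unfold near_diagonal. rewrite <- rsum_scal.
  apply Rabs_rsum_le. intros k Hk. now apply Hv.
Qed.

(** Adding the term [c_n n^(-it)] changes the squared modulus by the constant [|c_n|^2] and twice a
    cross term. The cross terms are bounded separately, at the price of a logarithm when the
    coefficients decay like a power. *)
Lemma dirichlet_mean_square (c : nat -> C) (n : nat) (a b : R) : c O = 0 ->
  exists I, is_RInt (fun t => Cmod (dpoly c n t) ^ 2) a b I /\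
   Rabs (I - (b - a) * rsum (fun k => Cmod (c k) ^ 2) n) <=
   4 * rsum (fun l => Cmod (c l) * near_diagonal c l) n.
Proof.
intros c0. induction n as [|n [I [HI BI]]].
- exists 0. cbn [rsum]. split.
  + apply (is_RInt_ext (fun _ => 0)).
    * intros t _. unfold dpoly. simpl. rewrite Cmod_0. ring.
    * apply is_RInt_0.
  + replace (0 - (b - a) * 0) with 0 by ring. rewrite Rabs_R0. lra.
- destruct (dirichlet_cross_term c n a b c0) as [v [Hv Bv]].
  exists (I + ((b - a) * Cmod (c n) ^ 2 + 2 * v)). cbn [rsum]. split.
  + apply (is_RInt_ext (fun t => Cmod (dpoly c n t) ^ 2 +
      (Cmod (c n) ^ 2 + 2 * Re (dpoly c n t * Cconj (c n * npow_neg n (0, t)))))).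
    * intros t _. unfold dpoly at 3. cbn [csum]. rewrite Cmod_sqr_plus. fold (dpoly c n t).
      do 2 f_equal. rewrite Cmod_mult, Cmod_npow_neg. simpl Re.
      unfold Rpower. rewrite Ropp_0, Rmult_0_l, exp_0. ring.
    * apply (is_RInt_plus (V := R_NormedModule)); auto.
      apply (is_RInt_plus (V := R_NormedModule)).
      -- apply (is_RInt_const (V := R_NormedModule) a b (Cmod (c n) ^ 2)).
      -- apply (is_RInt_scal (V := R_NormedModule) _ a b 2 v Hv).
  + replace (_ - _) with ((I - (b - a) * rsum (fun k => Cmod (c k) ^ 2) n) + 2 * v) by ring.
    eapply Rle_trans; [apply Rabs_triang|]. rewrite Rabs_mult, (Rabs_pos_eq 2) by lra. lra.
Qed.

Lemma near_diagonal_le (c : nat -> C) (A t : R) (l : nat) : 0 <= A -> t <= 1 -> (1 <= l)%nat ->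
  (forall k, (1 <= k)%nat -> Cmod (c k) <= A * Rpower (INR k) (- t)) ->
  near_diagonal c l <= 2 * A * Rpower (INR l) (1 - t) * (1 + ln (INR l)).
Proof.
intros HA Ht Hl Hc. unfold near_diagonal.
apply Rle_trans with (rsum (fun k => A * match k with O => 0 | _ =>
  Rpower (INR k) (- t) * (INR l / (INR l - INR k)) end) l).
- apply rsum_le. intros k Hk. destruct k as [|k']; [lra|]. rewrite <- Rmult_assoc.
  apply Rmult_le_compat_r; [|apply Hc; lia].
  apply lt_INR in Hk. pose proof (pos_INR l).
  apply Rmult_le_pos; auto. left. apply Rinv_0_lt_compat; lra.
- rewrite rsum_scal. eapply Rle_trans; [apply Rmult_le_compat_l; [auto|apply (near_diagonal_sum_le t l Ht Hl)]|].
  right. ring.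
Qed.

(** One factor [l^(-tau)] comes from the coefficient and [l^(1-tau)] from the near-diagonal sum, so
    [l^(1-2 tau)] has to be summed; its exponent lies in [(-1, 0)]. *)
Lemma off_diagonal_le (c : nat -> C) (A tau : R) (n : nat) : c O = 0 -> 0 <= A -> 1 / 2 < tau < 1 ->
  (1 <= n)%nat -> (forall k, (1 <= k)%nat -> Cmod (c k) <= A * Rpower (INR k) (- tau)) ->
  rsum (fun l => Cmod (c l) * near_diagonal c l) n <=
  A ^ 2 / (1 - tau) * (Rpower (INR n) (2 - 2 * tau) * (1 + ln (INR n))).
Proof.
intros c0 HA Ht Hn Hc. destruct n as [|n]; [lia|]. rewrite rsum_S_l, c0, Cmod_0, Rmult_0_l, Rplus_0_l.
set (L := 1 + ln (INR (S n))).
assert (HL : 1 <= L).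
{ unfold L. pose proof (ln_le 1 (INR (S n)) ltac:(lra) ltac:(apply INR_ge_1; lia)) as H.
  rewrite ln_1 in H. lra. }
destruct (Nat.eq_dec n 0) as [->|n0].
{ simpl rsum. apply Rmult_le_pos.
  - apply Rmult_le_pos; [nra|]. left; apply Rinv_0_lt_compat; lra.
  - apply Rmult_le_pos; [left; apply Rpower_pos|lra]. }
apply Rle_trans with (rsum (fun j => 2 * A ^ 2 * L * Rpower (INR (S j)) (- (2 * tau - 1))) n).
- apply rsum_le. intros j Hj.
  assert (J : 1 <= INR (S j)) by (apply INR_ge_1; lia).
  pose proof (near_diagonal_le c A tau (S j) HA ltac:(lra) ltac:(lia) Hc) as D.
  assert (LJ : 1 + ln (INR (S j)) <= L).
  { unfold L. apply Rplus_le_compat_l. apply ln_le; [lra|]. apply le_INR; lia. }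
  assert (LJ0 : 0 <= ln (INR (S j))).
  { rewrite <- ln_1. apply ln_le; lra. }
  pose proof (Rpower_pos (INR (S j)) (1 - tau)) as P1.
  pose proof (Rpower_pos (INR (S j)) (- tau)) as P2.
  replace (- (2 * tau - 1)) with (- tau + (1 - tau)) by ring. rewrite Rpower_plus.
  apply Rle_trans with (A * Rpower (INR (S j)) (- tau) * (2 * A * Rpower (INR (S j)) (1 - tau) * L)).
  + apply Rmult_le_compat; auto using Cmod_ge_0.
    * apply (rsum_seg_nonneg _ 0); [lia|].
      intros k [_ Hk]. apply lt_INR in Hk. destruct k; [lra|].
      apply Rmult_le_pos; [apply Cmod_ge_0|].
      apply Rmult_le_pos; [lra|]. left; apply Rinv_0_lt_compat; lra.
    * apply Hc. lia.
    * eapply Rle_trans; [apply D|]. apply Rmult_le_compat_l; auto.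
      apply Rmult_le_pos; lra.
  + right. ring.
- rewrite rsum_scal.
  pose proof (rsum_power_lt1 (2 * tau - 1) n ltac:(lra) ltac:(lia)) as S1.
  replace (1 - (2 * tau - 1)) with (2 - 2 * tau) in S1 by ring.
  assert (S2 : Rpower (INR n) (2 - 2 * tau) <= Rpower (INR (S n)) (2 - 2 * tau)).
  { apply Rle_Rpower_l; [lra|]. split; [apply lt_0_INR; lia|apply le_INR; lia]. }
  assert (0 <= A ^ 2 * L) by (apply Rmult_le_pos; nra).
  apply Rle_trans with (2 * A ^ 2 * L * (Rpower (INR (S n)) (2 - 2 * tau) / (2 - 2 * tau))).
  + apply Rmult_le_compat_l; [lra|]. eapply Rle_trans; [apply S1|].
    apply Rmult_le_compat_r; auto. left; apply Rinv_0_lt_compat; lra.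
  + right. fold L. field. lra.
Qed.

Lemma ln_le_power (x d : R) : 0 < d -> 1 <= x -> 1 + ln x <= (1 + / d) * Rpower x d.
Proof.
intros Hd Hx. assert (0 <= ln x) by (rewrite <- ln_1; apply ln_le; lra).
assert (0 < / d) by now apply Rinv_0_lt_compat.
pose proof (exp_ineq1_le (d * ln x)) as H2. fold (Rpower x d) in H2.
assert (ln x <= / d * Rpower x d).
{ apply Rmult_le_reg_l with d; auto. rewrite <- Rmult_assoc, Rinv_r by lra. lra. }
assert (1 <= Rpower x d) by nra. nra.
Qed.

(** Coefficients of size [1/k] already make the near-diagonal sum logarithmic; half of the excess
    [beta - 1] absorbs the logarithm and the other half keeps the outer sum convergent. *)
Lemma off_diagonal_bounded (c : nat -> C) (A beta : R) (n : nat) : c O = 0 -> 0 <= A -> 1 < beta ->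
  (1 <= n)%nat -> (forall k, (1 <= k)%nat -> Cmod (c k) <= A * Rpower (INR k) (- beta)) ->
  rsum (fun l => Cmod (c l) * near_diagonal c l) n <=
  2 * A ^ 2 * (1 + 2 / (beta - 1)) * (Rpower 2 ((beta + 1) / 2) / ((beta - 1) / 2)).
Proof.
intros c0 HA Hb Hn Hc.
set (d := (beta - 1) / 2).
assert (Hc1 : forall k, (1 <= k)%nat -> Cmod (c k) <= A * Rpower (INR k) (- (1))).
{ intros k Hk. eapply Rle_trans; [now apply Hc|]. apply Rmult_le_compat_l; auto.
  apply Rle_Rpower; [now apply INR_ge_1|lra]. }
pose proof (rsum_power_gt1 ((beta + 1) / 2) 1 n ltac:(lra) ltac:(lia) Hn) as S1.
assert (Hd : 0 < d) by (unfold d; lra).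
assert (Di : 0 < / d) by now apply Rinv_0_lt_compat.
set (K := 2 * A ^ 2 * (1 + / d)).
assert (HK : 0 <= K) by (unfold K; nra).
apply Rle_trans with (K * (rsum (fun j => Rpower (INR j) (- ((beta + 1) / 2))) n -
   rsum (fun j => Rpower (INR j) (- ((beta + 1) / 2))) 1)).
- assert (E : forall m, (1 <= m)%nat -> rsum (fun l => Cmod (c l) * near_diagonal c l) m =
   rsum (fun l => Cmod (c l) * near_diagonal c l) m - rsum (fun l => Cmod (c l) * near_diagonal c l) 1).
  { intros m _. cbn [rsum]. rewrite c0, Cmod_0. ring. }
  rewrite E by auto. rewrite Rmult_minus_distr_l, <- !rsum_scal. apply rsum_le_seg; auto.
  intros k Hk. assert (J : 1 <= INR k) by (apply INR_ge_1; lia).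
  pose proof (near_diagonal_le c A 1 k HA ltac:(lra) ltac:(lia) Hc1) as D.
  replace (1 - 1) with 0 in D by ring. rewrite Rpower_O, Rmult_1_r in D by lra.
  pose proof (ln_le_power (INR k) d Hd J) as L.
  replace (- ((beta + 1) / 2)) with (- beta + d) by (unfold d; field). rewrite Rpower_plus.
  pose proof (Rpower_pos (INR k) (- beta)) as P2.
  apply Rle_trans with (A * Rpower (INR k) (- beta) * (2 * A * ((1 + / d) * Rpower (INR k) d))).
  + apply Rle_trans with (Cmod (c k) * (2 * A * ((1 + / d) * Rpower (INR k) d))).
    * apply Rmult_le_compat_l; [apply Cmod_ge_0|]. eapply Rle_trans; [apply D|].
      apply Rmult_le_compat_l; lra.
    * apply Rmult_le_compat_r; [|apply Hc; lia]. apply Rmult_le_pos; [lra|].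
      apply Rmult_le_pos; [lra|]. left; apply Rpower_pos.
  + right. unfold K. ring.
- apply Rle_trans with (K * (Rpower 2 ((beta + 1) / 2) / ((beta + 1) / 2 - 1) *
     Rpower (INR 1) (1 - (beta + 1) / 2))).
  + apply Rmult_le_compat_l; auto.
  + right. simpl INR. unfold Rpower at 2. rewrite ln_1, Rmult_0_r, exp_0.
    replace ((beta + 1) / 2 - 1) with d by (unfold d; field). unfold K.
    replace (2 / (beta - 1)) with (/ d) by (unfold d; field; lra). ring.
Qed.

(** * Goursat's theorem on rectangles *)

(** The integral of [A dx + B dy] counterclockwise around [[a,b] x [c,d]]. *)
Definition circulation (A B : R -> R -> R) (a b c d : R) : R :=
  RInt (fun x => A x c) a b - RInt (fun x => A x d) a b +
  (RInt (fun y => B b y) c d - RInt (fun y => B a y) c d).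

(** Closedness is the shared [m], which is both the [y]-derivative of [A] and the [x]-derivative of
    [B]; it is asked pointwise only. *)
Definition closed_form_on (A B : R -> R -> R) (a b c d : R) : Prop :=
  forall x y, a <= x <= b -> c <= y <= d ->
  exists lx m ly, differentiable_pt_lim A x y lx m /\ differentiable_pt_lim B x y m ly.

Lemma differentiable_continuous_fst (A : R -> R -> R) (x y lx ly : R) :
  differentiable_pt_lim A x y lx ly -> continuous (fun u => A u y) x.
Proof.
intros H. assert (K : continuity_2d_pt A x y) by (apply differentiable_continuity_pt; now exists lx, ly).
apply filterlim_locally. intros eps. destruct (K eps) as [d Hd]. exists d. intros u Hu.
apply Hd; [exact Hu|]. rewrite Rminus_eq_0, Rabs_R0. apply cond_pos.
Qed.

Lemma differentiable_continuous_snd (A : R -> R -> R) (x y lx ly : R) :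
  differentiable_pt_lim A x y lx ly -> continuous (fun v => A x v) y.
Proof.
intros H. assert (K : continuity_2d_pt A x y) by (apply differentiable_continuity_pt; now exists lx, ly).
apply filterlim_locally. intros eps. destruct (K eps) as [d Hd]. exists d. intros u Hu.
apply Hd; [|exact Hu]. rewrite Rminus_eq_0, Rabs_R0. apply cond_pos.
Qed.

Lemma ex_RInt_cont_le (f : R -> R) (a b : R) : a <= b ->
  (forall x, a <= x <= b -> continuous f x) -> ex_RInt f a b.
Proof.
intros Hab H. apply (ex_RInt_continuous (V := R_CompleteNormedModule)). intros z Hz.
rewrite Rmin_left, Rmax_right in Hz by lra. now apply H.
Qed.

Lemma closed_form_sub (A B : R -> R -> R) (a b c d a' b' c' d' : R) :
  closed_form_on A B a b c d -> a <= a' -> b' <= b -> c <= c' -> d' <= d ->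
  closed_form_on A B a' b' c' d'.
Proof. intros H Ha Hb Hc Hd x y Hx Hy. apply H; lra. Qed.

Lemma closed_form_integrable (A B : R -> R -> R) (a b c d : R) :
  closed_form_on A B a b c d -> a <= b -> c <= d ->
  (forall y x x', c <= y <= d -> a <= x -> x <= x' -> x' <= b -> ex_RInt (fun u => A u y) x x') /\
  (forall x y y', a <= x <= b -> c <= y -> y <= y' -> y' <= d -> ex_RInt (fun v => B x v) y y').
Proof.
intros H Hab Hcd. split.
- intros y x x' Hy Hx Hxx Hx'. apply ex_RInt_cont_le; auto. intros u Hu.
  destruct (H u y ltac:(lra) Hy) as (lx & m & ly & HA & _).
  now apply differentiable_continuous_fst with (1 := HA).
- intros x y y' Hx Hy Hyy Hy'. apply ex_RInt_cont_le; auto. intros v Hv.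
  destruct (H x v Hx ltac:(lra)) as (lx & m & ly & _ & HB).
  now apply differentiable_continuous_snd with (1 := HB).
Qed.

Lemma circulation_split (A B : R -> R -> R) (a e b c f d : R) :
  closed_form_on A B a b c d -> a <= e -> e <= b -> c <= f -> f <= d ->
  circulation A B a b c d =
  circulation A B a e c f + circulation A B e b c f +
  circulation A B a e f d + circulation A B e b f d.
Proof.
intros H Ha He Hc Hf.
destruct (closed_form_integrable A B a b c d H ltac:(lra) ltac:(lra)) as [IA IB].
unfold circulation.
rewrite <- (RInt_Chasles (fun x => A x c) a e b) by (apply IA; lra).
rewrite <- (RInt_Chasles (fun x => A x d) a e b) by (apply IA; lra).
rewrite <- (RInt_Chasles (fun y => B a y) c f d) by (apply IB; lra).
rewrite <- (RInt_Chasles (fun y => B b y) c f d) by (apply IB; lra).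
unfold plus; simpl. ring.
Qed.

Lemma RInt_diff_near_const (f g : R -> R) (a b K eps : R) : a <= b ->
  ex_RInt f a b -> ex_RInt g a b ->
  (forall x, a <= x <= b -> Rabs (f x - g x - K) <= eps) ->
  Rabs (RInt f a b - RInt g a b - K * (b - a)) <= eps * (b - a).
Proof.
intros Hab Hf Hg H.
assert (E : is_RInt (fun x => f x - g x - K) a b (RInt f a b - RInt g a b - K * (b - a))).
{ apply (is_RInt_minus (V := R_NormedModule)).
  - apply (is_RInt_minus (V := R_NormedModule)); now apply (RInt_correct (V := R_CompleteNormedModule)).
  - pose proof (is_RInt_const (V := R_NormedModule) a b K) as I.
    unfold scal in I; simpl in I; unfold mult in I; simpl in I. now rewrite Rmult_comm in I. }
pose proof (norm_RInt_le_const (V := R_NormedModule) (fun x => f x - g x - K) a b _ eps Hab H E) as N.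
unfold norm in N; simpl in N; unfold abs in N; simpl in N. lra.
Qed.

(** The affine parts of [A] and [B] at [(x, y)] contribute nothing, because the two mixed terms
    carry the same [m] with opposite signs. What remains is at most [eps] times the size, integrated
    along the sides. *)
Lemma circulation_small (A B : R -> R -> R) (x y lx m ly : R) :
  differentiable_pt_lim A x y lx m -> differentiable_pt_lim B x y m ly ->
  forall eps : posreal, exists delta : posreal, forall a b c d,
   closed_form_on A B a b c d ->
   a <= x <= b -> c <= y <= d -> (b - a) + (d - c) < delta ->
   Rabs (circulation A B a b c d) <= 2 * eps * ((b - a) + (d - c)) ^ 2.
Proof.
intros HA HB eps. destruct (HA eps) as [d1 H1]. destruct (HB eps) as [d2 H2].
assert (Hd : 0 < Rmin d1 d2) by (apply Rmin_pos; apply cond_pos).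
exists (mkposreal _ Hd). intros a b c d F Hx Hy Hs. simpl in Hs.
pose proof (Rmin_l d1 d2). pose proof (Rmin_r d1 d2).
destruct (closed_form_integrable A B a b c d F ltac:(lra) ltac:(lra)) as [IA IB].
set (s := (b - a) + (d - c)) in *. assert (Es : s = (b - a) + (d - c)) by reflexivity.
assert (e0 := cond_pos eps).
assert (M : forall u v, a <= u <= b -> c <= v <= d -> Rmax (Rabs (u - x)) (Rabs (v - y)) <= s).
{ intros u v Hu Hv. unfold s. apply Rmax_lub; apply Rabs_le; lra. }
assert (X : Rabs (RInt (fun u => A u c) a b - RInt (fun u => A u d) a b - m * (c - d) * (b - a)) <= 2 * eps * s * (b - a)).
{ apply RInt_diff_near_const; [lra|apply IA; lra|apply IA; lra|]. intros u Hu.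
  assert (P : forall v, c <= v <= d -> Rabs (A u v - A x y - (lx * (u - x) + m * (v - y))) <= eps * s).
  { intros v Hv. eapply Rle_trans; [apply H1|].
    - apply Rabs_lt_between. lra.
    - apply Rabs_lt_between. lra.
    - apply Rmult_le_compat_l; [lra|]. now apply M. }
  pose proof (P c ltac:(lra)) as Pc. pose proof (P d ltac:(lra)) as Pd.
  apply Rabs_le_between in Pc, Pd. apply Rabs_le. lra. }
assert (Y : Rabs (RInt (fun v => B b v) c d - RInt (fun v => B a v) c d - m * (b - a) * (d - c)) <= 2 * eps * s * (d - c)).
{ apply RInt_diff_near_const; [lra|apply IB; lra|apply IB; lra|]. intros v Hv.
  assert (P : forall u, a <= u <= b -> Rabs (B u v - B x y - (m * (u - x) + ly * (v - y))) <= eps * s).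
  { intros u Hu. eapply Rle_trans; [apply H2|].
    - apply Rabs_lt_between. lra.
    - apply Rabs_lt_between. lra.
    - apply Rmult_le_compat_l; [lra|]. now apply M. }
  pose proof (P a ltac:(lra)) as Pc. pose proof (P b ltac:(lra)) as Pd.
  apply Rabs_le_between in Pc, Pd. apply Rabs_le. lra. }
unfold circulation. apply Rabs_le_between in X, Y. apply Rabs_le.
replace (2 * eps * s ^ 2) with (2 * eps * s * (b - a) + 2 * eps * s * (d - c)) by (unfold s; ring).
lra.
Qed.

Lemma nested_halving (x : nat -> R) (s : R) : 0 <= s ->
  (forall n, x n <= x (S n) /\ x (S n) + s / 2 ^ S n <= x n + s / 2 ^ n) ->
  exists l, forall n, x n <= l <= x n + s / 2 ^ n.
Proof.
intros Hs H.
assert (P : forall n, 0 <= s / 2 ^ n).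
{ intros n. apply Rmult_le_pos; auto. left. apply Rinv_0_lt_compat. apply pow_lt; lra. }
assert (Hx : forall n k, x n <= x (n + k)%nat /\ x (n + k)%nat <= x n + s / 2 ^ n).
{ intros n k. assert (x n <= x (n + k)%nat /\ x (n + k)%nat + s / 2 ^ (n + k) <= x n + s / 2 ^ n).
  { induction k as [|k IH]; [rewrite Nat.add_0_r; lra|].
    rewrite Nat.add_succ_r. destruct (H (n + k)%nat). lra. }
  pose proof (P (n + k)%nat). lra. }
destruct (ex_finite_lim_seq_incr x (x O + s / 2 ^ 0)) as [l Hl].
- intros n. apply H.
- intros n. apply (Hx O n).
- exists l. intros n. apply is_lim_seq_incr_n with (N := n) in Hl.
  split.
  + apply (is_lim_seq_le (fun _ => x n) (fun k => x (k + n)%nat) (x n) l); auto using is_lim_seq_const.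
    intros k. rewrite Nat.add_comm. apply Hx.
  + apply (is_lim_seq_le (fun k => x (k + n)%nat) (fun _ => x n + s / 2 ^ n) l (x n + s / 2 ^ n));
    auto using is_lim_seq_const.
    intros k. rewrite Nat.add_comm. apply Hx.
Qed.

(* Goursat: no continuity of the partial derivatives is assumed. *)
Lemma goursat_green (A B : R -> R -> R) (a b c d : R) : a <= b -> c <= d ->
  closed_form_on A B a b c d -> circulation A B a b c d = 0.
Proof.
intros Hab Hcd F.
destruct (Req_dec (circulation A B a b c d) 0) as [|NZ]; auto. exfalso.
set (eta := Rabs (circulation A B a b c d)).
assert (Heta : 0 < eta) by now apply Rabs_pos_lt.
set (w := fun n => (b - a) / 2 ^ n). set (h := fun n => (d - c) / 2 ^ n).
assert (W2 : forall n, w n = 2 * w (S n)).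
{ intros n. unfold w. simpl. field. apply pow_nonzero. lra. }
assert (H2 : forall n, h n = 2 * h (S n)).
{ intros n. unfold h. simpl. field. apply pow_nonzero. lra. }
assert (W0 : forall n, 0 <= w n).
{ intros n. apply Rmult_le_pos; [lra|]. left. apply Rinv_0_lt_compat, pow_lt. lra. }
assert (H0 : forall n, 0 <= h n).
{ intros n. apply Rmult_le_pos; [lra|]. left. apply Rinv_0_lt_compat, pow_lt. lra. }
set (circ := fun n (p : R * R) => circulation A B (fst p) (fst p + w n) (snd p) (snd p + h n)).
set (Inv := fun n (p : R * R) => a <= fst p /\ fst p + w n <= b /\ c <= snd p /\ snd p + h n <= d /\
   eta / 4 ^ n <= Rabs (circ n p)).
set (Sub := fun n (p p' : R * R) => fst p <= fst p' /\ fst p' + w (S n) <= fst p + w n /\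
   snd p <= snd p' /\ snd p' + h (S n) <= snd p + h n).
(* Pigeonhole: the circulations of the four quarters add up to that of the rectangle, so one of them
   keeps at least a quarter of its modulus. *)
assert (Step : forall n p, Inv n p -> exists p', Inv (S n) p' /\ Sub n p p').
{ intros n [x y] (I1 & I2 & I3 & I4 & I5). simpl in I1, I2, I3, I4.
  pose proof (W2 n) as w2. pose proof (H2 n) as h2. pose proof (W0 (S n)) as w0. pose proof (H0 (S n)) as h0.
  set (w' := w (S n)) in *. set (h' := h (S n)) in *.
  assert (E : circ n (x, y) = circ (S n) (x, y) + circ (S n) (x + w', y) +
      circ (S n) (x, y + h') + circ (S n) (x + w', y + h')).
  { unfold circ. simpl fst; simpl snd. fold w' h'.
    rewrite (circulation_split A B x (x + w') (x + w n) y (y + h') (y + h n)) by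
      (try lra; apply closed_form_sub with (1 := F); lra).
    replace (x + w n) with (x + w' + w') by lra. replace (y + h n) with (y + h' + h') by lra. ring. }
  assert (Q : eta / 4 ^ n = 4 * (eta / 4 ^ S n)).
  { simpl. field. apply pow_nonzero. lra. }
  unfold Inv, Sub. fold w' h'.
  destruct (Rle_dec (eta / 4 ^ S n) (Rabs (circ (S n) (x, y)))) as [G|G1].
  { exists (x, y). simpl fst; simpl snd. repeat split; auto; lra. }
  destruct (Rle_dec (eta / 4 ^ S n) (Rabs (circ (S n) (x + w', y)))) as [G|G2].
  { exists (x + w', y). simpl fst; simpl snd. repeat split; auto; lra. }
  destruct (Rle_dec (eta / 4 ^ S n) (Rabs (circ (S n) (x, y + h')))) as [G|G3].
  { exists (x, y + h'). simpl fst; simpl snd. repeat split; auto; lra. }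
  exists (x + w', y + h'). simpl fst; simpl snd. repeat split; try lra.
  rewrite E in I5.
  pose proof (Rabs_triang (circ (S n) (x, y) + circ (S n) (x + w', y) + circ (S n) (x, y + h'))
    (circ (S n) (x + w', y + h'))).
  pose proof (Rabs_triang (circ (S n) (x, y) + circ (S n) (x + w', y)) (circ (S n) (x, y + h'))).
  pose proof (Rabs_triang (circ (S n) (x, y)) (circ (S n) (x + w', y))). lra. }
(* Hilbert's epsilon selects at each stage one of the quarters provided by [Step]. *)
set (p := nat_rect (fun _ => (R * R)%type) (a, c)
  (fun n q => epsilon (inhabits (0, 0)) (fun q' => Inv (S n) q' /\ Sub n q q'))).
assert (HI : forall n, Inv n (p n)).
{ induction n as [|n IH].
  - unfold Inv, circ, w, h. simpl. rewrite !Rdiv_1_r.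
    replace (a + (b - a)) with b by ring. replace (c + (d - c)) with d by ring.
    repeat split; try lra. unfold eta. lra.
  - simpl. apply (epsilon_spec (inhabits (0, 0)) (fun q' => Inv (S n) q' /\ Sub n (p n) q')).
    now apply Step. }
assert (HS : forall n, Sub n (p n) (p (S n))).
{ intros n. simpl. apply (epsilon_spec (inhabits (0, 0)) (fun q' => Inv (S n) q' /\ Sub n (p n) q')).
  now apply Step. }
destruct (nested_halving (fun n => fst (p n)) (b - a) ltac:(lra)) as [x Hx].
{ intros n. destruct (HS n) as (S1 & S2 & _). now split. }
destruct (nested_halving (fun n => snd (p n)) (d - c) ltac:(lra)) as [y Hy].
{ intros n. destruct (HS n) as (_ & _ & S1 & S2). now split. }
destruct (F x y) as (lx & m & ly & FA & FB).
{ specialize (Hx O). simpl in Hx. rewrite Rdiv_1_r in Hx. lra. }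
{ specialize (Hy O). simpl in Hy. rewrite Rdiv_1_r in Hy. lra. }
set (s := (b - a) + (d - c)).
(* This tolerance makes [2 eps s^2 < eta] strictly, even when [s = 0]. *)
assert (He : 0 < eta / (2 * s ^ 2 + 1)) by (apply Rdiv_lt_0_compat; nra).
destruct (circulation_small A B x y lx m ly FA FB (mkposreal _ He)) as [delta HD]. simpl in HD.
assert (L : is_lim_seq (fun n => s * (/ 2) ^ n) 0).
{ replace (Finite 0) with (Rbar_mult (Finite s) (Finite 0)) by (simpl; f_equal; ring).
  apply is_lim_seq_scal_l, is_lim_seq_geom. rewrite Rabs_pos_eq; lra. }
apply is_lim_seq_spec in L. destruct (L delta) as [n Hn]. specialize (Hn n (Nat.le_refl n)).
rewrite Rminus_0_r in Hn. apply Rabs_lt_between in Hn.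
destruct (HI n) as (I1 & I2 & I3 & I4 & I5).
assert (WH : w n + h n = s * (/ 2) ^ n).
{ unfold w, h, s. rewrite pow_inv. unfold Rdiv. ring. }
specialize (HD (fst (p n)) (fst (p n) + w n) (snd (p n)) (snd (p n) + h n)).
assert (B1 : eta / 4 ^ n <= 2 * (eta / (2 * s ^ 2 + 1)) * (s ^ 2 / 4 ^ n)).
{ eapply Rle_trans; [apply I5|]. eapply Rle_trans; [apply HD|].
  - apply closed_form_sub with (1 := F); auto.
  - apply Hx.
  - apply Hy.
  - replace (_ + _) with (w n + h n) by ring. lra.
  - right. f_equal.
    transitivity ((w n + h n) ^ 2); [simpl; ring|]. rewrite WH.
    rewrite Rpow_mult_distr, <- pow_mult, Nat.mul_comm, pow_mult.
    replace ((/ 2) ^ 2) with (/ 4) by field. rewrite pow_inv. reflexivity. }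
assert (0 < 4 ^ n) by (apply pow_lt; lra).
assert (B2 : eta <= 2 * (eta / (2 * s ^ 2 + 1)) * s ^ 2).
{ apply Rmult_le_reg_r with (/ 4 ^ n); [now apply Rinv_0_lt_compat|]. unfold Rdiv in *. lra. }
assert (B3 : 2 * (eta / (2 * s ^ 2 + 1)) * s ^ 2 = eta - eta / (2 * s ^ 2 + 1)) by (field; nra).
lra.
Qed.

(** * Holomorphic functions and the peaking kernel *)

(** The derivative is taken in [AbsRing_NormedModule C_AbsRing], the structure of the product and
    chain rules; [holo_of_ex_derive] transports differentiability from [C_NormedModule]. *)
Definition holo (f : C -> C) (z : C) : Prop :=
  ex_derive (K := C_AbsRing) (V := AbsRing_NormedModule C_AbsRing) f z.

Lemma is_derive_C_intro (f : C -> C) (z l : C) :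
  (forall eps : posreal, exists delta : posreal, forall y, Cmod (y - z) < delta ->
     Cmod (f y - f z - (y - z) * l) <= eps * Cmod (y - z)) ->
  is_derive (K := C_AbsRing) (V := AbsRing_NormedModule C_AbsRing) f z l.
Proof.
intros H. split; [apply is_linear_scal_l|].
intros x Hx. apply (is_filter_lim_locally_unique (V := AbsRing_NormedModule C_AbsRing)) in Hx.
subst x. intros eps. destruct (H eps) as [delta Hd]. exists delta. intros y Hy. exact (Hd y Hy).
Qed.

Lemma is_derive_C_elim (f : C -> C) (z l : C) :
  is_derive (K := C_AbsRing) (V := AbsRing_NormedModule C_AbsRing) f z l ->
  forall eps : posreal, exists delta : posreal, forall y, Cmod (y - z) < delta ->
     Cmod (f y - f z - (y - z) * l) <= eps * Cmod (y - z).
Proof.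
intros [_ H] eps. destruct (H z (fun P HP => HP) eps) as [delta Hd].
exists delta. intros y Hy. exact (Hd y Hy).
Qed.

Lemma holo_of_ex_derive (f : C -> C) (z : C) :
  ex_derive (K := C_AbsRing) (V := C_NormedModule) f z -> holo f z.
Proof.
intros [l [_ H]]. exists l. apply is_derive_C_intro. intros eps.
destruct (H z (fun P HP => HP) eps) as [delta Hd].
exists delta. intros y Hy. exact (Hd y Hy).
Qed.

Lemma holo_const (c z : C) : holo (fun _ => c) z.
Proof. apply ex_derive_const. Qed.

Lemma holo_id (z : C) : holo (fun z => z) z.
Proof. apply ex_derive_id. Qed.

Lemma holo_plus (f g : C -> C) (z : C) : holo f z -> holo g z -> holo (fun z => (f z + g z)%C) z.
Proof. apply (ex_derive_plus (K := C_AbsRing) (V := AbsRing_NormedModule C_AbsRing)). Qed.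

Lemma holo_minus (f g : C -> C) (z : C) : holo f z -> holo g z -> holo (fun z => (f z - g z)%C) z.
Proof. apply (ex_derive_minus (K := C_AbsRing) (V := AbsRing_NormedModule C_AbsRing)). Qed.

Lemma holo_mult (f g : C -> C) (z : C) : holo f z -> holo g z -> holo (fun z => (f z * g z)%C) z.
Proof.
intros [l Hl] [m Hm]. eexists. apply (is_derive_mult (K := C_AbsRing)); eauto.
intros; apply Cmult_comm.
Qed.

Lemma holo_comp (f g : C -> C) (z : C) : holo f (g z) -> holo g z -> holo (fun z => f (g z)) z.
Proof.
intros [l Hl] [m Hm]. eexists.
apply (is_derive_comp (K := C_AbsRing) (V := AbsRing_NormedModule C_AbsRing)); eauto.
Qed.

Lemma holo_cexp (z : C) : holo cexp z.
Proof.
exists (cexp z). apply is_derive_C_intro. intros eps.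
assert (He : 0 < Rmin 1 (eps / (8 * exp (Re z)))).
{ apply Rmin_pos; [lra|]. apply Rdiv_lt_0_compat; [apply cond_pos|].
  pose proof (exp_pos (Re z)). lra. }
exists (mkposreal _ He). intros y Hy. simpl in Hy.
pose proof (Rmin_l 1 (eps / (8 * exp (Re z)))). pose proof (Rmin_r 1 (eps / (8 * exp (Re z)))).
replace (cexp y - cexp z - (y - z) * cexp z)%C with (cexp z * (cexp (y - z) - 1 - (y - z)))%C.
2:{ replace (cexp y) with (cexp z * cexp (y - z))%C; [ring|]. rewrite <- cexp_plus. f_equal. ring. }
rewrite Cmod_mult, Cmod_cexp.
pose proof (cexp_taylor2 (y - z) ltac:(lra)) as T.
pose proof (exp_pos (Re z)) as P. pose proof (Cmod_ge_0 (y - z)) as Q.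
apply Rle_trans with (exp (Re z) * (8 * Cmod (y - z) ^ 2)); [apply Rmult_le_compat_l; lra|].
replace (exp (Re z) * _) with ((8 * exp (Re z) * Cmod (y - z)) * Cmod (y - z)) by ring.
apply Rmult_le_compat_r; auto.
apply Rle_trans with (8 * exp (Re z) * (eps / (8 * exp (Re z)))).
- apply Rmult_le_compat_l; lra.
- right. field. lra.
Qed.

Lemma holo_pow (f : C -> C) (z : C) (n : nat) : holo f z -> holo (fun z => (f z ^ n)%C) z.
Proof.
intros H. induction n as [|n IH]; simpl; [apply holo_const|]. now apply holo_mult.
Qed.

Lemma holo_csum (f : nat -> C -> C) (z : C) (n : nat) :
  (forall k, holo (f k) z) -> holo (fun z => csum (fun k => f k z) n) z.
Proof.
intros H. induction n as [|n IH]; cbn [csum]; [apply holo_const|]. now apply holo_plus.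
Qed.

Lemma Cmod_le_2Rmax (x y : R) : Cmod (x, y) <= 2 * Rmax (Rabs x) (Rabs y).
Proof.
eapply Rle_trans; [apply Cmod_le_sum|]. simpl.
pose proof (Rmax_l (Rabs x) (Rabs y)). pose proof (Rmax_r (Rabs x) (Rabs y)). lra.
Qed.

Lemma holo_cauchy_riemann (f : C -> C) (x y : R) : holo f (x, y) -> exists p q,
  differentiable_pt_lim (fun x y => Re (f (x, y))) x y p (- q) /\
  differentiable_pt_lim (fun x y => Im (f (x, y))) x y q p.
Proof.
intros [[p q] H]. exists p, q. pose proof (is_derive_C_elim _ _ _ H) as K.
assert (E : forall eps : posreal, exists delta : posreal, forall u v,
  Rabs (u - x) < delta -> Rabs (v - y) < delta ->
  Cmod (f (u, v) - f (x, y) - (u - x, v - y) * (p, q)) <= eps * Rmax (Rabs (u - x)) (Rabs (v - y))).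
{ intros eps. assert (He : 0 < eps / 2) by (pose proof (cond_pos eps); lra).
  destruct (K (mkposreal _ He)) as [delta Hd]. simpl in Hd.
  assert (Hd2 : 0 < delta / 2) by (pose proof (cond_pos delta); lra).
  exists (mkposreal _ Hd2). intros u v Hu Hv. simpl in Hu, Hv.
  assert (Eq : ((u, v) - (x, y))%C = (u - x, v - y)) by reflexivity.
  specialize (Hd (u, v)). rewrite Eq in Hd.
  pose proof (Cmod_le_2Rmax (u - x) (v - y)) as M.
  pose proof (Cmod_le_sum (u - x, v - y)) as M2. simpl in M2.
  eapply Rle_trans; [apply Hd; lra|]. nra. }
split; intros eps; destruct (E eps) as [delta Hd]; exists delta; intros u v Hu Hv;
specialize (Hd u v Hu Hv); (eapply Rle_trans; [|apply Hd]).
- eapply Rle_trans; [|apply re_le_Cmod]. right. f_equal.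
  destruct (f (u, v)), (f (x, y)); simpl; ring.
- eapply Rle_trans; [|apply im_le_Cmod]. right. f_equal.
  destruct (f (u, v)), (f (x, y)); simpl; ring.
Qed.

Lemma differentiable_pt_lim_opp (f : R -> R -> R) (x y p q : R) :
  differentiable_pt_lim f x y p q -> differentiable_pt_lim (fun x y => - f x y) x y (- p) (- q).
Proof.
intros H eps. destruct (H eps) as [d Hd]. exists d. intros u v Hu Hv.
eapply Rle_trans; [|apply (Hd u v Hu Hv)]. right. rewrite <- Rabs_Ropp. f_equal. ring.
Qed.

(** Cauchy's theorem for [G dz] on the rectangle, whose horizontal sides cancel by periodicity. The
    two conclusions come from the closed forms [Im G dx + Re G dy] and [Re G dx - Im G dy]. *)
Lemma vertical_integral_const (G : C -> C) (a b c d : R) : a <= b -> c <= d ->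
  (forall x y, a <= x <= b -> c <= y <= d -> holo G (x, y)) ->
  (forall x, a <= x <= b -> G (x, c) = G (x, d)) ->
  RInt (fun y => Re (G (a, y))) c d = RInt (fun y => Re (G (b, y))) c d /\
  RInt (fun y => Im (G (a, y))) c d = RInt (fun y => Im (G (b, y))) c d.
Proof.
intros Hab Hcd H P.
assert (E : forall f g : R -> R, (forall x, a <= x <= b -> f x = g x) -> RInt f a b = RInt g a b).
{ intros f g Hfg. apply RInt_ext. intros x Hx. rewrite Rmin_left, Rmax_right in Hx by lra.
  apply Hfg. lra. }
split.
- assert (K := goursat_green (fun x y => Im (G (x, y))) (fun x y => Re (G (x, y))) a b c d Hab Hcd).
  unfold circulation in K.
  rewrite (E (fun x => Im (G (x, c))) (fun x => Im (G (x, d)))) in K by (intros; now rewrite P).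
  enough (RInt (fun y => Re (G (b, y))) c d - RInt (fun y => Re (G (a, y))) c d = 0) by lra.
  rewrite <- K; [ring|]. intros x y Hx Hy.
  destruct (holo_cauchy_riemann G x y (H x y Hx Hy)) as (p & q & H1 & H2).
  exists q, p, (- q). auto.
- assert (K := goursat_green (fun x y => Re (G (x, y))) (fun x y => - Im (G (x, y))) a b c d Hab Hcd).
  unfold circulation in K.
  rewrite (E (fun x => Re (G (x, c))) (fun x => Re (G (x, d)))) in K by (intros; now rewrite P).
  assert (F : closed_form_on (fun x y => Re (G (x, y))) (fun x y => - Im (G (x, y))) a b c d).
  { intros x y Hx Hy.
    destruct (holo_cauchy_riemann G x y (H x y Hx Hy)) as (p & q & H1 & H2).
    exists p, (- q), (- p). split; auto. now apply differentiable_pt_lim_opp. }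
  specialize (K F).
  assert (I : forall x, a <= x <= b -> ex_RInt (fun y => Im (G (x, y))) c d).
  { intros x Hx. apply ex_RInt_cont_le; auto. intros y Hy.
    destruct (holo_cauchy_riemann G x y (H x y Hx Hy)) as (p & q & H1 & H2).
    exact (differentiable_continuous_snd _ _ _ _ _ H2). }
  rewrite (RInt_opp (V := R_CompleteNormedModule) (fun y => Im (G (b, y)))) in K by (apply I; lra).
  rewrite (RInt_opp (V := R_CompleteNormedModule) (fun y => Im (G (a, y)))) in K by (apply I; lra).
  unfold opp in K; simpl in K. lra.
Qed.

(** This is [cos^2 (y/2)]: on [[-PI, PI]] it is largest at 0, so its powers concentrate there, and
    as a trigonometric polynomial it extends to an entire periodic function. *)
Definition peak (y : R) : R := (1 + cos y) / 2.

Lemma peak_bounds (y : R) : 0 <= peak y <= 1.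
Proof. unfold peak. destruct (COS_bound y). lra. Qed.

Lemma peak_decr (x y : R) : Rabs x <= Rabs y -> Rabs y <= PI -> peak y <= peak x.
Proof.
intros H H1. unfold peak.
assert (E : forall z, cos z = cos (Rabs z)).
{ intros z. unfold Rabs. destruct (Rcase_abs z); auto. now rewrite cos_neg. }
rewrite (E x), (E y). pose proof (Rabs_pos x).
assert (cos (Rabs y) <= cos (Rabs x)); [|lra].
apply cos_decr_1; lra.
Qed.

Lemma continuous_peak_pow (n : nat) (y : R) : continuous (fun y => peak y ^ n) y.
Proof.
apply (ex_derive_continuous (fun y => peak y ^ n)). unfold peak. auto_derive. easy.
Qed.

Lemma RInt_lower_const (f : R -> R) (a b m : R) : a <= b -> ex_RInt f a b ->
  (forall x, a <= x <= b -> m <= f x) -> m * (b - a) <= RInt f a b.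
Proof.
intros Hab Hf H. rewrite Rmult_comm.
pose proof (RInt_const (V := R_CompleteNormedModule) a b m) as E.
unfold scal in E; simpl in E; unfold mult in E; simpl in E. rewrite <- E.
apply RInt_le; auto; [apply ex_RInt_const|]. intros; apply H; lra.
Qed.

(** If [phi 0 > eps], the integrand is at least [eta k1^n] on [|y| <= d/2], nonnegative up to [d],
    and at least [- B k2^n] beyond. Since [k2 < k1], the central part wins for large [n], against
    the assumed sign of the integrals. *)
Lemma peak_separation_half (phi : R -> R) (eps : R) : (forall y, continuous phi y) ->
  (forall n, RInt (fun y => (phi y - eps) * peak y ^ n) (- PI) PI <= 0) -> phi 0 <= eps.
Proof.
intros Hc H. apply Rnot_lt_le. intros Hlt.
set (eta := (phi 0 - eps) / 2). assert (He : 0 < eta) by (unfold eta; lra).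
pose proof (Hc 0) as C0. apply filterlim_locally with (eps := mkposreal _ He) in C0.
destruct C0 as [d0 Hd0]. simpl in Hd0.
set (d := Rmin (d0 / 2) 1).
assert (Hd : 0 < d <= 1 /\ d < d0).
{ pose proof (cond_pos d0). unfold d. pose proof (Rmin_l (d0 / 2) 1). pose proof (Rmin_r (d0 / 2) 1).
  split; [split|]; try lra. apply Rmin_pos; lra. }
pose proof PI_RGT_0 as pi0. pose proof PI2_1 as pi1.
set (psi := fun y => phi y - eps).
assert (Near : forall y, Rabs y <= d -> eta <= psi y).
{ intros y Hy. assert (B : Rabs (phi y - phi 0) < eta).
  { apply Hd0. change (Rabs (y - 0) < d0). rewrite Rminus_0_r. lra. }
  apply Rabs_lt_between in B. unfold psi, eta in *. lra. }
assert (Cpsi : forall y, continuous psi y).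
{ intros y. apply (continuous_minus (V := R_NormedModule)); auto. apply continuous_const. }
destruct (continuity_ab_min psi (- PI) PI ltac:(lra)) as [ym [Hm _]].
{ intros y _. apply continuity_pt_filterlim, Cpsi. }
set (B := Rmax 0 (- psi ym)).
assert (HB : 0 <= B /\ forall y, - PI <= y <= PI -> - B <= psi y).
{ split; [apply Rmax_l|]. intros y Hy. specialize (Hm y Hy).
  pose proof (Rmax_r 0 (- psi ym)). fold B in H0. lra. }
destruct HB as [B0 HB].
assert (Cn : forall n y, continuous (fun y => psi y * peak y ^ n) y).
{ intros n y. apply (continuous_mult (K := R_AbsRing)); auto using continuous_peak_pow. }
assert (In : forall n a b, a <= b -> ex_RInt (fun y => psi y * peak y ^ n) a b).
{ intros n a b Hab. apply ex_RInt_cont_le; auto. }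
set (k1 := peak (d / 2)). set (k2 := peak d).
assert (Hk12 : 0 <= k2 /\ k2 < k1).
{ split; [apply peak_bounds|]. unfold k1, k2, peak.
  assert (cos d < cos (d / 2)) by (apply cos_decreasing_1; lra). lra. }
assert (Low : forall n y, - PI <= y <= PI -> - (B * k2 ^ n) <= psi y * peak y ^ n).
{ intros n y Hy. pose proof (peak_bounds y) as Pb.
  assert (P0 : 0 <= peak y ^ n) by (apply pow_le; lra).
  assert (K0 : 0 <= k2 ^ n) by (apply pow_le; lra).
  destruct (Rle_dec (Rabs y) d) as [Y|Y].
  - specialize (Near y Y). apply Rle_trans with 0; [|apply Rmult_le_pos; lra]. nra.
  - assert (peak y ^ n <= k2 ^ n).
    { apply pow_incr. split; [lra|]. apply peak_decr; [rewrite (Rabs_pos_eq d); lra|].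
      apply Rabs_le; lra. }
    specialize (HB y Hy). nra. }
assert (Mid : forall n y, - (d / 2) <= y <= d / 2 -> eta * k1 ^ n <= psi y * peak y ^ n).
{ intros n y Hy. assert (Y : Rabs y <= d / 2) by (apply Rabs_le; lra).
  assert (k1 ^ n <= peak y ^ n).
  { apply pow_incr. split; [lra|]. apply peak_decr; rewrite (Rabs_pos_eq (d / 2)); lra. }
  assert (0 <= k1 ^ n) by (apply pow_le; lra).
  specialize (Near y ltac:(lra)). apply Rmult_le_compat; lra. }
assert (Main : forall n, eta * k1 ^ n * d <= B * k2 ^ n * (2 * PI)).
{ intros n. specialize (H n). fold psi in H.
  change (RInt (fun y => psi y * peak y ^ n) (- PI) PI <= 0) in H.
  rewrite <- (RInt_Chasles (V := R_CompleteNormedModule) _ (- PI) (- (d / 2)) PI) in H by (apply In; lra).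
  rewrite <- (RInt_Chasles (V := R_CompleteNormedModule) _ (- (d / 2)) (d / 2) PI) in H by (apply In; lra).
  unfold plus in H; simpl in H.
  pose proof (RInt_lower_const _ (- PI) (- (d / 2)) (- (B * k2 ^ n)) ltac:(lra)
    (In n (- PI) (- (d / 2)) ltac:(lra)) ltac:(intros; apply Low; lra)).
  pose proof (RInt_lower_const _ (d / 2) PI (- (B * k2 ^ n)) ltac:(lra)
    (In n (d / 2) PI ltac:(lra)) ltac:(intros; apply Low; lra)).
  pose proof (RInt_lower_const _ (- (d / 2)) (d / 2) (eta * k1 ^ n) ltac:(lra)
    (In n (- (d / 2)) (d / 2) ltac:(lra)) (Mid n)).
  assert (0 <= B * k2 ^ n) by (apply Rmult_le_pos; auto; apply pow_le; lra).
  nra. }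
assert (L : is_lim_seq (fun n => B * (2 * PI) * (k2 / k1) ^ n) 0).
{ replace (Finite 0) with (Rbar_mult (Finite (B * (2 * PI))) (Finite 0)) by (simpl; f_equal; ring).
  apply is_lim_seq_scal_l, is_lim_seq_geom. rewrite Rabs_pos_eq.
  - apply Rmult_lt_reg_r with k1; [lra|]. unfold Rdiv. rewrite Rmult_assoc, Rinv_l; lra.
  - apply Rmult_le_pos; [lra|]. left; apply Rinv_0_lt_compat; lra. }
assert (ed : 0 < eta * d) by nra.
apply is_lim_seq_spec in L. destruct (L (mkposreal _ ed)) as [n Hn].
specialize (Hn n (Nat.le_refl n)). simpl in Hn. rewrite Rminus_0_r in Hn.
apply Rabs_lt_between in Hn. specialize (Main n).
assert (K : 0 < k1 ^ n) by (apply pow_lt; lra).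
assert (B * (2 * PI) * (k2 / k1) ^ n * k1 ^ n = B * k2 ^ n * (2 * PI)).
{ unfold Rdiv at 1. rewrite Rpow_mult_distr, pow_inv. field. lra. }
nra.
Qed.

Lemma peak_separation (phi : R -> R) (eps : R) : (forall y, continuous phi y) ->
  (forall n, Rabs (RInt (fun y => phi y * peak y ^ n) (- PI) PI) <=
     eps * RInt (fun y => peak y ^ n) (- PI) PI) -> Rabs (phi 0) <= eps.
Proof.
intros Hc H. pose proof PI_RGT_0.
assert (I1 : forall n, ex_RInt (fun y => peak y ^ n) (- PI) PI).
{ intros n. apply ex_RInt_cont_le; [lra|]. auto using continuous_peak_pow. }
assert (I2 : forall n, ex_RInt (fun y => phi y * peak y ^ n) (- PI) PI).
{ intros n. apply ex_RInt_cont_le; [lra|]. intros.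
  apply (continuous_mult (K := R_AbsRing)); auto using continuous_peak_pow. }
assert (E : forall s n, RInt (fun y => (s * phi y - eps) * peak y ^ n) (- PI) PI =
  s * RInt (fun y => phi y * peak y ^ n) (- PI) PI - eps * RInt (fun y => peak y ^ n) (- PI) PI).
{ intros s n. apply is_RInt_unique.
  apply (is_RInt_ext (fun y => s * (phi y * peak y ^ n) - eps * peak y ^ n)).
  - intros y _. match goal with |- ?a = ?b => change (@eq R a b) end. ring.
  - apply (is_RInt_minus (V := R_NormedModule)); apply (is_RInt_scal (V := R_NormedModule));
    now apply (RInt_correct (V := R_CompleteNormedModule)). }
apply Rabs_le. split.
- enough (-1 * phi 0 <= eps) by lra.
  apply (peak_separation_half (fun y => -1 * phi y)).
  + intros y. apply (continuous_scal_r (V := R_NormedModule) (-1) phi). auto.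
  + intros n. rewrite E. specialize (H n). apply Rabs_le_between in H. lra.
- rewrite <- (Rmult_1_l (phi 0)).
  apply (peak_separation_half (fun y => 1 * phi y)).
  + intros y. apply (continuous_scal_r (V := R_NormedModule) 1 phi). auto.
  + intros n. rewrite E. specialize (H n). apply Rabs_le_between in H. lra.
Qed.

(** * Unique continuation *)

(** The [n]-th power of [cosh^2 ((w - u)/2)]: entire, with period [2 PI i], and equal to
    [peak y ^ n] at [w = u + iy]. *)
Definition peak_kernel (u : R) (n : nat) (w : C) : C :=
  ((RtoC (/ 4) * (2 + cexp (w - u) + cexp (u - w))) ^ n)%C.

Lemma holo_peak_kernel (u : R) (n : nat) (w : C) : holo (peak_kernel u n) w.
Proof.
apply holo_pow. apply holo_mult; [apply holo_const|].
apply holo_plus; [apply holo_plus; [apply holo_const|]|];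
apply (holo_comp cexp); auto using holo_cexp, holo_minus, holo_id, holo_const.
Qed.

Lemma peak_kernel_line (u y : R) (n : nat) : peak_kernel u n (u, y) = RtoC (peak y ^ n).
Proof.
unfold peak_kernel. rewrite RtoC_pow. f_equal. unfold cexp, peak.
apply injective_projections; simpl;
replace (u + - u) with 0 by ring; replace (y + - 0) with y by ring;
replace (0 + - y) with (- y) by ring; rewrite exp_0, cos_neg, sin_neg; field.
Qed.

Lemma cexp_periodic (x : R) : cexp (x, - PI) = cexp (x, PI).
Proof. unfold cexp; simpl. rewrite cos_neg, sin_neg, sin_PI. f_equal. ring. Qed.

Lemma peak_kernel_periodic (u x : R) (n : nat) : peak_kernel u n (x, - PI) = peak_kernel u n (x, PI).
Proof.
unfold peak_kernel. f_equal. f_equal. f_equal; [f_equal|].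
- replace ((x, (- PI)%R) - RtoC u)%C with ((x - u, - PI) : C) by (apply injective_projections; simpl; ring).
  replace ((x, PI) - RtoC u)%C with ((x - u, PI) : C) by (apply injective_projections; simpl; ring).
  apply cexp_periodic.
- replace (RtoC u - (x, (- PI)%R))%C with ((u - x, PI) : C) by (apply injective_projections; simpl; ring).
  replace (RtoC u - (x, PI))%C with ((u - x, - PI) : C) by (apply injective_projections; simpl; ring).
  symmetry. apply cexp_periodic.
Qed.

Lemma Cmod_peak_kernel_le (u x y : R) (n : nat) :
  Cmod (peak_kernel u n (x, y)) <= (/ 4 * (2 + exp (x - u) + exp (u - x))) ^ n.
Proof.
unfold peak_kernel. rewrite Cmod_pow. apply pow_incr. split; [apply Cmod_ge_0|].
rewrite Cmod_mult, Cmod_R, Rabs_pos_eq by lra. apply Rmult_le_compat_l; [lra|].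
eapply Rle_trans; [apply Cmod_triangle|].
pose proof (Cmod_triangle 2 (cexp ((x, y) - u))) as T.
rewrite Cmod_R, Rabs_pos_eq in T by lra. rewrite !Cmod_cexp in *. simpl in *.
unfold Rminus. lra.
Qed.

Lemma RInt_Rabs_le (f g : R -> R) (a b : R) : a <= b -> ex_RInt f a b -> ex_RInt g a b ->
  (forall x, a <= x <= b -> Rabs (f x) <= g x) -> Rabs (RInt f a b) <= RInt g a b.
Proof.
intros Hab Hf Hg H.
pose proof (norm_RInt_le (V := R_NormedModule) f g a b _ _ Hab H
  (RInt_correct (V := R_CompleteNormedModule) f a b Hf)
  (RInt_correct (V := R_CompleteNormedModule) g a b Hg)) as N.
exact N.
Qed.

Lemma holo_continuous_vertical (f : C -> C) (x : R) (y : R) : holo f (x, y) ->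
  continuous (fun y => Re (f (x, y))) y /\ continuous (fun y => Im (f (x, y))) y.
Proof.
intros H. destruct (holo_cauchy_riemann f x y H) as (p & q & H1 & H2).
split; [exact (differentiable_continuous_snd _ _ _ _ _ H1)|exact (differentiable_continuous_snd _ _ _ _ _ H2)].
Qed.

Lemma Re_mult_real (z : C) (k : R) : Re (z * RtoC k) = Re z * k.
Proof. destruct z; simpl; ring. Qed.

Lemma Im_mult_real (z : C) (k : R) : Im (z * RtoC k) = Im z * k.
Proof. destruct z; simpl; ring. Qed.

(** The map [w -> p - exp w] turns vertical segments of length [2 PI] into circles around [p].
    Moving the integral from radius [r] to radius [rho] replaces the size of [F] by [eps] and the
    kernel by its maximum there. The factor [K] depends on [n] but not on [F]. *)
Lemma circle_moment_le (F : C -> C) (p : C) (r rho eps : R) (n : nat) :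
  0 < rho -> rho <= r -> 0 <= eps ->
  (forall z, Cmod (z - p) <= r -> holo F z) ->
  (forall z, Cmod (z - p) <= rho -> Cmod (F z) <= eps) ->
  let K := (/ 4 * (2 + exp (ln rho - ln r) + exp (ln r - ln rho))) ^ n * (2 * PI) in
  Rabs (RInt (fun y => Re (F (p - cexp (ln r, y))%C) * peak y ^ n) (- PI) PI) <= eps * K /\
  Rabs (RInt (fun y => Im (F (p - cexp (ln r, y))%C) * peak y ^ n) (- PI) PI) <= eps * K.
Proof.
intros Hrho Hr He HF HFs K. pose proof PI_RGT_0 as pi0.
set (u1 := ln r) in *. set (u0 := ln rho) in *.
assert (Hu : u0 <= u1) by (apply ln_le; auto).
set (G := fun w : C => (F (p - cexp w) * peak_kernel u1 n w)%C).
assert (Hdisc : forall x y, x <= u1 -> Cmod (p - cexp (x, y) - p) <= r).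
{ intros x y Hx. replace (p - cexp (x, y) - p)%C with (- cexp (x, y))%C by ring.
  rewrite Cmod_opp, Cmod_cexp. simpl. rewrite <- (exp_ln r) by lra. now apply exp_mono. }
assert (HG : forall x y, x <= u1 -> holo G (x, y)).
{ intros x y Hx. apply holo_mult; [|apply holo_peak_kernel].
  apply (holo_comp F (fun w => (p - cexp w)%C)).
  - apply HF. now apply Hdisc.
  - apply holo_minus; [apply holo_const|apply holo_cexp]. }
destruct (vertical_integral_const G u0 u1 (- PI) PI Hu ltac:(lra)) as [ER EI].
{ intros x y Hx _. apply HG. lra. }
{ intros x _. unfold G. now rewrite cexp_periodic, peak_kernel_periodic. }
assert (B : forall y, Cmod (G (u0, y)) <= eps * (/ 4 * (2 + exp (u0 - u1) + exp (u1 - u0))) ^ n).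
{ intros y. unfold G. rewrite Cmod_mult. apply Rmult_le_compat; auto using Cmod_ge_0, Cmod_peak_kernel_le.
  apply HFs. replace (p - cexp (u0, y) - p)%C with (- cexp (u0, y))%C by ring.
  rewrite Cmod_opp, Cmod_cexp. simpl. unfold u0. rewrite exp_ln; lra. }
assert (KE : eps * K = RInt (fun _ => eps * (/ 4 * (2 + exp (u0 - u1) + exp (u1 - u0))) ^ n) (- PI) PI).
{ rewrite (RInt_const (V := R_CompleteNormedModule)). unfold scal; simpl; unfold mult; simpl.
  unfold K. ring. }
rewrite KE. split.
- replace (RInt (fun y => Re (F (p - cexp (u1, y))%C) * peak y ^ n) (- PI) PI)
   with (RInt (fun y => Re (G (u0, y))) (- PI) PI).
  + apply RInt_Rabs_le; [lra| |apply ex_RInt_const|].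
    * apply ex_RInt_cont_le; [lra|]. intros y _. exact (proj1 (holo_continuous_vertical G u0 y (HG u0 y Hu))).
    * intros y _. eapply Rle_trans; [apply re_le_Cmod|apply B].
  + rewrite ER. apply RInt_ext. intros y _. unfold G. now rewrite peak_kernel_line, Re_mult_real.
- replace (RInt (fun y => Im (F (p - cexp (u1, y))%C) * peak y ^ n) (- PI) PI)
   with (RInt (fun y => Im (G (u0, y))) (- PI) PI).
  + apply RInt_Rabs_le; [lra| |apply ex_RInt_const|].
    * apply ex_RInt_cont_le; [lra|]. intros y _. exact (proj2 (holo_continuous_vertical G u0 y (HG u0 y Hu))).
    * intros y _. eapply Rle_trans; [apply im_le_Cmod|apply B].
  + rewrite EI. apply RInt_ext. intros y _. unfold G. now rewrite peak_kernel_line, Im_mult_real.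
Qed.

(* In the coordinate [w = log (p - z)] the circular integral of [F * peak_kernel] does not
   depend on the radius; it is small on small circles, and on the circle of radius [r] the
   kernel concentrates at [p - r]. *)
Lemma holo_limit_zero (D : nat -> C -> C) (p : C) (r rho : R) :
  0 < rho -> rho <= r ->
  (forall M z, Cmod (z - p) <= r -> holo (D M) z) ->
  (forall eps, 0 < eps -> exists M0, forall M z, (M0 <= M)%nat -> Cmod (z - p) <= r ->
     Cmod (D M z - D M0 z) <= eps) ->
  (forall z, Cmod (z - p) <= rho -> forall eps, 0 < eps ->
     exists M0, forall M, (M0 <= M)%nat -> Cmod (D M z) <= eps) ->
  forall eps, 0 < eps -> exists M0, forall M, (M0 <= M)%nat -> Cmod (D M (p - RtoC r)%C) <= eps.
Proof.
intros Hrho Hr Hh Hc Hs. pose proof PI_RGT_0 as pi0.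
(* Pointwise convergence to 0 on the small disc becomes uniform through the uniform Cauchy
   property. *)
assert (Hu : forall eps, 0 < eps -> exists M1, forall M z, (M1 <= M)%nat -> Cmod (z - p) <= rho ->
  Cmod (D M z) <= eps).
{ intros eps He. destruct (Hc (eps / 3) ltac:(lra)) as [M1 H1]. exists M1. intros M z HM Hz.
  destruct (Hs z Hz (eps / 3) ltac:(lra)) as [M2 H2].
  pose proof (H1 M z HM ltac:(lra)) as A1.
  pose proof (H1 (Nat.max M1 M2) z ltac:(lia) ltac:(lra)) as A2.
  pose proof (H2 (Nat.max M1 M2) ltac:(lia)) as A3.
  replace (D M z) with ((D M z - D M1 z) - (D (Nat.max M1 M2) z - D M1 z) + D (Nat.max M1 M2) z)%C by ring.
  eapply Rle_trans; [apply Cmod_triangle|].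
  pose proof (Cmod_triangle_minus (D M z - D M1 z) (D (Nat.max M1 M2) z - D M1 z)). lra. }
intros eps He. destruct (Hc (eps / 3) ltac:(lra)) as [M0 H0]. exists M0.
assert (Hcirc : forall y, Cmod (p - cexp (ln r, y) - p) <= r).
{ intros y. replace (p - cexp (ln r, y) - p)%C with (- cexp (ln r, y))%C by ring.
  rewrite Cmod_opp, Cmod_cexp. simpl. rewrite exp_ln; lra. }
assert (Hol : forall M y, holo (fun w => D M (p - cexp w)%C) (ln r, y)).
{ intros M y. apply (holo_comp (D M) (fun w => (p - cexp w)%C)).
  - apply Hh. apply Hcirc.
  - apply holo_minus; [apply holo_const|apply holo_cexp]. }
assert (E0 : (p - cexp (ln r, 0%R) = p - RtoC r)%C).
{ f_equal. f_equal. unfold cexp; simpl. rewrite cos_0, sin_0, exp_ln by lra.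
  apply injective_projections; simpl; ring. }
assert (Iphi : forall (phi : R -> R) n, (forall y, continuous phi y) ->
   ex_RInt (fun y => phi y * peak y ^ n) (- PI) PI).
{ intros phi n H. apply ex_RInt_cont_le; [lra|]. intros.
  apply (continuous_mult (K := R_AbsRing)); auto using continuous_peak_pow. }
assert (Ipk : forall n, ex_RInt (fun y => peak y ^ n) (- PI) PI).
{ intros n. apply ex_RInt_cont_le; [lra|]. auto using continuous_peak_pow. }
assert (Key : forall proj : C -> R,
  (forall M y, continuous (fun y => proj (D M (p - cexp (ln r, y))%C)) y) ->
  (forall a b : C, Rabs (proj a - proj b) <= Cmod (a - b)) ->
  (forall M n e, 0 <= e -> (forall z, Cmod (z - p) <= rho -> Cmod (D M z) <= e) ->
    Rabs (RInt (fun y => proj (D M (p - cexp (ln r, y))%C) * peak y ^ n) (- PI) PI) <=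
    e * ((/ 4 * (2 + exp (ln rho - ln r) + exp (ln r - ln rho))) ^ n * (2 * PI))) ->
  Rabs (proj (D M0 (p - RtoC r)%C)) <= eps / 3).
{ intros proj Pc Pl Pm. rewrite <- E0.
  apply (peak_separation (fun y => proj (D M0 (p - cexp (ln r, y))%C))); [apply Pc|].
  intros n. apply le_epsilon. intros e1 He1.
  set (K := (/ 4 * (2 + exp (ln rho - ln r) + exp (ln r - ln rho))) ^ n * (2 * PI)) in *.
  assert (HK : 0 < K).
  { apply Rmult_lt_0_compat; [|lra]. apply pow_lt.
    pose proof (exp_pos (ln rho - ln r)). pose proof (exp_pos (ln r - ln rho)). lra. }
  (* [K] may grow exponentially with [n], but [n] is fixed at this point: [M] is chosen afterwards,
     with [D M] below [e1 / K] on the small disc. Passing from [D M0] to [D M] costs only [eps / 3]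
     on the large circle. *)
  destruct (Hu (e1 / K)) as [M1 H1]; [now apply Rdiv_lt_0_compat|].
  set (M := Nat.max M0 M1).
  pose proof (Pm M n (e1 / K) ltac:(left; now apply Rdiv_lt_0_compat)
    (fun z Hz => H1 M z ltac:(lia) Hz)) as A. fold K in A.
  replace (e1 / K * K) with e1 in A by (field; lra).
  assert (Bd : Rabs (RInt (fun y => (proj (D M0 (p - cexp (ln r, y))%C) - proj (D M (p - cexp (ln r, y))%C)) * peak y ^ n)
    (- PI) PI) <= eps / 3 * RInt (fun y => peak y ^ n) (- PI) PI).
  { assert (Sc : eps / 3 * RInt (fun y => peak y ^ n) (- PI) PI = RInt (fun y => eps / 3 * peak y ^ n) (- PI) PI).
    { symmetry. apply is_RInt_unique. apply (is_RInt_scal (V := R_NormedModule)).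
      now apply (RInt_correct (V := R_CompleteNormedModule)). }
    rewrite Sc. apply RInt_Rabs_le; [lra| | |].
    - apply (Iphi (fun y => proj (D M0 (p - cexp (ln r, y))%C) - proj (D M (p - cexp (ln r, y))%C))).
      intros y. apply (continuous_minus (V := R_NormedModule)); apply Pc.
    - apply (ex_RInt_scal (V := R_NormedModule)). auto.
    - intros y _. pose proof (peak_bounds y).
      assert (0 <= peak y ^ n) by (apply pow_le; lra).
      rewrite Rabs_mult, (Rabs_pos_eq (peak y ^ n)) by auto.
      apply Rmult_le_compat_r; auto. eapply Rle_trans; [apply Pl|].
      rewrite Cmod_minus_sym. apply H0; [lia|apply Hcirc]. }
  assert (Eq : RInt (fun y => proj (D M0 (p - cexp (ln r, y))%C) * peak y ^ n) (- PI) PI =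
    RInt (fun y => (proj (D M0 (p - cexp (ln r, y))%C) - proj (D M (p - cexp (ln r, y))%C)) * peak y ^ n) (- PI) PI
    + RInt (fun y => proj (D M (p - cexp (ln r, y))%C) * peak y ^ n) (- PI) PI).
  { apply is_RInt_unique.
    apply (is_RInt_ext (fun y => (proj (D M0 (p - cexp (ln r, y))%C) - proj (D M (p - cexp (ln r, y))%C)) * peak y ^ n
      + proj (D M (p - cexp (ln r, y))%C) * peak y ^ n)).
    - intros y _. match goal with |- ?a = ?b => change (@eq R a b) end. ring.
    - apply (is_RInt_plus (V := R_NormedModule)); apply (RInt_correct (V := R_CompleteNormedModule)).
      + apply (Iphi (fun y => proj (D M0 (p - cexp (ln r, y))%C) - proj (D M (p - cexp (ln r, y))%C))).
        intros y. apply (continuous_minus (V := R_NormedModule)); apply Pc.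
      + apply (Iphi (fun y => proj (D M (p - cexp (ln r, y))%C))). apply Pc. }
  rewrite Eq. eapply Rle_trans; [apply Rabs_triang|]. lra. }
assert (KR : Rabs (Re (D M0 (p - RtoC r)%C)) <= eps / 3).
{ apply (Key Re).
  - intros M y. exact (proj1 (holo_continuous_vertical (fun w => D M (p - cexp w)%C) _ _ (Hol M y))).
  - intros a b. apply (re_le_Cmod (a - b)).
  - intros M n e He' Hz. now apply (circle_moment_le (D M) p r rho e n Hrho Hr He' (Hh M) Hz). }
assert (KI : Rabs (Im (D M0 (p - RtoC r)%C)) <= eps / 3).
{ apply (Key Im).
  - intros M y. exact (proj2 (holo_continuous_vertical (fun w => D M (p - cexp w)%C) _ _ (Hol M y))).
  - intros a b. apply (im_le_Cmod (a - b)).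
  - intros M n e He' Hz. now apply (circle_moment_le (D M) p r rho e n Hrho Hr He' (Hh M) Hz). }
intros M HM.
assert (Hin : Cmod (p - RtoC r - p) <= r).
{ replace (p - RtoC r - p)%C with (- RtoC r)%C by ring. rewrite Cmod_opp, Cmod_R, Rabs_pos_eq; lra. }
pose proof (H0 M (p - RtoC r)%C HM Hin).
replace (D M (p - RtoC r)%C) with ((D M (p - RtoC r) - D M0 (p - RtoC r)) + D M0 (p - RtoC r))%C by ring.
eapply Rle_trans; [apply Cmod_triangle|].
pose proof (Cmod_le_sum (D M0 (p - RtoC r)%C)). lra.
Qed.

(** * Rearrangement of the double series *)

Lemma csum_0 (n : nat) : csum (fun _ => RtoC 0) n = RtoC 0.
Proof. induction n as [|n IH]; cbn [csum]; [|rewrite IH]; ring. Qed.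

Lemma csum_swap (F : nat -> nat -> C) (n m : nat) :
  csum (fun i => csum (fun j => F i j) m) n = csum (fun j => csum (fun i => F i j) n) m.
Proof.
induction n as [|n IH]; cbn [csum]; [now rewrite csum_0|].
rewrite IH, csum_plus. reflexivity.
Qed.

Lemma csum_triangle (F : nat -> nat -> C) (M : nat) :
  csum (fun n => csum (fun m => F m n) (M - n)) M =
  csum (fun k => csum (fun n => F (k - n)%nat n) (S k)) M.
Proof.
induction M as [|M IH]; [reflexivity|].
change (csum (fun k => csum (fun n => F (k - n)%nat n) (S k)) (S M)) with
 (csum (fun k => csum (fun n => F (k - n)%nat n) (S k)) M + csum (fun n => F (M - n)%nat n) (S M))%C.
rewrite <- IH.
rewrite (csum_ext _ (fun n => csum (fun m => F m n) (M - n) + F (M - n)%nat n)%C).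
- rewrite csum_plus. cbn [csum]. rewrite Nat.sub_diag. cbn [csum]. ring.
- intros k Hk. replace (S M - k)%nat with (S (M - k)) by lia. reflexivity.
Qed.

Lemma csum_truncate (f : nat -> C) (N M : nat) : (N <= M)%nat ->
  (forall k, (N <= k < M)%nat -> f k = 0) -> csum f M = csum f N.
Proof.
intros H. induction H as [|M H IH]; intros Hf; auto. cbn [csum].
rewrite IH by (intros; apply Hf; lia). rewrite Hf by lia. ring.
Qed.

(** Extension by zero off [1 <= n < m], so that sums can be interchanged over full squares and
    triangles. *)
Definition AV_term (s1 s2 z : C) (m n : nat) : C :=
  if andb (1 <=? n)%nat (n <? m)%nat
  then (npow_neg m s1 * npow_neg n s2 * npow_neg (m + n) z)%C else 0.

Lemma AV_term_in (s1 s2 z : C) (m n : nat) : (1 <= n < m)%nat ->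
  AV_term s1 s2 z m n = (npow_neg m s1 * npow_neg n s2 * npow_neg (m + n) z)%C.
Proof.
intros H. unfold AV_term. destruct (Nat.leb_spec 1 n); [|lia].
destruct (Nat.ltb_spec n m); [|lia]. reflexivity.
Qed.

Lemma AV_term_out (s1 s2 z : C) (m n : nat) : ~ (1 <= n < m)%nat -> AV_term s1 s2 z m n = 0.
Proof.
intros H. unfold AV_term. destruct (Nat.leb_spec 1 n); [|reflexivity].
destruct (Nat.ltb_spec n m); [lia|]. reflexivity.
Qed.

Lemma sum_n_m_csum (f : nat -> C) (m : nat) :
  sum_n_m (G := C_AbelianMonoid) f 1 m = csum (fun j => f (S j)) m.
Proof.
induction m as [|m IH].
- rewrite sum_n_m_zero by lia. reflexivity.
- rewrite sum_n_Sm by lia. rewrite IH. reflexivity.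
Qed.

Lemma AV_inner_csum (s1 s2 z : C) (m M : nat) : (m <= M)%nat ->
  AV_inner s1 s2 z m = csum (AV_term s1 s2 z m) M.
Proof.
intros H. unfold AV_inner. rewrite sum_n_m_csum.
rewrite (csum_truncate _ m M H) by (intros; apply AV_term_out; lia).
destruct m as [|m]; [reflexivity|]. rewrite csum_S_l, AV_term_out by lia.
replace (S m - 1)%nat with m by lia. rewrite Cplus_0_l. apply csum_ext. intros j Hj.
now rewrite AV_term_in by lia.
Qed.

Lemma AV2_inner_antidiagonal (s1 s2 z : C) (k : nat) :
  (AV2_inner s1 s2 k * npow_neg k z)%C = csum (fun n => AV_term s1 s2 z (k - n) n) (S k).
Proof.
rewrite AV2_inner_csum, csum_S_l, AV_term_out by lia. rewrite Cplus_0_l.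
pose proof (Nat.div_mod_eq (k - 1) 2) as Q1.
pose proof (Nat.mod_upper_bound (k - 1) 2 ltac:(lia)) as Q2.
rewrite (csum_truncate _ ((k - 1) / 2) k) by (try lia; intros; apply AV_term_out; lia).
rewrite Cmult_comm, <- csum_scal. apply csum_ext. intros j Hj.
rewrite AV_term_in by lia. replace (k - S j + S j)%nat with k by lia. ring.
Qed.

(* Only the terms with [m < M <= m + n] distinguish the two orders of summation. *)
Lemma AV_rearrangement (s1 s2 z : C) (M : nat) : 0 <= Re s1 -> 1 < Re s2 -> 0 <= Re z ->
  3 / 2 <= Re s1 + Re z -> (2 <= M)%nat ->
  Cmod (csum (AV_inner s1 s2 z) M - csum (fun k => AV2_inner s1 s2 k * npow_neg k z)%C M)
   <= 4 * Rpower (INR M) (- (1 / 2)).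
Proof.
intros H1 H2 Hz Hw HM.
set (F := AV_term s1 s2 z).
rewrite (csum_ext (AV_inner s1 s2 z) (fun m => csum (fun n => F m n) M))
  by (intros; apply AV_inner_csum; lia).
rewrite csum_swap.
rewrite (csum_ext (fun k => AV2_inner s1 s2 k * npow_neg k z)%C
   (fun k => csum (fun n => F (k - n)%nat n) (S k))) by (intros; apply AV2_inner_antidiagonal).
rewrite <- csum_triangle.
assert (M2 : 2 <= INR M) by (apply le_INR in HM; simpl in HM; lra).
set (P := Rpower (INR M / 2) (- (3 / 2))).
assert (P0 : 0 < P) by apply Rpower_pos.
replace (csum (fun n => csum (fun m => F m n) M) M - csum (fun n => csum (fun m => F m n) (M - n)) M)%C
 with (csum (fun n => csum (fun m => F m n) M + (- (1)) * csum (fun m => F m n) (M - n)) M)%C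
 by (rewrite csum_plus, csum_scal; ring).
(* For fixed [n], only the [n] values [M - n <= m < M] remain. Those with [n < m] satisfy
   [m >= M/2], and each term is at most [P / n] because [Re s2 > 1]. So each [n] contributes at most
   [P], and [M P = 2^(3/2) M^(-1/2)]. *)
apply Rle_trans with (rsum (fun _ => P) M).
- apply Cmod_csum_le. intros n Hn.
  replace (csum (fun m => F m n) M + (- (1)) * csum (fun m => F m n) (M - n))%C with
    (csum (fun m => F m n) M - csum (fun m => F m n) (M - n))%C by ring.
  destruct n as [|n'].
  { rewrite Nat.sub_0_r. replace (csum (fun m => F m O) M - csum (fun m => F m O) M)%C with (RtoC 0) by ring.
    rewrite Cmod_0. lra. }
  set (n := S n') in *.
  assert (N1 : 1 <= INR n) by (apply INR_ge_1; unfold n; lia).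
  apply Rle_trans with (rsum (fun _ => P * / INR n) M - rsum (fun _ => P * / INR n) (M - n)).
  + apply Cmod_csum_seg_le; [lia|]. intros m Hm.
    assert (PI0 : 0 < P * / INR n) by (apply Rmult_lt_0_compat; auto; apply Rinv_0_lt_compat; lra).
    destruct (Nat.lt_ge_cases n m) as [L|L].
    2:{ unfold F. rewrite AV_term_out by lia. rewrite Cmod_0. lra. }
    unfold F. rewrite AV_term_in by (unfold n; lia).
    rewrite !Cmod_mult, !Cmod_npow_neg.
    assert (m1 : INR M / 2 <= INR m).
    { assert (M <= 2 * m)%nat as X by lia. apply le_INR in X. rewrite mult_INR in X. simpl (INR 2) in X. lra. }
    assert (A1 : Rpower (INR n) (- Re s2) <= / INR n).
    { rewrite <- (Rpower_1 (INR n)) at 2 by lra. rewrite <- Rpower_Ropp. apply Rle_Rpower; lra. }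
    assert (A2 : Rpower (INR (m + n)) (- Re z) <= Rpower (INR m) (- Re z)).
    { apply Rpower_antitone; auto; try lra. apply le_INR; lia. }
    assert (A3 : Rpower (INR m) (- Re s1) * Rpower (INR m) (- Re z) <= P).
    { rewrite <- Rpower_plus. apply Rle_trans with (Rpower (INR m) (- (3 / 2))).
      - apply Rle_Rpower; lra.
      - apply Rpower_antitone; lra. }
    pose proof (Rpower_pos (INR m) (- Re s1)) as q1. pose proof (Rpower_pos (INR n) (- Re s2)) as q2.
    pose proof (Rpower_pos (INR m) (- Re z)) as q3. pose proof (Rpower_pos (INR (m + n)) (- Re z)) as q4.
    apply Rle_trans with ((Rpower (INR m) (- Re s1) * Rpower (INR m) (- Re z)) * Rpower (INR n) (- Re s2)).
    * replace (_ * _ * Rpower (INR n) _) with (Rpower (INR m) (- Re s1) * Rpower (INR n) (- Re s2) * Rpower (INR m) (- Re z)) by ring.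
      apply Rmult_le_compat_l; auto. apply Rmult_le_pos; lra.
    * apply Rmult_le_compat; try lra. apply Rmult_le_pos; lra.
  + assert (K : forall c k, rsum (fun _ => c) k = c * INR k).
    { intros c k. induction k as [|k IH]; cbn [rsum]; [simpl; ring|]. rewrite IH, S_INR. ring. }
    rewrite !K, minus_INR by lia. right. field. lra.
- assert (K : forall c k, rsum (fun _ => c) k = c * INR k).
  { intros c k. induction k as [|k IH]; cbn [rsum]; [simpl; ring|]. rewrite IH, S_INR. ring. }
  rewrite K. unfold P. unfold Rdiv at 1. rewrite <- Rpower_mult_distr by lra.
  replace (Rpower (/ 2) (- (3 / 2))) with (Rpower 2 (3 / 2)).
  2:{ unfold Rpower. f_equal. rewrite ln_Rinv by lra. ring. }
  assert (B : Rpower 2 (3 / 2) <= 4).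
  { replace 4 with (Rpower 2 (1 + 1)) by (rewrite Rpower_plus, Rpower_1; lra). apply Rle_Rpower; lra. }
  replace (- (3 / 2)) with (- (1 / 2) + - (1)) by field.
  rewrite Rpower_plus, (Rpower_Ropp (INR M) 1), Rpower_1 by lra.
  pose proof (Rpower_pos (INR M) (- (1 / 2))) as q.
  replace (_ * _ * _ * INR M) with (Rpower 2 (3 / 2) * Rpower (INR M) (- (1 / 2))) by (field; lra). nra.
Qed.

Lemma is_series_csum (f : nat -> C) (L : C) :
  is_series (K := C_AbsRing) (V := C_NormedModule) f L ->
  forall eps, 0 < eps -> exists M0, forall M, (M0 <= M)%nat -> Cmod (csum f M - L) <= eps.
Proof.
intros H eps He.
assert (E : forall n, sum_n (G := C_AbelianMonoid) f n = csum f (S n)).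
{ induction n as [|n IH].
  - rewrite sum_O. simpl. ring.
  - rewrite sum_Sn, IH. reflexivity. }
assert (He2 : 0 < eps / 2) by lra.
apply (fun K => proj1 (filterlim_locally (U := C_NormedModule) (F := eventually) (sum_n f) L) K (mkposreal _ He2)) in H.
destruct H as [N HN]. exists (S N). intros M HM. destruct M as [|M]; [lia|].
specialize (HN M ltac:(lia)). rewrite <- E.
(* Balls of [C_NormedModule] are componentwise; passing to [Cmod] costs [sqrt 2], for which
   [eps / 2] was reserved. *)
apply C_NormedModule_mixin_compat2 in HN. simpl in HN.
assert (S2 : sqrt 2 <= 2).
{ rewrite <- (sqrt_pow2 2) at 2 by lra. apply sqrt_le_1_alt. lra. }
assert (Cmod (sum_n (G := C_AbelianMonoid) f M - L) < sqrt 2 * (eps / 2)) by exact HN.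
nra.
Qed.

Lemma Rpower_neg_eventually_le (K a eps : R) : 0 < a -> 0 < eps ->
  exists M0, forall M, (M0 <= M)%nat -> K * Rpower (INR M) (- a) <= eps.
Proof.
intros Ha He. pose proof (is_lim_seq_Rpower_neg K a Ha) as L. apply is_lim_seq_spec in L.
destruct (L (mkposreal _ He)) as [M0 H]. exists M0. intros M HM. specialize (H M HM). simpl in H.
rewrite Rminus_0_r in H. apply Rabs_lt_between in H. lra.
Qed.

(** * Approximation of the continuation *)

Definition AV_partial (s1 s2 z : C) (M : nat) : C :=
  csum (fun k => AV2_inner s1 s2 k * npow_neg k z)%C M.

Definition AV_remainder (s1 s2 zeta2 : C) (k : nat) : C :=
  (AV2_inner s1 s2 k - zeta2 * npow_neg k s1)%C.

(* The factor [w - 1] (with [w = s1 + z]) clears the pole of the continuation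
   [AV_partial M + zeta2 M^(1-w) / (w - 1)]. *)
Definition AV_defect (s1 s2 zeta2 : C) (Z : C -> C) (M : nat) (z : C) : C :=
  ((s1 + z - 1) * (Z z - AV_partial s1 s2 z M) - zeta2 * npow_neg M (s1 + z - 1))%C.

Lemma AV_partial_split (s1 s2 zeta2 z : C) (N : nat) :
  AV_partial s1 s2 z N = (csum (fun k => AV_remainder s1 s2 zeta2 k * npow_neg k z) N
    + zeta2 * csum (fun k => npow_neg k (s1 + z)) N)%C.
Proof.
rewrite <- csum_scal, <- csum_plus. apply csum_ext. intros k _. unfold AV_remainder.
rewrite npow_neg_plus. ring.
Qed.

Lemma AV_defect_diff (s1 s2 zeta2 z : C) (Z : C -> C) (N M : nat) :
  (AV_defect s1 s2 zeta2 Z M z - AV_defect s1 s2 zeta2 Z N z =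
   - ((s1 + z - 1) * (csum (fun k => AV_remainder s1 s2 zeta2 k * npow_neg k z) M -
                      csum (fun k => AV_remainder s1 s2 zeta2 k * npow_neg k z) N))
   - zeta2 * ((s1 + z - 1) * (csum (fun k => npow_neg k (s1 + z)) M - csum (fun k => npow_neg k (s1 + z)) N)
        - (npow_neg N (s1 + z - 1) - npow_neg M (s1 + z - 1))))%C.
Proof. unfold AV_defect. rewrite !(AV_partial_split s1 s2 zeta2). ring. Qed.

Section Continuation.
Variables (s1 s2 : C) (sigma3 kappa : R) (zeta2 : C) (Cr : R).
Let sigma := Re s1 + sigma3.
(** The decay exponent of the remainder series: [r_k k^(-sigma3) = O(k^(-beta))]. *)
Let beta := sigma + kappa - 1.
Hypothesis Hs1 : 0 <= Re s1.
Hypothesis Hs3 : 0 < sigma3.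
Hypothesis Hsig : 1 / 2 < sigma <= 1.
Hypothesis Hkap : 1 < kappa <= Re s2.
Hypothesis Hbeta : 1 < beta.
Hypothesis HCr : 0 <= Cr.
Hypothesis Hrem : forall k, (1 <= k)%nat ->
  Cmod (AV_remainder s1 s2 zeta2 k) <= Cr * Rpower (INR k) (1 - Re s1 - kappa).

Let C1 := Cr * (Rpower 2 beta / (beta - 1)).

Lemma remainder_term_le (z : C) (k : nat) : sigma3 <= Re z -> (1 <= k)%nat ->
  Cmod (AV_remainder s1 s2 zeta2 k * npow_neg k z) <= Cr * Rpower (INR k) (- beta).
Proof.
intros Hz Hk. apply INR_ge_1 in Hk as K. rewrite Cmod_mult, Cmod_npow_neg.
replace (- beta) with ((1 - Re s1 - kappa) + - sigma3) by (unfold beta, sigma; ring).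
rewrite Rpower_plus, <- Rmult_assoc. apply Rmult_le_compat; auto using Cmod_ge_0.
- left; apply Rpower_pos.
- apply Rle_Rpower; lra.
Qed.

Lemma remainder_sum_le (z : C) (N M : nat) : sigma3 <= Re z -> (1 <= N)%nat -> (N <= M)%nat ->
  Cmod (csum (fun k => AV_remainder s1 s2 zeta2 k * npow_neg k z)%C M
      - csum (fun k => AV_remainder s1 s2 zeta2 k * npow_neg k z)%C N) <= C1 * Rpower (INR N) (1 - beta).
Proof.
intros Hz HN HNM.
eapply Rle_trans.
- apply (Cmod_csum_seg_le _ (fun k => Cr * Rpower (INR k) (- beta))); auto.
  intros k Hk. apply remainder_term_le; auto. lia.
- rewrite !rsum_scal, <- Rmult_minus_distr_l. unfold C1. rewrite Rmult_assoc.
  apply Rmult_le_compat_l; auto. now apply rsum_power_gt1.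
Qed.

Lemma C1_nonneg : 0 <= C1.
Proof.
unfold C1. apply Rmult_le_pos; auto. apply Rmult_le_pos; [left; apply Rpower_pos|].
left. apply Rinv_0_lt_compat. lra.
Qed.

Lemma Re_shift (z : C) : sigma3 <= Re z -> sigma <= Re (s1 + z) /\ / 2 <= Cmod (s1 + z).
Proof.
intros Hz. assert (E : Re (s1 + z) = Re s1 + Re z) by (destruct s1, z; reflexivity).
rewrite E. split; [unfold sigma; lra|].
pose proof (re_le_Cmod (s1 + z)) as B. rewrite E in B. unfold sigma in Hsig.
rewrite Rabs_pos_eq in B; lra.
Qed.

(** The term [zeta2 M^(1-w)] in the defect is exactly the main term of [zeta_segment], so the
    difference stays small also where the Dirichlet series diverges. The bound does not involve [Z]
    and is uniform for [z] in bounded sets. *)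
Lemma AV_defect_cauchy (Z : C -> C) (z : C) (N M : nat) : sigma3 <= Re z -> (1 <= N)%nat ->
  16 * Cmod (s1 + z) <= INR N -> (N <= M)%nat ->
  Cmod (AV_defect s1 s2 zeta2 Z M z - AV_defect s1 s2 zeta2 Z N z) <=
   Cmod (s1 + z - 1) * (C1 * Rpower (INR N) (- (beta - 1)))
   + 60 * Cmod zeta2 * Cmod (s1 + z) * Rpower (INR N) (- sigma).
Proof.
intros Hz HN HwN HNM. destruct (Re_shift z Hz) as [Hre Hh].
rewrite AV_defect_diff. eapply Rle_trans; [apply Cmod_triangle_minus|].
rewrite Cmod_opp, !Cmod_mult. apply Rplus_le_compat.
- apply Rmult_le_compat_l; [apply Cmod_ge_0|].
  replace (- (beta - 1)) with (1 - beta) by ring. now apply remainder_sum_le.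
- pose proof (zeta_segment (s1 + z) sigma N M ltac:(lra) Hre Hh HN HwN HNM) as S.
  apply INR_ge_1 in HN as HN'. apply le_INR in HNM as HNM'.
  pose proof (Rpower_antitone (INR N) (INR M) sigma ltac:(lra) ltac:(lra) HNM') as A.
  replace (60 * Cmod zeta2 * Cmod (s1 + z) * Rpower (INR N) (- sigma)) with
    (Cmod zeta2 * (30 * Cmod (s1 + z) * (Rpower (INR N) (- sigma) + Rpower (INR N) (- sigma)))) by ring.
  apply Rmult_le_compat_l; [apply Cmod_ge_0|]. eapply Rle_trans; [apply S|].
  apply Rmult_le_compat_l; [|lra]. pose proof (Cmod_ge_0 (s1 + z)). lra.
Qed.

Variable Z : C -> C.
Hypothesis Hsum : 2 < Re s1 + Re s2 + sigma3.
Hypothesis HZ : is_zetaAV2_slice s1 s2 Z.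

(** In this half-plane [Z] is the double series, the rearrangement costs [O(M^(-1/2))], and
    [M^(1-w)] is itself at most [M^(-1/2)]. The extra 1 in [W] only avoids a division by zero. *)
Lemma AV_defect_center (z : C) : sigma3 <= Re z -> 3 / 2 <= Re s1 + Re z ->
  forall eps, 0 < eps -> exists M0, forall M, (M0 <= M)%nat -> Cmod (AV_defect s1 s2 zeta2 Z M z) <= eps.
Proof.
intros Hz Hw eps He. destruct HZ as [_ HS].
set (W := Cmod (s1 + z - 1) + 1). assert (W1 : 1 <= W) by (unfold W; pose proof (Cmod_ge_0 (s1 + z - 1)); lra).
assert (e1 : 0 < eps / (3 * W)) by (apply Rdiv_lt_0_compat; lra).
destruct (is_series_csum _ _ (HS z ltac:(lra) ltac:(lra)) _ e1) as [M1 H1].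
destruct (Rpower_neg_eventually_le 4 (1 / 2) _ ltac:(lra) e1) as [M2 H2].
destruct (Rpower_neg_eventually_le (Cmod zeta2) (1 / 2) (eps / 3) ltac:(lra) ltac:(lra)) as [M3 H3].
exists (Nat.max (Nat.max M1 M2) (Nat.max M3 2)). intros M HM.
specialize (H1 M ltac:(lia)). specialize (H2 M ltac:(lia)). specialize (H3 M ltac:(lia)).
pose proof (AV_rearrangement s1 s2 z M Hs1 ltac:(lra) ltac:(lra) Hw ltac:(lia)) as R.
fold (AV_partial s1 s2 z M) in R.
unfold AV_defect. eapply Rle_trans; [apply Cmod_triangle_minus|]. rewrite !Cmod_mult.
assert (A : Cmod (Z z - AV_partial s1 s2 z M) <= 2 * (eps / (3 * W))).
{ replace (Z z - AV_partial s1 s2 z M)%C with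
   (- (csum (AV_inner s1 s2 z) M - Z z) + (csum (AV_inner s1 s2 z) M - AV_partial s1 s2 z M))%C by ring.
  eapply Rle_trans; [apply Cmod_triangle|]. rewrite Cmod_opp. lra. }
assert (B : Cmod (s1 + z - 1) * Cmod (Z z - AV_partial s1 s2 z M) <= W * (2 * (eps / (3 * W)))).
{ apply Rmult_le_compat; auto using Cmod_ge_0. unfold W; lra. }
replace (W * (2 * (eps / (3 * W)))) with (2 * eps / 3) in B by (field; lra).
assert (D : Cmod zeta2 * Cmod (npow_neg M (s1 + z - 1)) <= eps / 3).
{ eapply Rle_trans; [|apply H3]. apply Rmult_le_compat_l; [apply Cmod_ge_0|].
  rewrite Cmod_npow_neg. apply Rle_Rpower; [apply INR_ge_1; lia|].
  destruct s1, z; simpl in *. lra. }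
lra.
Qed.

Lemma holo_npow_neg (k : nat) (c z : C) : holo (fun z => npow_neg k (c + z)) z.
Proof.
apply (ex_derive_ext (K := C_AbsRing) (V := AbsRing_NormedModule C_AbsRing)
  (fun z : C => cexp (- (c + z) * RtoC (ln (INR k)))%C)).
- intros u. symmetry. apply npow_neg_cexp.
- apply (holo_comp cexp (fun z => (- (c + z) * RtoC (ln (INR k)))%C)); [apply holo_cexp|].
  apply holo_mult; [|apply holo_const].
  apply (ex_derive_opp (K := C_AbsRing) (V := AbsRing_NormedModule C_AbsRing)).
  apply holo_plus; [apply holo_const|apply holo_id].
Qed.

Lemma holo_ext (f g : C -> C) (z : C) : (forall z, f z = g z) -> holo f z -> holo g z.
Proof. apply (ex_derive_ext (K := C_AbsRing) (V := AbsRing_NormedModule C_AbsRing)). Qed.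

Lemma holo_AV_defect (M : nat) (z : C) : holo Z z -> holo (AV_defect s1 s2 zeta2 Z M) z.
Proof.
intros H. unfold AV_defect. apply holo_minus; [apply holo_mult|apply holo_mult; [apply holo_const|]].
- apply holo_minus; [|apply holo_const]. apply holo_plus; [apply holo_const|apply holo_id].
- apply holo_minus; auto. unfold AV_partial. apply holo_csum. intros k.
  apply holo_mult; [apply holo_const|].
  apply (holo_ext (fun z => npow_neg k (0 + z)%C)); [intros; f_equal; ring|]. apply holo_npow_neg.
- apply (holo_ext (fun z => npow_neg M ((s1 - 1) + z)%C)); [intros; f_equal; ring|]. apply holo_npow_neg.
Qed.

Lemma slice_holo (z : C) : sigma3 <= Re z -> (s1 + z)%C <> RtoC 1 -> holo Z z.
Proof.
intros Hz Hn. apply holo_of_ex_derive. apply HZ. split; [lra|].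
intros l E. destruct l as [|l].
- apply Hn. rewrite E. simpl. f_equal. ring.
(* The remaining excluded points have [Re (s1 + z) <= 0], to the left of [sigma]. *)
- apply (f_equal Re) in E. destruct (Re_shift z Hz) as [B _].
  rewrite E in B. change (Re (RtoC (1 - INR (S l)))) with (1 - INR (S l)) in B.
  rewrite S_INR in B. pose proof (pos_INR l). lra.
Qed.

Hypothesis Him : 0 <= Im s1.

(** The disc is centred at [Re (s1 + z) = 2], at height [t], and its leftmost point is
    [(sigma3, t)]. On the concentric disc of radius [1/2] the double series converges absolutely.
    The pole [s1 + z = 1] is at vertical distance [t + Im s1 >= 2] from the centre, more than the
    radius [2 - sigma < 3/2]. *)
Lemma AV_defect_line (t : R) : 2 <= t -> forall eps, 0 < eps ->
  exists M0, forall M, (M0 <= M)%nat -> Cmod (AV_defect s1 s2 zeta2 Z M (sigma3, t)) <= eps.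
Proof.
intros Ht.
set (p := (2 - Re s1, t) : C). set (r := 2 - sigma).
replace ((sigma3, t) : C) with (p - RtoC r)%C.
2:{ unfold p, r, sigma. apply injective_projections; simpl; ring. }
assert (Hre : forall z, Cmod (z - p) <= r -> sigma3 <= Re z).
{ intros z Hz. pose proof (re_le_Cmod (z - p)) as B. destruct z as [a b]. unfold p in *. simpl in B.
  apply Rabs_le_between in B. simpl. unfold r, sigma in *. lra. }
assert (Hone : forall z, Cmod (z - p) <= r -> (s1 + z)%C <> RtoC 1).
{ intros z Hz E.
  assert (F : (z - p)%C = ((- (1), - (t + Im s1)) : C)).
  { replace z with (RtoC 1 - s1)%C by (rewrite <- E; ring). unfold p. destruct s1 as [a b].
    apply injective_projections; simpl; ring. }
  rewrite F in Hz. pose proof (im_le_Cmod (- (1), - (t + Im s1))) as B.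
  simpl in B. apply Rabs_le_between in B. unfold r in *. lra. }
assert (Hw : forall z, Cmod (z - p) <= r -> Cmod (s1 + z) <= Cmod (s1 + p) + r).
{ intros z Hz. replace (s1 + z)%C with ((s1 + p) + (z - p))%C by ring.
  eapply Rle_trans; [apply Cmod_triangle|]. lra. }
apply (holo_limit_zero (AV_defect s1 s2 zeta2 Z) p r (1 / 2)); [lra|unfold r; lra| | |].
- intros M z Hz. apply holo_AV_defect. apply slice_holo; auto.
- intros eps He. set (W := Cmod (s1 + p) + r + 1).
  assert (W1 : 1 <= W) by (unfold W, r; pose proof (Cmod_ge_0 (s1 + p)); lra).
  assert (e1 : 0 < eps / (2 * W)) by (apply Rdiv_lt_0_compat; lra).
  destruct (Rpower_neg_eventually_le C1 (beta - 1) _ ltac:(lra) e1) as [M1 H1].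
  destruct (Rpower_neg_eventually_le (60 * Cmod zeta2) sigma _ ltac:(lra) e1) as [M2 H2].
  destruct (nfloor_ex (16 * W)) as [M3 [_ H3]]; [lra|].
  exists (Nat.max (Nat.max M1 M2) (S M3)). intros M z HM Hz.
  set (N := Nat.max (Nat.max M1 M2) (S M3)) in *.
  pose proof (Hw z Hz) as w1.
  assert (HN : 16 * Cmod (s1 + z) <= INR N).
  { assert (INR (S M3) <= INR N) by (apply le_INR; unfold N; lia). rewrite S_INR in *. unfold W in *. lra. }
  eapply Rle_trans; [apply AV_defect_cauchy; auto; unfold N; lia|].
  specialize (H1 N ltac:(unfold N; lia)). specialize (H2 N ltac:(unfold N; lia)).
  pose proof (Rpower_pos (INR N) (- (beta - 1))). pose proof (Rpower_pos (INR N) (- sigma)).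
  pose proof C1_nonneg. pose proof (Cmod_ge_0 zeta2).
  assert (Cmod (s1 + z - 1) <= W).
  { eapply Rle_trans; [apply Cmod_triangle_minus|]. rewrite Cmod_1. unfold W; lra. }
  apply Rle_trans with (W * (eps / (2 * W)) + W * (eps / (2 * W))).
  + apply Rplus_le_compat.
    * apply Rmult_le_compat; auto using Cmod_ge_0. apply Rmult_le_pos; lra.
    * replace (60 * Cmod zeta2 * Cmod (s1 + z) * Rpower (INR N) (- sigma)) with
        (Cmod (s1 + z) * (60 * Cmod zeta2 * Rpower (INR N) (- sigma))) by ring.
      apply Rmult_le_compat; auto using Cmod_ge_0.
      -- apply Rmult_le_pos; lra.
      -- unfold W; lra.
  + right. field. lra.
- intros z Hz. apply AV_defect_center.
  + apply Hre. unfold r. lra.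
  + pose proof (re_le_Cmod (z - p)) as B. destruct z as [a b]. unfold p in *. simpl in B.
    apply Rabs_le_between in B. simpl. lra.
Qed.

(** Dividing the definition of the defect by [w1 = s1 + z - 1], with [|w1| >= t], leaves the zeta
    tail and the pole term [N^(1-sigma) / t]. The block of remainders from [N] to [M] stays on the
    left, since it is small only in mean square. *)
Lemma zeta_AV_approx (t : R) (N M : nat) : 2 <= t -> (1 <= N)%nat -> (N <= M)%nat ->
  16 * Cmod (s1 + (sigma3, t)) <= INR N ->
  Cmod (Z (sigma3, t) - AV_partial s1 s2 (sigma3, t) N
    - (csum (fun k => AV_remainder s1 s2 zeta2 k * npow_neg k (sigma3, t))%C M -
       csum (fun k => AV_remainder s1 s2 zeta2 k * npow_neg k (sigma3, t))%C N)) <=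
  C1 * Rpower (INR M) (1 - beta) + 180 * Cmod zeta2 * Rpower (INR N) (- sigma)
   + Cmod zeta2 * Rpower (INR N) (1 - sigma) / t.
Proof.
intros Ht HN HNM HwN. set (z := (sigma3, t) : C) in *.
set (w1 := (s1 + z - 1)%C).
assert (Hz : sigma3 <= Re z) by (simpl; lra).
destruct (Re_shift z Hz) as [Hre Hh].
assert (T1 : t <= Cmod w1).
{ pose proof (im_le_Cmod w1) as B. unfold w1, z in B. destruct s1 as [a b]. simpl in B, Him.
  unfold w1, z. apply Rabs_le_between in B. simpl in *. lra. }
assert (T2 : Cmod (s1 + z) <= 3 / 2 * Cmod w1).
{ replace (s1 + z)%C with (w1 + 1)%C by (unfold w1; ring).
  eapply Rle_trans; [apply Cmod_triangle|]. rewrite Cmod_1. lra. }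
apply le_INR in HNM as HNM'. apply INR_ge_1 in HN as HN'.
set (R := (csum (fun k => AV_remainder s1 s2 zeta2 k * npow_neg k z)%C M -
       csum (fun k => AV_remainder s1 s2 zeta2 k * npow_neg k z)%C N)%C).
set (S := ((s1 + z - 1) * (csum (fun k => npow_neg k (s1 + z)) M - csum (fun k => npow_neg k (s1 + z)) N)
        - (npow_neg N (s1 + z - 1) - npow_neg M (s1 + z - 1)))%C).
assert (E : (w1 * (Z z - AV_partial s1 s2 z N - R) =
   AV_defect s1 s2 zeta2 Z M z + zeta2 * S + zeta2 * npow_neg N (s1 + z - 1))%C).
{ unfold AV_defect, S, R, w1. rewrite !(AV_partial_split s1 s2 zeta2). ring. }
pose proof (zeta_segment (s1 + z) sigma N M ltac:(lra) Hre Hh HN HwN HNM) as HS. fold S in HS.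
pose proof (Rpower_antitone (INR N) (INR M) sigma ltac:(lra) ltac:(lra) HNM') as A.
pose proof (Cmod_ge_0 zeta2) as z0. pose proof (Rpower_pos (INR N) (- sigma)) as pN.
(* The defect tends to 0 on the line, so its value at [M] is bounded by its variation from [M]
   on. *)
assert (HD : Cmod (AV_defect s1 s2 zeta2 Z M z) <= Cmod w1 * (C1 * Rpower (INR M) (1 - beta))
   + 60 * Cmod zeta2 * Cmod (s1 + z) * Rpower (INR N) (- sigma)).
{ apply le_epsilon. intros e He. destruct (AV_defect_line t Ht e He) as [M0 H0].
  set (M' := Nat.max M M0). specialize (H0 M' ltac:(unfold M'; lia)). fold z in H0.
  pose proof (AV_defect_cauchy Z z M M' Hz ltac:(lia) ltac:(lra) ltac:(unfold M'; lia)) as K.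
  fold w1 in K. replace (- (beta - 1)) with (1 - beta) in K by ring.
  replace (AV_defect s1 s2 zeta2 Z M z) with
    (AV_defect s1 s2 zeta2 Z M' z - (AV_defect s1 s2 zeta2 Z M' z - AV_defect s1 s2 zeta2 Z M z))%C by ring.
  eapply Rle_trans; [apply Cmod_triangle_minus|].
  assert (60 * Cmod zeta2 * Cmod (s1 + z) * Rpower (INR M) (- sigma) <=
    60 * Cmod zeta2 * Cmod (s1 + z) * Rpower (INR N) (- sigma)).
  { apply Rmult_le_compat_l; auto. pose proof (Cmod_ge_0 (s1 + z)). apply Rmult_le_pos; lra. }
  lra. }
assert (HN1 : Cmod (npow_neg N (s1 + z - 1)) <= Rpower (INR N) (1 - sigma)).
{ rewrite Cmod_npow_neg. apply Rle_Rpower; auto. unfold sigma, z. destruct s1; simpl. lra. }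
apply Rmult_le_reg_l with (Cmod w1); [lra|]. rewrite <- Cmod_mult, E.
eapply Rle_trans; [apply Cmod_triangle|]. rewrite Cmod_mult.
pose proof (Cmod_triangle (AV_defect s1 s2 zeta2 Z M z) (zeta2 * S)) as Q. rewrite Cmod_mult in Q.
assert (Q1 : Cmod zeta2 * Cmod S <= 60 * Cmod zeta2 * Cmod (s1 + z) * Rpower (INR N) (- sigma)).
{ replace (60 * Cmod zeta2 * Cmod (s1 + z) * Rpower (INR N) (- sigma)) with
    (Cmod zeta2 * (30 * Cmod (s1 + z) * (Rpower (INR N) (- sigma) + Rpower (INR N) (- sigma)))) by ring.
  apply Rmult_le_compat_l; auto. eapply Rle_trans; [apply HS|].
  apply Rmult_le_compat_l; [|lra]. pose proof (Cmod_ge_0 (s1 + z)). lra. }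
(* [180 = 120 * 3/2], the factor [3/2] being that of [|w| <= 3/2 |w1|]. *)
assert (Q2 : 120 * Cmod zeta2 * Cmod (s1 + z) * Rpower (INR N) (- sigma) <=
   Cmod w1 * (180 * Cmod zeta2 * Rpower (INR N) (- sigma))).
{ replace (120 * Cmod zeta2 * Cmod (s1 + z) * Rpower (INR N) (- sigma)) with
    (Cmod (s1 + z) * (120 * Cmod zeta2 * Rpower (INR N) (- sigma))) by ring.
  replace (Cmod w1 * (180 * Cmod zeta2 * Rpower (INR N) (- sigma))) with
    (3 / 2 * Cmod w1 * (120 * Cmod zeta2 * Rpower (INR N) (- sigma))) by field.
  apply Rmult_le_compat_r; auto. apply Rmult_le_pos; lra. }
assert (Q3 : Cmod zeta2 * Cmod (npow_neg N (s1 + z - 1)) <=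
  Cmod w1 * (Cmod zeta2 * Rpower (INR N) (1 - sigma) / t)).
{ pose proof (Rpower_pos (INR N) (1 - sigma)).
  apply Rle_trans with (t * (Cmod zeta2 * Rpower (INR N) (1 - sigma) / t)).
  - replace (t * _) with (Cmod zeta2 * Rpower (INR N) (1 - sigma)) by (field; lra).
    apply Rmult_le_compat_l; auto.
  - apply Rmult_le_compat_r; auto. apply Rmult_le_pos; [apply Rmult_le_pos; lra|].
    left; apply Rinv_0_lt_compat; lra. }
lra.
Qed.
End Continuation.

(** * Mean square of the continuation *)

Lemma Series_tail_le (f : nat -> R) (eta : nat -> R) : (forall k, 0 <= f k) ->
  (forall N M, (1 <= N)%nat -> (N <= M)%nat -> rsum f M - rsum f N <= eta N) ->
  forall N, (1 <= N)%nat -> 0 <= Series f - rsum f N <= eta N.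
Proof.
intros Hf H.
assert (E : forall n, sum_n f n = rsum f (S n)).
{ induction n as [|n IH].
  - rewrite sum_O. simpl. ring.
  - rewrite sum_Sn, IH. reflexivity. }
destruct (ex_finite_lim_seq_incr (sum_n f) (rsum f 1 + eta 1%nat)) as [l Hl].
- intros n. rewrite !E. cbn [rsum]. pose proof (Hf (S n)). lra.
- intros n. rewrite E. pose proof (H 1%nat (S n) ltac:(lia) ltac:(lia)). lra.
- assert (Es : Series f = l) by (apply is_series_unique; exact Hl).
  rewrite Es. intros N HN.
  apply is_lim_seq_incr_n with (N := N) in Hl.
  split.
  + enough (rsum f N <= l) by lra.
    apply (is_lim_seq_le (fun _ => rsum f N) (fun k => sum_n f (k + N)) (rsum f N) l); auto using is_lim_seq_const.
    intros n. rewrite E. apply rsum_seg_nonneg; [lia|auto].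
  + enough (l <= rsum f N + eta N) by lra.
    apply (is_lim_seq_le (fun k => sum_n f (k + N)) (fun _ => rsum f N + eta N) l (rsum f N + eta N));
      auto using is_lim_seq_const.
    intros n. rewrite E. pose proof (H N (S (n + N)) HN ltac:(lia)). lra.
Qed.

(** The cross term is split by [2xy <= x^2 / h + h y^2]. When [|P|^2] has integral of order [U] and
    [|E|^2] a bounded one, the choice [h = U^(1/2)] balances the two parts. *)
Lemma Cmod_sqr_perturb (P E : C) (h : R) : 1 <= h ->
  Rabs (Cmod (P + E) ^ 2 - Cmod P ^ 2) <= / h * Cmod P ^ 2 + 2 * h * Cmod E ^ 2.
Proof.
intros Hh. pose proof (Cmod_triangle P E) as T. pose proof (Cmod_triangle_minus (P + E) E) as T2.
replace (P + E - E)%C with P in T2 by ring.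
pose proof (Cmod_ge_0 P) as p0. pose proof (Cmod_ge_0 E) as e0. pose proof (Cmod_ge_0 (P + E)) as s0.
set (x := Cmod P) in *. set (y := Cmod E) in *. set (s := Cmod (P + E)) in *.
assert (hp : 0 < / h) by (apply Rinv_0_lt_compat; lra).
assert (Q : 2 * x * y <= / h * x ^ 2 + h * y ^ 2).
{ assert (0 <= / h * (x - h * y) ^ 2) by (apply Rmult_le_pos; [lra|apply pow2_ge_0]).
  replace (/ h * (x - h * y) ^ 2) with (/ h * x ^ 2 - 2 * x * y + h * y ^ 2) in H by (field; lra). lra. }
assert (y ^ 2 <= h * y ^ 2) by nra.
apply Rabs_le. split; [|nra].
destruct (Rle_dec y x); nra.
Qed.

Lemma Cmod_sqr_plus_le (P E : C) : Cmod (P + E) ^ 2 <= 2 * Cmod P ^ 2 + 2 * Cmod E ^ 2.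
Proof.
pose proof (Cmod_triangle P E) as T.
pose proof (Cmod_ge_0 P) as p0. pose proof (Cmod_ge_0 E) as e0. pose proof (Cmod_ge_0 (P + E)) as s0.
assert (H : Cmod (P + E) ^ 2 <= (Cmod P + Cmod E) ^ 2) by (apply pow_incr; lra).
pose proof (pow2_ge_0 (Cmod P - Cmod E)). nra.
Qed.

Lemma Cmod_sqr_prod (z : C) : Re z * Re z + Im z * Im z = Cmod z ^ 2.
Proof. rewrite Cmod2_alt. ring. Qed.

Lemma npow_neg_split (k : nat) (x t : R) :
  npow_neg k (x, t) = (npow_neg k (x, 0) * npow_neg k (0, t))%C.
Proof. rewrite <- npow_neg_plus. f_equal. apply injective_projections; simpl; ring. Qed.

Section MeanSquare.
Variables (s1 s2 : C) (sigma3 kappa tau : R) (zeta2 : C) (Cr : R) (Z : C -> C).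
Let sigma := Re s1 + sigma3.
Let beta := sigma + kappa - 1.
Hypothesis Hs1 : 0 <= Re s1.
Hypothesis Hs3 : 0 < sigma3.
Hypothesis Hsig : 1 / 2 < sigma <= 1.
Hypothesis Hkap : 1 < kappa <= Re s2.
Hypothesis Hbeta : 1 < beta.
Hypothesis HCr : 0 <= Cr.
Hypothesis Hrem : forall k, (1 <= k)%nat ->
  Cmod (AV_remainder s1 s2 zeta2 k) <= Cr * Rpower (INR k) (1 - Re s1 - kappa).
Hypothesis Hsum : 2 < Re s1 + Re s2 + sigma3.
Hypothesis HZ : is_zetaAV2_slice s1 s2 Z.
Hypothesis Him : 0 <= Im s1.
Hypothesis Hline : forall t, 2 <= t -> (s1 + (sigma3, t))%C <> RtoC 1.
Hypothesis Htau : 1 / 2 < tau < 1.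
Hypothesis Htausig : tau <= sigma.

Let coef (k : nat) : C := (AV2_inner s1 s2 k * npow_neg k (sigma3, 0))%C.
Let A := Cmod zeta2 + Cr.
Let S := zetaAV2_sq s1 s2 sigma3.

Lemma A_nonneg : 0 <= A.
Proof. unfold A. pose proof (Cmod_ge_0 zeta2). lra. Qed.

Lemma coef_0 : coef O = 0.
Proof. unfold coef. rewrite AV2_inner_csum. simpl. ring. Qed.

Lemma coef_le (k : nat) : (1 <= k)%nat -> Cmod (coef k) <= A * Rpower (INR k) (- tau).
Proof.
intros Hk. apply INR_ge_1 in Hk as K. unfold coef. rewrite Cmod_mult, Cmod_npow_neg. simpl Re.
assert (B : Cmod (AV2_inner s1 s2 k) <= A * Rpower (INR k) (- Re s1)).
{ replace (AV2_inner s1 s2 k) with (AV_remainder s1 s2 zeta2 k + zeta2 * npow_neg k s1)%C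
   by (unfold AV_remainder; ring).
  eapply Rle_trans; [apply Cmod_triangle|]. rewrite Cmod_mult, Cmod_npow_neg.
  assert (Rpower (INR k) (1 - Re s1 - kappa) <= Rpower (INR k) (- Re s1)) by (apply Rle_Rpower; lra).
  pose proof (Hrem k Hk). unfold A. nra. }
apply Rle_trans with (A * Rpower (INR k) (- Re s1) * Rpower (INR k) (- sigma3)).
- apply Rmult_le_compat_r; auto. left; apply Rpower_pos.
- rewrite Rmult_assoc, <- Rpower_plus. apply Rmult_le_compat_l; [apply A_nonneg|].
  apply Rle_Rpower; auto. unfold sigma in *. lra.
Qed.

Let K2 := A ^ 2 * (Rpower 2 (2 * tau) / (2 * tau - 1)).

Lemma K2_nonneg : 0 <= K2.
Proof.
unfold K2. apply Rmult_le_pos; [apply pow2_ge_0|]. apply Rmult_le_pos; [left; apply Rpower_pos|].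
left; apply Rinv_0_lt_compat; lra.
Qed.

Lemma Rpower_sqr (x a : R) : Rpower x a ^ 2 = Rpower x (2 * a).
Proof. replace (2 * a) with (a + a) by ring. rewrite Rpower_plus. ring. Qed.

Lemma diagonal_tail (N : nat) : (1 <= N)%nat ->
  0 <= S - rsum (fun k => Cmod (coef k) ^ 2) N <= K2 * Rpower (INR N) (1 - 2 * tau).
Proof.
intros HN.
assert (E : S = Series (fun k => Cmod (coef k) ^ 2)).
{ unfold S, zetaAV2_sq. apply Series_ext. intros k. unfold coef. rewrite Cmod_mult, Cmod_npow_neg.
  simpl Re. rewrite Rpow_mult_distr, Rpower_sqr. unfold Rpower. f_equal. f_equal. ring. }
rewrite E. apply (Series_tail_le _ (fun N => K2 * Rpower (INR N) (1 - 2 * tau))); auto.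
- intros k. apply pow2_ge_0.
- intros N' M HN' HM. unfold K2.
  apply Rle_trans with (rsum (fun j => A ^ 2 * Rpower (INR j) (- (2 * tau))) M -
    rsum (fun j => A ^ 2 * Rpower (INR j) (- (2 * tau))) N').
  + apply rsum_le_seg; auto. intros k Hk. replace (- (2 * tau)) with (2 * - tau) by ring.
    rewrite <- Rpower_sqr, <- Rpow_mult_distr. apply pow_incr.
    split; [apply Cmod_ge_0|]. apply coef_le. lia.
  + rewrite !rsum_scal, <- Rmult_minus_distr_l, Rmult_assoc.
    apply Rmult_le_compat_l; [apply pow2_ge_0|]. apply rsum_power_gt1; auto. lra.
Qed.

Lemma S_nonneg : 0 <= S.
Proof.
pose proof (diagonal_tail 1 ltac:(lia)) as [H _].
assert (0 <= rsum (fun k => Cmod (coef k) ^ 2) 1).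
{ apply (rsum_seg_nonneg _ 0); [lia|]. intros. apply pow2_ge_0. }
lra.
Qed.

Lemma AV_partial_dpoly (t : R) (N : nat) : AV_partial s1 s2 (sigma3, t) N = dpoly coef N t.
Proof. unfold AV_partial, dpoly, coef. apply csum_ext. intros k _. rewrite npow_neg_split. ring. Qed.

(** Zero below [N], so that the block of remainders is a Dirichlet polynomial to which the mean
    square bound applies. *)
Let rcoef (N k : nat) : C :=
  if (k <? N)%nat then 0 else (AV_remainder s1 s2 zeta2 k * npow_neg k (sigma3, 0))%C.

Lemma rcoef_lt (N k : nat) : (k < N)%nat -> rcoef N k = 0.
Proof. intros H. unfold rcoef. destruct (Nat.ltb_spec k N); [auto|lia]. Qed.

Lemma rcoef_ge (N k : nat) : (N <= k)%nat ->
  rcoef N k = (AV_remainder s1 s2 zeta2 k * npow_neg k (sigma3, 0))%C.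
Proof. intros H. unfold rcoef. destruct (Nat.ltb_spec k N); [lia|auto]. Qed.

Lemma rcoef_le (N k : nat) : (1 <= k)%nat -> Cmod (rcoef N k) <= Cr * Rpower (INR k) (- beta).
Proof.
intros Hk. destruct (Nat.lt_ge_cases k N) as [H|H].
- rewrite rcoef_lt, Cmod_0 by auto. apply Rmult_le_pos; auto. left; apply Rpower_pos.
- rewrite rcoef_ge by auto.
  apply (remainder_term_le s1 s2 sigma3 kappa zeta2 Cr Hrem (sigma3, 0) k); auto. simpl. lra.
Qed.

Lemma remainder_dpoly (t : R) (N M : nat) : (N <= M)%nat ->
  (csum (fun k => AV_remainder s1 s2 zeta2 k * npow_neg k (sigma3, t))%C M -
   csum (fun k => AV_remainder s1 s2 zeta2 k * npow_neg k (sigma3, t))%C N)%C = dpoly (rcoef N) M t.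
Proof.
intros H. unfold dpoly.
rewrite (csum_ext_seg _ (fun k => rcoef N k * npow_neg k (0, t))%C N M H).
2:{ intros k Hk. rewrite rcoef_ge, npow_neg_split by lia. ring. }
rewrite (csum_ext (fun k => rcoef N k * npow_neg k (0, t))%C (fun _ => RtoC 0) N).
- rewrite csum_0. ring.
- intros k Hk. rewrite rcoef_lt by auto. ring.
Qed.

Let K3 := Cr ^ 2 * (Rpower 2 (2 * beta) / (2 * beta - 1)) +
  4 * (2 * Cr ^ 2 * (1 + 2 / (beta - 1)) * (Rpower 2 ((beta + 1) / 2) / ((beta - 1) / 2))).

(** Beyond [N >= U] the diagonal sum is [O(N^(1 - 2 beta)) = O(1/U)], which offsets the length [U];
    the off-diagonal part is bounded because [beta > 1]. Neither bound depends on [M]. *)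
Lemma remainder_mean_square (U : R) (N M : nat) : 1 <= U -> U <= INR N -> (N <= M)%nat ->
  exists I, is_RInt (fun t => Cmod (dpoly (rcoef N) M t) ^ 2) U (2 * U) I /\ I <= K3.
Proof.
intros HU HN HNM.
assert (N1 : (1 <= N)%nat) by (destruct N; [simpl in HN; lra|lia]).
assert (r0 : rcoef N O = 0) by (apply rcoef_lt; lia).
destruct (dirichlet_mean_square (rcoef N) M U (2 * U) r0) as [I [HI BI]].
exists I. split; auto.
pose proof (off_diagonal_bounded (rcoef N) Cr beta M r0 HCr Hbeta ltac:(lia) (rcoef_le N)) as O.
assert (D : rsum (fun k => Cmod (rcoef N k) ^ 2) M <= Cr ^ 2 * (Rpower 2 (2 * beta) / (2 * beta - 1)) * / U).
{ assert (E : rsum (fun k => Cmod (rcoef N k) ^ 2) N = 0).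
  { rewrite (rsum_ext _ (fun _ => 0 * 0)) by (intros k Hk; rewrite rcoef_lt, Cmod_0 by auto; ring).
    rewrite rsum_scal. ring. }
  rewrite <- (Rminus_0_r (rsum _ M)), <- E.
  apply Rle_trans with (rsum (fun j => Cr ^ 2 * Rpower (INR j) (- (2 * beta))) M -
    rsum (fun j => Cr ^ 2 * Rpower (INR j) (- (2 * beta))) N).
  + apply rsum_le_seg; auto. intros k Hk. replace (- (2 * beta)) with (2 * - beta) by ring.
    rewrite <- Rpower_sqr, <- Rpow_mult_distr. apply pow_incr.
    split; [apply Cmod_ge_0|]. apply rcoef_le. lia.
  + rewrite !rsum_scal, <- Rmult_minus_distr_l, Rmult_assoc.
    apply Rmult_le_compat_l; [apply pow2_ge_0|].
    eapply Rle_trans; [apply rsum_power_gt1; auto; lra|].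
    apply Rmult_le_compat_l.
    * apply Rmult_le_pos; [left; apply Rpower_pos|]. left; apply Rinv_0_lt_compat; lra.
    * apply Rle_trans with (Rpower (INR N) (- (1))).
      -- apply Rle_Rpower; lra.
      -- rewrite Rpower_Ropp, Rpower_1 by lra. apply Rinv_le_contravar; lra. }
assert (D2 : (2 * U - U) * rsum (fun k => Cmod (rcoef N k) ^ 2) M <=
   Cr ^ 2 * (Rpower 2 (2 * beta) / (2 * beta - 1))).
{ apply Rle_trans with (U * (Cr ^ 2 * (Rpower 2 (2 * beta) / (2 * beta - 1)) * / U)).
  - replace (2 * U - U) with U by ring. apply Rmult_le_compat_l; lra.
  - right. field. lra. }
apply Rabs_le_between in BI. unfold K3. lra.
Qed.

Lemma Z_line_holo (t : R) : 2 <= t -> holo Z (sigma3, t).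
Proof.
intros Ht. apply (slice_holo s1 s2 sigma3 kappa zeta2 Cr Hs1 Hsig Hbeta Hrem Z Hsum HZ).
- simpl. lra.
- now apply Hline.
Qed.

Lemma Z_sqr_integrable (a b : R) : 2 <= a -> a <= b ->
  ex_RInt (fun t => Cmod (Z (sigma3, t)) ^ 2) a b.
Proof.
intros Ha Hab. apply ex_RInt_cont_le; auto. intros t Ht.
destruct (holo_continuous_vertical Z sigma3 t (Z_line_holo t ltac:(lra))) as [CR CI].
apply (continuous_ext (fun t => Re (Z (sigma3, t)) * Re (Z (sigma3, t)) + Im (Z (sigma3, t)) * Im (Z (sigma3, t)))).
- intros x. apply Cmod_sqr_prod.
- apply (continuous_plus (V := R_NormedModule)); apply (continuous_mult (K := R_AbsRing)); auto.
Qed.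

(** For [t <= 2U] and [U >= 1], [|w| <= 1 + Im s1 + 2U <= (3 + Im s1) U]; so [N >= K0 U] meets the
    Kusmin-Landau condition. *)
Let K0 := 16 * (3 + Im s1).
Let err (T : R) : R := Rpower T (2 - 2 * tau) * (1 + ln T) + Rpower T (1 / 2).

Lemma dyadic_mean_square : exists C0, 0 <= C0 /\ forall U, 2 <= U ->
  Rabs (RInt (fun t => Cmod (Z (sigma3, t)) ^ 2) U (2 * U) - S * U) <= C0 * err U.
Proof.
set (C' := 1 + 180 * Cmod zeta2 + Cmod zeta2 * (K0 + 1)).
set (Q := 4 * (A ^ 2 / (1 - tau)) * (Rpower (K0 + 1) (2 - 2 * tau) * (1 + ln (K0 + 1)))).
assert (z0 := Cmod_ge_0 zeta2).
assert (k0 : 48 <= K0) by (unfold K0; lra).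
assert (C'0 : 0 <= C') by (unfold C'; nra).
assert (lk : 0 <= ln (K0 + 1)) by (rewrite <- ln_1; apply ln_le; lra).
assert (Q0 : 0 <= Q).
{ unfold Q. apply Rmult_le_pos.
  - apply Rmult_le_pos; [lra|]. apply Rmult_le_pos; [apply pow2_ge_0|]. left; apply Rinv_0_lt_compat; lra.
  - apply Rmult_le_pos; [left; apply Rpower_pos|lra]. }
assert (K30 : 0 <= K3).
{ destruct (remainder_mean_square 1 1 1 ltac:(lra) ltac:(simpl; lra) ltac:(lia)) as [I [HI BI]].
  assert (0 <= I); [|lra]. apply (is_RInt_le (fun _ => 0) (fun t => Cmod (dpoly (rcoef 1) 1 t) ^ 2) 1 (2 * 1) 0 I);
    auto using is_RInt_0; [lra|].
  intros; apply pow2_ge_0. }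
assert (S0 := S_nonneg). assert (K20 := K2_nonneg).
exists (2 * Q + K2 + S + 4 * K3 + 4 * C' ^ 2). split; [nra|].
intros U HU.
assert (HU0 : 0 <= K0 * U) by nra.
destruct (nfloor_ex (K0 * U) HU0) as [n0 [Hn1 Hn2]].
set (N := Datatypes.S n0). assert (HN : INR N = INR n0 + 1) by apply S_INR.
assert (NU : K0 * U <= INR N <= (K0 + 1) * U) by nra.
assert (N1 : (1 <= N)%nat) by (unfold N; lia).
assert (UN : U <= INR N) by nra.
assert (pN := Rpower_pos (INR N) (- sigma)).
(* [M] is so large that the remainders beyond it are below [N^(-sigma)]. With [beta] near 1 it may
   be huge, which is harmless as the mean square bound is uniform in [M]. *)
destruct (Rpower_neg_eventually_le (Cr * (Rpower 2 beta / (beta - 1))) (beta - 1) (Rpower (INR N) (- sigma))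
   ltac:(lra) pN) as [M0 HM0].
set (M := Nat.max N M0). specialize (HM0 M ltac:(unfold M; lia)).
assert (NM : (N <= M)%nat) by (unfold M; lia).
destruct (remainder_mean_square U N M ltac:(lra) UN NM) as [IR [HIR BIR]].
destruct (dirichlet_mean_square coef N U (2 * U) coef_0) as [IP [HIP BIP]].
pose proof (off_diagonal_le coef A tau N coef_0 A_nonneg Htau N1 coef_le) as O.
destruct (diagonal_tail N N1) as [D1 D2].
set (h := Rpower U (1 / 2)).
assert (hh : h * h = U).
{ unfold h. rewrite <- Rpower_plus. replace (1 / 2 + 1 / 2) with 1 by field. apply Rpower_1. lra. }
assert (h0 : 0 < h) by apply Rpower_pos.
assert (h1 : 1 <= h) by nra.
assert (EN : Rpower (INR N) (- sigma) <= / h).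
{ apply Rle_trans with (Rpower (INR N) (- (1 / 2))); [apply Rle_Rpower; lra|].
  unfold h. rewrite <- Rpower_Ropp. apply Rpower_antitone; lra. }
(* Everything outside the two polynomials is [O(N^(-sigma))], hence [O(U^(-1/2))]; for the pole
   term, [N / t <= K0 + 1]. *)
assert (Theta : forall t, U <= t <= 2 * U ->
  Cmod (Z (sigma3, t) - dpoly coef N t - dpoly (rcoef N) M t) <= C' * / h).
{ intros t Ht.
  assert (w : 16 * Cmod (s1 + (sigma3, t)) <= INR N).
  { pose proof (Cmod_le_sum (s1 + (sigma3, t))) as B.
    assert (B1 : Re (s1 + (sigma3, t)) = sigma) by (unfold sigma; destruct s1; reflexivity).
    assert (B2 : Im (s1 + (sigma3, t)) = Im s1 + t) by (destruct s1; reflexivity).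
    rewrite B1, B2, !Rabs_pos_eq in B by lra. unfold K0 in *. nra. }
  pose proof (zeta_AV_approx s1 s2 sigma3 kappa zeta2 Cr Hs1 Hs3 Hsig Hkap Hbeta HCr Hrem Z Hsum HZ Him
    t N M ltac:(lra) N1 NM w) as AP.
  rewrite AV_partial_dpoly, remainder_dpoly in AP by auto. eapply Rle_trans; [apply AP|].
  fold sigma. fold beta.
  apply Rle_trans with (C' * Rpower (INR N) (- sigma)); [|apply Rmult_le_compat_l; auto].
  replace (- (beta - 1)) with (1 - beta) in HM0 by ring.
  assert (X : Cmod zeta2 * Rpower (INR N) (1 - sigma) / t <= Cmod zeta2 * (K0 + 1) * Rpower (INR N) (- sigma)).
  { replace (1 - sigma) with (1 + - sigma) by ring. rewrite Rpower_plus, Rpower_1 by lra.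
    unfold Rdiv. replace (Cmod zeta2 * (INR N * Rpower (INR N) (- sigma)) * / t) with
      (Cmod zeta2 * (INR N * / t) * Rpower (INR N) (- sigma)) by ring.
    apply Rmult_le_compat_r; [lra|]. apply Rmult_le_compat_l; auto.
    apply Rmult_le_reg_r with t; [lra|]. rewrite Rmult_assoc, Rinv_l, Rmult_1_r by lra. nra. }
  unfold C'. lra. }
assert (Pt : forall t, U <= t <= 2 * U -> Rabs (Cmod (Z (sigma3, t)) ^ 2 - Cmod (dpoly coef N t) ^ 2) <=
   / h * Cmod (dpoly coef N t) ^ 2 + (4 * h * Cmod (dpoly (rcoef N) M t) ^ 2 + 4 * C' ^ 2 * / h)).
{ intros t Ht. specialize (Theta t Ht).
  set (P := dpoly coef N t) in *. set (Rm := dpoly (rcoef N) M t) in *.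
  set (Th := (Z (sigma3, t) - P - Rm)%C) in *.
  replace (Z (sigma3, t)) with (P + (Rm + Th))%C by (unfold Th; ring).
  eapply Rle_trans; [apply (Cmod_sqr_perturb P (Rm + Th) h h1)|].
  pose proof (Cmod_sqr_plus_le Rm Th) as B.
  assert (T2 : Cmod Th ^ 2 <= (C' * / h) ^ 2) by (apply pow_incr; split; [apply Cmod_ge_0|auto]).
  assert (T3 : 2 * h * Cmod (Rm + Th) ^ 2 <= 2 * h * (2 * Cmod Rm ^ 2 + 2 * (C' * / h) ^ 2)).
  { apply Rmult_le_compat_l; lra. }
  replace (2 * h * (2 * Cmod Rm ^ 2 + 2 * (C' * / h) ^ 2)) with (4 * h * Cmod Rm ^ 2 + 4 * C' ^ 2 * / h) in T3
    by (field; lra). lra. }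
assert (IZ := RInt_correct (V := R_CompleteNormedModule) _ _ _ (Z_sqr_integrable U (2 * U) HU ltac:(lra))).
set (IZv := RInt (fun t => Cmod (Z (sigma3, t)) ^ 2) U (2 * U)) in *.
assert (Diff : Rabs (IZv - IP) <= / h * IP + (4 * h * IR + U * (4 * C' ^ 2 * / h))).
{ apply (norm_RInt_le (V := R_NormedModule) (fun t => Cmod (Z (sigma3, t)) ^ 2 - Cmod (dpoly coef N t) ^ 2)
   (fun t => / h * Cmod (dpoly coef N t) ^ 2 + (4 * h * Cmod (dpoly (rcoef N) M t) ^ 2 + 4 * C' ^ 2 * / h))
   U (2 * U)); auto; [lra| |].
  - apply (is_RInt_minus (V := R_NormedModule)); auto.
  - apply (is_RInt_plus (V := R_NormedModule)); [now apply (is_RInt_scal (V := R_NormedModule))|].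
    apply (is_RInt_plus (V := R_NormedModule)); [now apply (is_RInt_scal (V := R_NormedModule))|].
    pose proof (is_RInt_const (V := R_NormedModule) U (2 * U) (4 * C' ^ 2 * / h)) as Kc.
    replace (2 * U - U) with U in Kc by ring. exact Kc. }
set (L := Rpower U (2 - 2 * tau) * (1 + ln U)).
assert (lU : 0 <= ln U) by (rewrite <- ln_1; apply ln_le; lra).
assert (O' : 4 * rsum (fun l => Cmod (coef l) * near_diagonal coef l) N <= Q * L).
{ apply Rle_trans with (4 * (A ^ 2 / (1 - tau) * (Rpower (INR N) (2 - 2 * tau) * (1 + ln (INR N))))); [lra|].
  replace (Q * L) with (4 * (A ^ 2 / (1 - tau) *
    (Rpower (K0 + 1) (2 - 2 * tau) * ((1 + ln (K0 + 1)) * L)))) by (unfold Q; ring).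
  apply Rmult_le_compat_l; [lra|]. apply Rmult_le_compat_l.
  { apply Rmult_le_pos; [apply pow2_ge_0|]. left; apply Rinv_0_lt_compat; lra. }
  unfold L.
  replace (Rpower (K0 + 1) (2 - 2 * tau) * ((1 + ln (K0 + 1)) * (Rpower U (2 - 2 * tau) * (1 + ln U)))) with
   ((Rpower (K0 + 1) (2 - 2 * tau) * Rpower U (2 - 2 * tau)) * ((1 + ln (K0 + 1)) * (1 + ln U))) by ring.
  rewrite Rpower_mult_distr by lra.
  assert (lnN : ln (INR N) <= ln (K0 + 1) + ln U) by (rewrite <- ln_mult by lra; apply ln_le; lra).
  assert (0 <= ln (INR N)) by (rewrite <- ln_1; apply ln_le; lra).
  apply Rmult_le_compat; [left; apply Rpower_pos|lra| |nra].
  apply Rle_Rpower_l; lra. }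
(* Cutting the diagonal series at [N] loses [U N^(1 - 2 tau)], at most [U^(2 - 2 tau)]. *)
assert (NT : U * (K2 * Rpower (INR N) (1 - 2 * tau)) <= K2 * L).
{ apply Rle_trans with (K2 * (U * Rpower U (1 - 2 * tau))).
  - replace (U * (K2 * Rpower (INR N) (1 - 2 * tau))) with (K2 * (U * Rpower (INR N) (1 - 2 * tau))) by ring.
    apply Rmult_le_compat_l; auto. apply Rmult_le_compat_l; [lra|].
    replace (1 - 2 * tau) with (- (2 * tau - 1)) by ring. apply Rpower_antitone; lra.
  - apply Rmult_le_compat_l; auto. rewrite <- (Rpower_1 U) at 1 by lra. rewrite <- Rpower_plus.
    replace (1 + (1 - 2 * tau)) with (2 - 2 * tau) by ring. unfold L.
    pose proof (Rpower_pos U (2 - 2 * tau)). nra. }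
assert (L0 : 0 <= L) by (unfold L; apply Rmult_le_pos; [left; apply Rpower_pos|lra]).
replace (2 * U - U) with U in BIP by ring. apply Rabs_le_between in BIP.
set (D := rsum (fun k => Cmod (coef k) ^ 2) N) in *.
assert (IPb : IP <= S * U + Q * L) by nra.
assert (IPs : Rabs (IP - S * U) <= Q * L + K2 * L) by (apply Rabs_le; nra).
assert (ih : 0 < / h <= 1).
{ split; [now apply Rinv_0_lt_compat|]. rewrite <- Rinv_1. apply Rinv_le_contravar; lra. }
assert (hU : / h * U = h) by (rewrite <- hh; field; lra).
assert (IPh : / h * IP <= S * h + Q * L).
{ apply Rle_trans with (/ h * (S * U + Q * L)); [apply Rmult_le_compat_l; lra|].
  replace (/ h * (S * U + Q * L)) with (S * (/ h * U) + / h * (Q * L)) by ring. rewrite hU.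
  assert (0 <= Q * L) by (apply Rmult_le_pos; auto). nra. }
assert (IRh : 4 * h * IR <= 4 * h * K3) by (apply Rmult_le_compat_l; lra).
replace (U * (4 * C' ^ 2 * / h)) with (4 * C' ^ 2 * h) in Diff by (transitivity (4 * C' ^ 2 * (/ h * U)); [rewrite hU|]; ring).
replace (IZv - S * U) with ((IZv - IP) + (IP - S * U)) by ring.
eapply Rle_trans; [apply Rabs_triang|]. unfold err. fold h L.
assert (0 <= K2 * h) by (apply Rmult_le_pos; lra). assert (0 <= Q * h) by (apply Rmult_le_pos; lra).
assert (0 <= S * L) by (apply Rmult_le_pos; lra). assert (0 <= K3 * L) by (apply Rmult_le_pos; lra).
assert (0 <= C' ^ 2 * L) by (apply Rmult_le_pos; [apply pow2_ge_0|lra]).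
lra.
Qed.

(** * From dyadic blocks to the whole range *)

Lemma err_pos (T : R) : 1 <= T -> 1 <= err T.
Proof.
intros HT. unfold err. pose proof (Rpower_pos T (2 - 2 * tau)).
assert (0 <= ln T) by (rewrite <- ln_1; apply ln_le; lra).
assert (1 <= Rpower T (1 / 2)).
{ rewrite <- (Rpower_O T) at 1 by lra. apply Rle_Rpower; lra. }
nra.
Qed.

(** The factor gained by [err] when [T] is halved; it is below 1 because both exponents are
    positive, the first one by [tau < 1]. *)
Let rho := Rmax (Rpower 2 (- (2 - 2 * tau))) (Rpower 2 (- (1 / 2))).

Lemma rho_bounds : 0 < rho < 1.
Proof.
unfold rho. split.
- eapply Rlt_le_trans; [|apply Rmax_l]. apply Rpower_pos.
- assert (H : forall a, 0 < a -> Rpower 2 (- a) < 1).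
  { intros a Ha. rewrite <- (Rpower_O 2) by lra. apply Rpower_lt; lra. }
  apply Rmax_lub_lt; apply H; lra.
Qed.

Lemma err_half (T : R) : 2 <= T -> err (T / 2) <= rho * err T.
Proof.
intros HT.
assert (E : forall a, Rpower (T / 2) a = Rpower 2 (- a) * Rpower T a).
{ intros a. unfold Rpower, Rdiv. rewrite <- exp_plus. f_equal. rewrite ln_mult, ln_Rinv by lra. ring. }
unfold err. rewrite !E.
assert (l1 : ln (T / 2) <= ln T) by (apply ln_le; lra).
assert (l2 : 0 <= ln (T / 2)) by (rewrite <- ln_1; apply ln_le; lra).
pose proof (Rpower_pos T (2 - 2 * tau)) as p1. pose proof (Rpower_pos T (1 / 2)) as p2.
pose proof (Rmax_l (Rpower 2 (- (2 - 2 * tau))) (Rpower 2 (- (1 / 2)))) as r1.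
pose proof (Rmax_r (Rpower 2 (- (2 - 2 * tau))) (Rpower 2 (- (1 / 2)))) as r2.
fold rho in r1, r2. pose proof (Rpower_pos 2 (- (2 - 2 * tau))) as p3.
pose proof rho_bounds as rb.
rewrite (Rmult_plus_distr_l rho). apply Rplus_le_compat.
- rewrite <- Rmult_assoc. apply Rmult_le_compat; try lra; nra.
- apply Rmult_le_compat_r; lra.
Qed.

Lemma mean_square_err : exists C0, 0 <= C0 /\ forall T, 2 <= T ->
  Rabs (RInt (fun t => Cmod (Z (sigma3, t)) ^ 2) 2 T - S * T) <= C0 * err T.
Proof.
destruct dyadic_mean_square as [C0 [HC0 HD]]. pose proof rho_bounds as rb.
set (f := fun t => Cmod (Z (sigma3, t)) ^ 2) in *.
set (B0 := RInt f 2 4).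
assert (S0 := S_nonneg).
assert (Pos : forall a b, 2 <= a -> a <= b -> 0 <= RInt f a b).
{ intros a b Ha Hab. apply RInt_ge_0; auto; [now apply Z_sqr_integrable|]. intros. apply pow2_ge_0. }
assert (Ch : forall a b c, 2 <= a -> a <= b -> b <= c -> RInt f a c = RInt f a b + RInt f b c).
{ intros a b c Ha Hab Hbc. symmetry.
  apply (RInt_Chasles (V := R_CompleteNormedModule)); apply Z_sqr_integrable; lra. }
assert (B00 : 0 <= B0) by (apply Pos; lra).
(* [B0 + 4 S] covers [2 <= T <= 4], and [C0 rho / (1 - rho)] sums the geometric series of dyadic
   errors: it makes [(C1 + C0) rho <= C1], which closes the induction. *)
set (C1 := B0 + 4 * S + C0 * rho / (1 - rho)).
assert (i1 : 0 < / (1 - rho)) by (apply Rinv_0_lt_compat; lra).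
assert (C1g : (C1 + C0) * rho <= C1).
{ assert (E : C0 * rho / (1 - rho) * (1 - rho) = C0 * rho) by (field; lra). unfold C1. nra. }
assert (C10 : 0 <= C0 * rho / (1 - rho)).
{ apply Rmult_le_pos; [apply Rmult_le_pos; lra|lra]. }
exists C1. split; [unfold C1; lra|].
(* Induction on the number of halvings that bring [T] down to at most 4. *)
assert (Ind : forall n T, 2 <= T <= 4 * 2 ^ n -> Rabs (RInt f 2 T - S * T) <= C1 * err T).
{ induction n as [|n IH]; intros T HT.
  - simpl in HT. pose proof (err_pos T ltac:(lra)) as E1.
    pose proof (Ch 2 T 4 ltac:(lra) ltac:(lra) ltac:(lra)) as E. fold B0 in E.
    pose proof (Pos 2 T ltac:(lra) ltac:(lra)). pose proof (Pos T 4 ltac:(lra) ltac:(lra)).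
    apply Rle_trans with (C1 * 1); [|apply Rmult_le_compat_l; unfold C1; lra].
    unfold C1. apply Rabs_le. nra.
  - destruct (Rle_dec T 4) as [H4|H4].
    { apply IH. assert (1 <= 2 ^ n) by (apply pow_R1_Rle; lra). lra. }
    simpl in HT. specialize (IH (T / 2) ltac:(lra)). specialize (HD (T / 2) ltac:(lra)).
    replace (2 * (T / 2)) with T in HD by field.
    rewrite (Ch 2 (T / 2) T) by lra.
    replace (RInt f 2 (T / 2) + RInt f (T / 2) T - S * T) with
     ((RInt f 2 (T / 2) - S * (T / 2)) + (RInt f (T / 2) T - S * (T / 2))) by field.
    eapply Rle_trans; [apply Rabs_triang|].
    pose proof (err_half T ltac:(lra)) as E2. pose proof (err_pos T ltac:(lra)) as E1.
    apply Rle_trans with ((C1 + C0) * (rho * err T)).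
    + apply Rle_trans with ((C1 + C0) * err (T / 2)); [lra|].
      apply Rmult_le_compat_l; auto. unfold C1. lra.
    + rewrite <- Rmult_assoc. apply Rmult_le_compat_r; lra. }
intros T HT. destruct (nfloor_ex T ltac:(lra)) as [n [_ Hn]].
apply (Ind n). split; auto.
assert (INR n + 1 <= 2 ^ n * 2).
{ clear. induction n as [|n IH]; [simpl; lra|]. rewrite S_INR. simpl.
  assert (1 <= 2 ^ n) by (apply pow_R1_Rle; lra). lra. }
assert (0 < 2 ^ n) by (apply pow_lt; lra). lra.
Qed.
End MeanSquare.

Theorem theorem1p2 (s1 s2 : C) (sigma3 : R) (Z : C -> C)
  (hs1 : 0 <= Re s1) (hs3 : 0 < sigma3)
  (h13a : 1 / 2 < Re s1 + sigma3) (h13b : Re s1 + sigma3 <= 1)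
  (h123 : 2 < Re s1 + Re s2 + sigma3) (ht1 : 0 <= Im s1)
  (hnohyp : forall t3 : R, 2 <= t3 -> Cplus s1 (sigma3, t3) <> RtoC 1)
  (hZ : is_zetaAV2_slice s1 s2 Z) :
  (Re s1 + sigma3 <= 3 / 4 ->
   exists C0 T0 : R, forall T : R, T0 <= T ->
     Rabs (RInt (fun t3 => Cmod (Z (sigma3, t3)) ^ 2) 2 T
           - zetaAV2_sq s1 s2 sigma3 * T)
     <= C0 * (Rpower T (2 - 2 * Re s1 - 2 * sigma3) * ln T)) /\
  (3 / 4 < Re s1 + sigma3 ->
   exists C0 T0 : R, forall T : R, T0 <= T ->
     Rabs (RInt (fun t3 => Cmod (Z (sigma3, t3)) ^ 2) 2 T
           - zetaAV2_sq s1 s2 sigma3 * T)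
     <= C0 * Rpower T (1 / 2)).
Proof.
(* [Re s2 > 1] follows from the hypotheses, and the cap keeps [kappa < 2]. Then [beta > 1]: by the
   convergence condition if [kappa = Re s2], and by [sigma > 1/2] if [kappa = 7/4]. *)
set (kappa := Rmin (Re s2) (7 / 4)).
assert (hk : 1 < kappa < 2 /\ kappa <= Re s2).
{ unfold kappa. pose proof (Rmin_r (Re s2) (7 / 4)). pose proof (Rmin_l (Re s2) (7 / 4)).
  repeat split; try lra. apply Rmin_glb_lt; lra. }
assert (hb : 1 < Re s1 + sigma3 + kappa - 1).
{ unfold kappa, Rmin. destruct (Rle_dec (Re s2) (7 / 4)); lra. }
destruct (AV2_inner_asymp s1 s2 kappa hs1 (proj1 hk) (proj2 hk)) as (zeta2 & Cr & HCr & Hrem).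
assert (Main : forall tau, 1 / 2 < tau < 1 -> tau <= Re s1 + sigma3 ->
  exists C0, 0 <= C0 /\ forall T, 2 <= T ->
  Rabs (RInt (fun t3 => Cmod (Z (sigma3, t3)) ^ 2) 2 T - zetaAV2_sq s1 s2 sigma3 * T) <=
  C0 * (Rpower T (2 - 2 * tau) * (1 + ln T) + Rpower T (1 / 2))).
{ intros tau Ht Hts.
  apply (mean_square_err s1 s2 sigma3 kappa tau zeta2 Cr Z); auto; lra. }
split; intros H.
(* Here [tau = sigma]: [T^(1/2)] is at most [T^(2 - 2 sigma)], and [T >= 3] exceeds [e], so that
   [1 <= ln T]. *)
- destruct (Main (Re s1 + sigma3) ltac:(lra) ltac:(lra)) as [C0 [HC0 HM]].
  exists (3 * C0), 3. intros T HT. eapply Rle_trans; [apply HM; lra|].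
  replace (2 - 2 * (Re s1 + sigma3)) with (2 - 2 * Re s1 - 2 * sigma3) by ring.
  set (P := Rpower T (2 - 2 * Re s1 - 2 * sigma3)).
  assert (L : 1 <= ln T).
  { rewrite <- (ln_exp 1). apply ln_le; [apply exp_pos|]. pose proof exp_le_3. lra. }
  assert (Q : Rpower T (1 / 2) <= P) by (apply Rle_Rpower; lra).
  assert (P0 : 0 < P) by apply Rpower_pos.
  replace (3 * C0 * (P * ln T)) with (C0 * (3 * (P * ln T))) by ring.
  apply Rmult_le_compat_l; auto. nra.
(* The cap [7/8] keeps [tau] below 1 up to [sigma = 1], yet above [3/4]; the slack
   [d = 1/2 - (2 - 2 tau) > 0] then absorbs the logarithm. *)
- set (tau := Rmin (Re s1 + sigma3) (7 / 8)).
  assert (ht : 3 / 4 < tau < 1 /\ tau <= Re s1 + sigma3).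
  { unfold tau. pose proof (Rmin_r (Re s1 + sigma3) (7 / 8)). pose proof (Rmin_l (Re s1 + sigma3) (7 / 8)).
    repeat split; try lra. apply Rmin_glb_lt; lra. }
  destruct (Main tau ltac:(lra) ltac:(lra)) as [C0 [HC0 HM]].
  set (d := 2 * tau - 3 / 2).
  exists (C0 * (2 + / d)), 2. intros T HT. eapply Rle_trans; [apply HM; lra|].
  rewrite Rmult_assoc. apply Rmult_le_compat_l; auto.
  pose proof (ln_le_power T d ltac:(unfold d; lra) ltac:(lra)) as L.
  replace (Rpower T (1 / 2)) with (Rpower T (2 - 2 * tau) * Rpower T d)
    by (rewrite <- Rpower_plus; f_equal; unfold d; field).
  pose proof (Rpower_pos T (2 - 2 * tau)). nra.
Qed.
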